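(* Let $f\in\mathcal{K}_S$, and let $H_{2,1}(F_{f^{-1}}/2)=\Gamma_1\Gamma_3-\Gamma_2^2$, where $\Gamma_1,\Gamma_2,\Gamma_3$ are the first three logarithmic coefficients of the inverse function $f^{-1}$. Then $$|H_{2,1}(F_{f^{-1}}/2)|\leq \frac1{36} .$$ The inequality is sharp, with extremal function $h_3(z)=\dfrac12\log\left(\dfrac{1+z}{1-z}\right)=z+\dfrac{z^3}{3}+\dfrac{z^5}{5}+\cdots$, $z\in\mathbb{D}$; that is, $h_3\in\mathcal{K}_S$ and $|H_{2,1}(F_{h_3^{-1}}/2)|=\frac1{36}$.
   Context: Let $\mathbb{D}=\{z\in\mathbb{C}:|z|<1\}$, and let $\mathcal{A}$ be the class of holomorphic functions $f$ on $\mathbb{D}$ with $f(0)=0$ and $f'(0)=1$, so that $f(z)=z+\sum_{n=2}^\infty a_nz^n$. The class $\mathcal{K}_S$ of functions convex with respect to symmetric points consists of all $f\in\mathcal{A}$ such that $$\mathrm{Re}\left(\frac{(zf'(z))'}{(f(z)-f(-z))'}\right)>0,\qquad z\in\mathbb{D}.$$ For such $f$, let $F=f^{-1}$ be its inverse function, defined and holomorphic in a neighborhood of the origin, with $F(w)=w+\sum_{n\ge2}A_nw^n$. The logarithmic coefficients $\Gamma_n=\Gamma_n(F)$ of the inverse function are defined by $$\log\left(\frac{F(w)}{w}\right)=2\sum_{n=1}^\infty \Gamma_n w^n\quad\text{near } w=0,\qquad \log 1:=0.$$ The second Hankel determinant of these coefficients is $$H_{2,1}(F_{f^{-1}}/2)=\begin{vmatrix}\Gamma_1&\Gamma_2\\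 \Gamma_2&\Gamma_3\end{vmatrix}=\Gamma_1\Gamma_3-\Gamma_2^2 .$$ In $h_3$, $\log$ denotes the principal branch. *)

(* Defs.v *)
From Stdlib Require Import Reals.
From Coquelicot Require Import Coquelicot.
Open Scope C_scope.

Definition in_disk (z : C) : Prop := (Cmod z < 1)%R.

(* Differentiability is over the field [C], i.e. complex differentiability. *)
Definition C_differentiable_at (f : C -> C) (z : C) : Prop :=
  @ex_derive C_AbsRing C_NormedModule f z.

(* Functions on the disk are represented by total functions [C -> C]; only
   their values on the disk (resp. near 0) are ever constrained. *)
Definition class_A (f : C -> C) : Prop :=
  (forall z : C, in_disk z -> C_differentiable_at f z) /\
  f 0 = 0 /\ C_derive f 0 = 1.

(* Division by zero gives zero in [C], so the strict inequality also forces
   the denominator (f(z) - f(-z))' to be nonzero. *)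
Definition class_KS (f : C -> C) : Prop :=
  class_A f /\
  forall z : C, in_disk z ->
    Rlt 0 (Re (C_derive (fun u => u * C_derive f u) z
               / C_derive (fun u => f u - f (- u)) z)).

Definition local_inverse (f F : C -> C) : Prop :=
  F 0 = 0 /\
  locally (0 : C) (fun w : C => C_differentiable_at F w /\ f (F w) = w) /\
  locally (0 : C) (fun z : C => F (f z) = z).

(* Principal argument, in (-PI, PI] for z <> 0. *)
Definition Carg (z : C) : R :=
  if Rle_dec 0 (Im z) then acos (Re z / Cmod z)
  else (- acos (Re z / Cmod z))%R.

(* Principal branch of the logarithm (z <> 0). *)
Definition Clog (z : C) : C := (ln (Cmod z), Carg z).

(* log (F w / w) = 2 * sum_(n >= 1) G n * w ^ n for w near 0.  Since
   F w / w -> 1, the branch with log 1 = 0 is the principal one near w = 0.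
   The point w = 0 itself, where F w / w stands for its limit 1, is excluded
   (there both sides are 0).  [G 0] is irrelevant. *)
Definition log_coefficients (F : C -> C) (G : nat -> C) : Prop :=
  locally (0 : C) (fun w : C => w <> 0 ->
    @is_series C_AbsRing C_NormedModule
      (fun n => 2 * G (S n) * w ^ S n) (Clog (F w / w))).

Definition hankel21 (G : nat -> C) : C := G 1%nat * G 3%nat - G 2%nat ^ 2.

Definition h3 (z : C) : C := 1 / 2 * Clog ((1 + z) / (1 - z)).

(* Main.v *)
Require Import Defs.
From Stdlib Require Import Reals Lra Lia Psatz Classical ClassicalEpsilon.
From Coquelicot Require Import Coquelicot.
Open Scope C_scope.

(** Let [f] be in the class with Taylor coefficients [a2], [a3], [a4], put
    [A = 2 (z f')'] and [B = (f(z) - f(-z))'].  The defining condition says that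
    [A / B] maps the disk into the right half-plane, so that
    [w = (A - B) / (A + B)] is a Schwarz function: it is holomorphic, bounded by
    one and vanishes at the origin.  Comparing coefficients in
    [w (A + B) = A - B] expresses [a2], [a3], [a4] through the coefficients
    [b1], [b2], [b3] of [w]; comparing coefficients in [f (F w) = w] with
    [F w = w exp (2 sum G_n w^n)] expresses the Hankel determinant [H] through
    [a2], [a3], [a4] ([hankel_formula]).  Together,
[[
    4 H = b1 b3 / 16 - 17/144 b1^2 b2 - b1^4 / 576 - b2^2 / 9.
]]
    With the two estimates [|b1|^2 + |b2|^2 + |b3|^2 <= 1] and
    [|b2| <= 1 - |b1|^2] ([schwarz_coef]) the triangle inequality already gives
    [|4 H| <= 1/9] ([hankel_real_bound]): the term [b1 b3] is absorbed by
    [2 |b1| |b3| <= |b1|^2 + |b3|^2 <= 1 - |b2|^2], what remains increases with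
    [|b2|], and at [|b2| = 1 - |b1|^2] it is at most [1/9].  Both estimates on
    the [b_k] are Bessel's inequality on circles applied to [w (1 + xi z)], for
    [xi = 0] and for the optimal [xi].

    All this rests on the analyticity of complex differentiable functions
    ([taylor]).  Goursat's theorem on rectangles, proved by bisection, is used
    only in logarithmic coordinates, where it says that the mean of a function
    over the circle of radius [r] does not depend on [r] as long as the function
    is holomorphic on the annulus swept out.  Continuity in [r] lets the radius cross a circle carrying an
    exceptional point.  Applied to [u (f u - f z) / (u - z)], whose only bad
    point is [u = z], this gives Cauchy's formula and then the power series.

    For sharpness, [h3] has derivative [1 / (1 - z^2)], which yields its odd
    power series, the membership in the class, and [a2 = a4 = 0],
    [a3 = 1/3], hence [4 H = -1/9].  Its inverse is the hyperbolic tangent. *)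

(** * Complex differentiation *)

Lemma Cmod_minus_sym (z w : C) : Cmod (z - w) = Cmod (w - z).
Proof. rewrite <- Cmod_opp. f_equal. ring. Qed.

Lemma Cmod_triangle_minus (z w : C) : (Cmod (z - w) <= Cmod z + Cmod w)%R.
Proof. unfold Cminus. rewrite <- (Cmod_opp w). apply Cmod_triangle. Qed.

Lemma Cmod_minus_ge (z w : C) : (Cmod z - Cmod w <= Cmod (z - w))%R.
Proof.
  assert (H := Cmod_triangle (z - w) w).
  replace (z - w + w) with z in H by ring. lra.
Qed.

Lemma locally_Cmod (z : C) (P : C -> Prop) :
  locally z P <-> exists d : R, (0 < d)%R /\ forall w, (Cmod (w - z) < d)%R -> P w.
Proof.
  split.
  - intros [d Hd]. exists d. split; [apply cond_pos|].
    intros w Hw. apply Hd. apply C_NormedModule_mixin_compat1. exact Hw.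
  - intros [d [Hd H]].
    assert (Hs : (0 < sqrt 2)%R) by (apply sqrt_lt_R0; lra).
    assert (Hp : (0 < d / sqrt 2)%R) by (apply Rdiv_lt_0_compat; assumption).
    exists (mkposreal _ Hp). intros w Hw. apply H.
    apply C_NormedModule_mixin_compat2 in Hw. simpl in Hw.
    replace (sqrt 2 * (d / sqrt 2))%R with d in Hw by (field; lra). exact Hw.
Qed.

Definition ccont (f : C -> C) (z : C) : Prop :=
  forall e : R, (0 < e)%R -> exists d : R, (0 < d)%R /\
    forall w, (Cmod (w - z) < d)%R -> (Cmod (f w - f z) < e)%R.

(** The difference quotient of [f] at [z], completed by the candidate [l] for
    the derivative.  The test is on [Cmod (w - z)] because equality of complex
    numbers is not decidable by computation. *)
Definition slope (f : C -> C) (z l w : C) : C :=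
  if Rle_dec (Cmod (w - z)) 0 then l else (f w - f z) / (w - z).

(** Caratheodory's form of differentiability: the completed difference quotient is
    continuous.  The calculus rules become identities between slopes, and the
    function integrated in Cauchy's formula is a slope. *)
Definition cderiv (f : C -> C) (z l : C) : Prop := ccont (slope f z l) z.

Lemma slope_at (f : C -> C) (z l : C) : slope f z l z = l.
Proof.
  unfold slope. destruct Rle_dec as [_|H]; [reflexivity|].
  exfalso. apply H. replace (z - z) with (RtoC 0) by ring. rewrite Cmod_0. lra.
Qed.

Lemma slope_off (f : C -> C) (z l w : C) :
  w <> z -> slope f z l w = (f w - f z) / (w - z).
Proof.
  intros Hw. unfold slope. destruct Rle_dec as [H|_]; [|reflexivity].
  exfalso. apply Hw. apply Ceq_minus. apply Cmod_eq_0.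
  apply Rle_antisym; [exact H | apply Cmod_ge_0].
Qed.

Lemma slope_spec (f : C -> C) (z l w : C) : f w = f z + slope f z l w * (w - z).
Proof.
  destruct (classic (w = z)) as [->|H].
  - rewrite slope_at. ring.
  - rewrite slope_off by exact H. field. apply Cminus_eq_contra, H.
Qed.

Lemma ccont_ext_loc (f g : C -> C) (z : C) (d : R) :
  (0 < d)%R -> (forall w, (Cmod (w - z) < d)%R -> f w = g w) -> ccont f z -> ccont g z.
Proof.
  intros Hd Hfg Hf e He. destruct (Hf e He) as [d' [Hd' H]].
  exists (Rmin d d'). split; [apply Rmin_glb_lt; assumption|].
  intros w Hw. rewrite <- !Hfg.
  - apply H. eapply Rlt_le_trans; [exact Hw|apply Rmin_r].
  - replace (z - z) with (RtoC 0) by ring. now rewrite Cmod_0.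
  - eapply Rlt_le_trans; [exact Hw|apply Rmin_l].
Qed.

Lemma ccont_const (c z : C) : ccont (fun _ => c) z.
Proof.
  intros e He. exists 1%R. split; [lra|]. intros w _.
  replace (c - c) with (RtoC 0) by ring. now rewrite Cmod_0.
Qed.

Lemma ccont_id (z : C) : ccont (fun w => w) z.
Proof. intros e He. exists e. auto. Qed.

Lemma ccont_plus (f g : C -> C) (z : C) :
  ccont f z -> ccont g z -> ccont (fun w => f w + g w) z.
Proof.
  intros Hf Hg e He.
  destruct (Hf (e / 2)%R ltac:(lra)) as [d1 [Hd1 H1]].
  destruct (Hg (e / 2)%R ltac:(lra)) as [d2 [Hd2 H2]].
  exists (Rmin d1 d2). split; [apply Rmin_glb_lt; assumption|]. intros w Hw.
  specialize (H1 w (Rlt_le_trans _ _ _ Hw (Rmin_l _ _))).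
  specialize (H2 w (Rlt_le_trans _ _ _ Hw (Rmin_r _ _))).
  replace (f w + g w - (f z + g z)) with ((f w - f z) + (g w - g z)) by ring.
  eapply Rle_lt_trans; [apply Cmod_triangle|]. lra.
Qed.

Lemma ccont_bounded (f : C -> C) (z : C) : ccont f z ->
  exists d : R, (0 < d)%R /\
    forall w, (Cmod (w - z) < d)%R -> (Cmod (f w) <= Cmod (f z) + 1)%R.
Proof.
  intros Hf. destruct (Hf 1%R Rlt_0_1) as [d [Hd H]]. exists d. split; [exact Hd|].
  intros w Hw. specialize (H w Hw). pose proof (Cmod_minus_ge (f w) (f z)). lra.
Qed.

Lemma ccont_mult (f g : C -> C) (z : C) :
  ccont f z -> ccont g z -> ccont (fun w => f w * g w) z.
Proof.
  intros Hf Hg e He.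
  destruct (ccont_bounded f z Hf) as [d0 [Hd0 H0]].
  pose proof (Cmod_ge_0 (f z)) as Pf. pose proof (Cmod_ge_0 (g z)) as Pg.
  set (A := (Cmod (f z) + 1)%R) in *. set (B := (Cmod (g z) + 1)%R).
  assert (HA : (0 < A)%R) by (unfold A; lra). assert (HB : (0 < B)%R) by (unfold B; lra).
  destruct (Hg (e / (2 * A))%R ltac:(apply Rdiv_lt_0_compat; lra)) as [d1 [Hd1 H1]].
  destruct (Hf (e / (2 * B))%R ltac:(apply Rdiv_lt_0_compat; lra)) as [d2 [Hd2 H2]].
  exists (Rmin d0 (Rmin d1 d2)). split; [repeat apply Rmin_glb_lt; assumption|].
  intros w Hw.
  assert (W0 := Rlt_le_trans _ _ _ Hw (Rmin_l _ _)).
  assert (W := Rlt_le_trans _ _ _ Hw (Rmin_r _ _)).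
  specialize (H0 w W0). specialize (H1 w (Rlt_le_trans _ _ _ W (Rmin_l _ _))).
  specialize (H2 w (Rlt_le_trans _ _ _ W (Rmin_r _ _))).
  replace (f w * g w - f z * g z) with (f w * (g w - g z) + (f w - f z) * g z) by ring.
  eapply Rle_lt_trans; [apply Cmod_triangle|]. rewrite !Cmod_mult.
  pose proof (Cmod_ge_0 (f w)). pose proof (Cmod_ge_0 (g w - g z)).
  pose proof (Cmod_ge_0 (f w - f z)).
  assert (X1 : (Cmod (f w) * Cmod (g w - g z) <= A * Cmod (g w - g z))%R)
    by (apply Rmult_le_compat_r; assumption).
  assert (X2 : (A * Cmod (g w - g z) < A * (e / (2 * A)))%R)
    by (apply Rmult_lt_compat_l; assumption).
  assert (X3 : (Cmod (f w - f z) * Cmod (g z) <= Cmod (f w - f z) * B)%R)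
    by (apply Rmult_le_compat_l; [assumption | unfold B; lra]).
  assert (X4 : (Cmod (f w - f z) * B < e / (2 * B) * B)%R)
    by (apply Rmult_lt_compat_r; assumption).
  replace (A * (e / (2 * A)))%R with (e / 2)%R in X2 by (field; lra).
  replace (e / (2 * B) * B)%R with (e / 2)%R in X4 by (field; lra). lra.
Qed.

Lemma ccont_comp (f g : C -> C) (z : C) :
  ccont f z -> ccont g (f z) -> ccont (fun w => g (f w)) z.
Proof.
  intros Hf Hg e He. destruct (Hg e He) as [d [Hd H]].
  destruct (Hf d Hd) as [d' [Hd' H']]. exists d'. auto.
Qed.

Lemma ccont_inv_id (z : C) : z <> 0 -> ccont Cinv z.
Proof.
  intros Hz e He. apply Cmod_gt_0 in Hz as Hm. set (m := Cmod z) in *.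
  exists (Rmin (m / 2) (e * m * m / 2)). split.
  - apply Rmin_glb_lt; [lra|]. pose proof (Rmult_lt_0_compat _ _ (Rmult_lt_0_compat _ _ He Hm) Hm). lra.
  - intros w Hw.
    assert (W1 := Rlt_le_trans _ _ _ Hw (Rmin_l _ _)).
    assert (W2 := Rlt_le_trans _ _ _ Hw (Rmin_r _ _)).
    pose proof (Cmod_minus_ge z w) as T. rewrite Cmod_minus_sym in T. fold m in T.
    assert (Hw0 : w <> 0) by (apply Cmod_gt_0; lra).
    replace (/ w - / z) with ((z - w) * (/ w * / z)) by (field; auto).
    rewrite !Cmod_mult, !Cmod_inv, Cmod_minus_sym by assumption. fold m.
    assert (Hq : (0 < / Cmod w * / m)%R)
      by (apply Rmult_lt_0_compat; apply Rinv_0_lt_compat; lra).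
    apply Rlt_le_trans with (e * m * m / 2 * (/ Cmod w * / m))%R.
    + apply Rmult_lt_compat_r; assumption.
    + replace (e * m * m / 2 * (/ Cmod w * / m))%R with (e * ((m / 2) / Cmod w))%R by (field; lra).
      rewrite <- (Rmult_1_r e) at 2. apply Rmult_le_compat_l; [lra|].
      apply Rle_div_l; lra.
Qed.

Lemma ccont_inv (f : C -> C) (z : C) : f z <> 0 -> ccont f z -> ccont (fun w => / f w) z.
Proof. intros H Hf. apply (ccont_comp f Cinv); [exact Hf | now apply ccont_inv_id]. Qed.

Lemma cderiv_intro (f phi : C -> C) (z : C) (d : R) : (0 < d)%R ->
  (forall w, (Cmod (w - z) < d)%R -> f w = f z + phi w * (w - z)) ->
  ccont phi z -> cderiv f z (phi z).
Proof.
  intros Hd H Hphi. apply (ccont_ext_loc phi _ z d Hd); [|exact Hphi].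
  intros w Hw. destruct (classic (w = z)) as [->|Hn].
  - now rewrite slope_at.
  - rewrite slope_off by exact Hn. rewrite (H w Hw). field. now apply Cminus_eq_contra.
Qed.

Lemma cderiv_ext_loc (f g : C -> C) (z l : C) (d : R) : (0 < d)%R ->
  (forall w, (Cmod (w - z) < d)%R -> f w = g w) -> cderiv f z l -> cderiv g z l.
Proof.
  intros Hd H Hf. rewrite <- (slope_at f z l).
  apply (cderiv_intro g (slope f z l) z d Hd); [|exact Hf].
  intros w Hw. rewrite <- !H; [apply slope_spec | | exact Hw].
  replace (z - z) with (RtoC 0) by ring. now rewrite Cmod_0.
Qed.

Lemma cderiv_ccont (f : C -> C) (z l : C) : cderiv f z l -> ccont f z.
Proof.
  intros H. apply (ccont_ext_loc (fun w => f z + slope f z l w * (w - z)) f z 1 Rlt_0_1).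
  - intros w _. symmetry. apply slope_spec.
  - apply ccont_plus; [apply ccont_const|]. apply ccont_mult; [exact H|].
    apply ccont_plus; [apply ccont_id | apply ccont_const].
Qed.

Lemma cderiv_const (c z : C) : cderiv (fun _ => c) z 0.
Proof.
  apply (cderiv_intro (fun _ => c) (fun _ => 0) z 1 Rlt_0_1); [intros; ring|].
  apply ccont_const.
Qed.

Lemma cderiv_id (z : C) : cderiv (fun w => w) z 1.
Proof.
  apply (cderiv_intro (fun w => w) (fun _ => 1) z 1 Rlt_0_1); [intros; ring|].
  apply ccont_const.
Qed.

Lemma cderiv_plus (f g : C -> C) (z l m : C) :
  cderiv f z l -> cderiv g z m -> cderiv (fun w => f w + g w) z (l + m).
Proof.
  intros Hf Hg.
  pose proof (cderiv_intro (fun w => f w + g w)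
    (fun w => slope f z l w + slope g z m w) z 1 Rlt_0_1) as H.
  cbv beta in H. rewrite !slope_at in H. apply H; [|now apply ccont_plus].
  intros w _. rewrite (slope_spec f z l w), (slope_spec g z m w) at 1. ring.
Qed.

Lemma cderiv_mult (f g : C -> C) (z l m : C) :
  cderiv f z l -> cderiv g z m -> cderiv (fun w => f w * g w) z (l * g z + f z * m).
Proof.
  intros Hf Hg.
  pose proof (cderiv_intro (fun w => f w * g w)
    (fun w => slope f z l w * g w + f z * slope g z m w) z 1 Rlt_0_1) as H.
  cbv beta in H. rewrite !slope_at in H. apply H.
  - intros w _. rewrite (slope_spec f z l w) at 1.
    transitivity (slope f z l w * (w - z) * g w + f z * g w); [ring|].
    rewrite (slope_spec g z m w) at 2. ring.
  - apply ccont_plus; apply ccont_mult; auto using ccont_const.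
    now apply cderiv_ccont with m.
Qed.

Lemma cderiv_comp (f g : C -> C) (z l m : C) :
  cderiv f z l -> cderiv g (f z) m -> cderiv (fun w => g (f w)) z (m * l).
Proof.
  intros Hf Hg.
  pose proof (cderiv_intro (fun w => g (f w))
    (fun w => slope g (f z) m (f w) * slope f z l w) z 1 Rlt_0_1) as H.
  cbv beta in H. rewrite !slope_at in H. apply H.
  - intros w _. rewrite (slope_spec g (f z) m (f w)) at 1.
    rewrite (slope_spec f z l w) at 2. ring.
  - apply ccont_mult; [|exact Hf].
    apply (ccont_comp f (slope g (f z) m)); [now apply cderiv_ccont with l | exact Hg].
Qed.

(** The slope of the inverse at [z] is [- 1 / (w z)]. *)
Lemma cderiv_inv_id (z : C) : z <> 0 -> cderiv Cinv z (- (/ z * / z)).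
Proof.
  intros Hz. apply Cmod_gt_0 in Hz as Hm.
  apply (cderiv_intro Cinv (fun w => - (/ w * / z)) z (Cmod z) Hm).
  - intros w Hw. pose proof (Cmod_minus_ge z w) as T. rewrite Cmod_minus_sym in T.
    assert (Hw0 : w <> 0) by (apply Cmod_gt_0; lra). field. auto.
  - apply (ccont_ext_loc (fun w => (- / z) * / w) _ z 1 Rlt_0_1); [intros; ring|].
    apply ccont_mult; [apply ccont_const | now apply ccont_inv_id].
Qed.

Lemma cderiv_eq (f : C -> C) (z l m : C) : cderiv f z l -> l = m -> cderiv f z m.
Proof. now intros H <-. Qed.

Lemma cderiv_inv (f : C -> C) (z l : C) : f z <> 0 -> cderiv f z l ->
  cderiv (fun w => / f w) z (- l / (f z * f z)).
Proof.
  intros Hz Hf. eapply cderiv_eq.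
  - apply (cderiv_comp f Cinv); [exact Hf | now apply cderiv_inv_id].
  - field. exact Hz.
Qed.

Lemma cderiv_div (f g : C -> C) (z l m : C) : g z <> 0 ->
  cderiv f z l -> cderiv g z m ->
  cderiv (fun w => f w / g w) z ((l * g z - f z * m) / (g z * g z)).
Proof.
  intros Hz Hf Hg. eapply cderiv_eq.
  - apply (cderiv_mult f (fun w => / g w)); [exact Hf | apply cderiv_inv; [exact Hz | exact Hg]].
  - cbv beta. field. exact Hz.
Qed.

Lemma cderiv_minus (f g : C -> C) (z l m : C) :
  cderiv f z l -> cderiv g z m -> cderiv (fun w => f w - g w) z (l - m).
Proof.
  intros Hf Hg. eapply cderiv_eq.
  - apply (cderiv_ext_loc (fun w => f w + (-(1)) * g w) _ z _ 1 Rlt_0_1); [intros; ring|].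
    apply cderiv_plus; [exact Hf|]. apply cderiv_mult; [apply cderiv_const | exact Hg].
  - cbv beta. ring.
Qed.

Lemma cderiv_eps (f : C -> C) (z l : C) : cderiv f z l <->
  forall e : R, (0 < e)%R -> exists d : R, (0 < d)%R /\ forall w, (Cmod (w - z) < d)%R ->
    (Cmod (f w - f z - l * (w - z)) <= e * Cmod (w - z))%R.
Proof.
  split.
  - intros H e He. destruct (H e He) as [d [Hd Hw]]. exists d. split; [exact Hd|].
    intros w W. specialize (Hw w W). rewrite slope_at in Hw.
    rewrite (slope_spec f z l w) at 1.
    replace (f z + slope f z l w * (w - z) - f z - l * (w - z))
      with ((slope f z l w - l) * (w - z)) by ring.
    rewrite Cmod_mult. apply Rmult_le_compat_r; [apply Cmod_ge_0 | lra].
  - intros H e He. destruct (H (e / 2)%R ltac:(lra)) as [d [Hd Hw]].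
    exists d. split; [exact Hd|]. intros w W. specialize (Hw w W). rewrite slope_at.
    destruct (classic (w = z)) as [->|Hn].
    + rewrite slope_at. replace (l - l) with (RtoC 0) by ring. now rewrite Cmod_0.
    + rewrite slope_off by exact Hn. apply Cminus_eq_contra in Hn as Hn'.
      replace ((f w - f z) / (w - z) - l) with ((f w - f z - l * (w - z)) / (w - z))
        by (field; exact Hn').
      apply Cmod_gt_0 in Hn' as Hp. rewrite Cmod_div by exact Hn'.
      apply Rlt_div_l; [exact Hp|]. eapply Rle_lt_trans; [exact Hw|].
      apply Rmult_lt_compat_r; lra.
Qed.

Lemma is_derive_cderiv (f : C -> C) (z l : C) :
  @is_derive C_AbsRing C_NormedModule f z l <-> cderiv f z l.
Proof.
  rewrite cderiv_eps. split.
  - intros [_ H] e He. specialize (H z (fun P HP => HP) (mkposreal e He)).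
    apply locally_C in H. apply (proj1 (locally_Cmod z _)) in H.
    destruct H as [d [Hd H]]. exists d. split; [exact Hd|]. intros w W. specialize (H w W).
    change (Cmod (f w - f z - (w - z) * l) <= e * Cmod (w - z))%R in H.
    now rewrite Cmult_comm in H.
  - intros H. split; [apply is_linear_scal_l|].
    intros x Hx. assert (x = z) as ->.
    { symmetry. apply (is_filter_lim_locally_unique (K := C_AbsRing) (V := AbsRing_NormedModule C_AbsRing)).
      exact Hx. }
    intros e. destruct (H e (cond_pos e)) as [d [Hd W]].
    apply (proj1 (locally_C z _)). apply (proj2 (locally_Cmod z _)).
    exists d. split; [exact Hd|]. intros w Hw. specialize (W w Hw).
    change (Cmod (f w - f z - (w - z) * l) <= e * Cmod (w - z))%R.
    now rewrite (Cmult_comm (w - z)).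
Qed.

Lemma C_differentiable_at_cderiv (f : C -> C) (z : C) :
  C_differentiable_at f z <-> exists l, cderiv f z l.
Proof. split; intros [l H]; exists l; now apply is_derive_cderiv. Qed.

Lemma C_derive_cderiv (f : C -> C) (z l : C) : cderiv f z l -> C_derive f z = l.
Proof. intros H. apply is_C_derive_unique. now apply is_derive_cderiv. Qed.

(** * Integrals of complex functions of a real variable *)

Definition rcont (g : R -> C) (t : R) : Prop :=
  forall e : R, (0 < e)%R -> exists d : R, (0 < d)%R /\
    forall u, (Rabs (u - t) < d)%R -> (Cmod (g u - g t) < e)%R.

Lemma rcont_continuous (g : R -> C) (t : R) :
  rcont g t -> @continuous R_UniformSpace C_UniformSpace g t.
Proof.
  intros H P HP. apply (proj1 (locally_Cmod _ _)) in HP. destruct HP as [e [He HP]].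
  destruct (H e He) as [d [Hd Hu]]. exists (mkposreal d Hd). intros u W.
  apply HP, Hu, W.
Qed.

Lemma continuous_rcont (g : R -> C) (t : R) :
  @continuous R_UniformSpace C_UniformSpace g t -> rcont g t.
Proof.
  intros H e He.
  destruct (H (fun w => (Cmod (w - g t) < e)%R)) as [d Hd].
  - apply locally_Cmod. exists e. auto.
  - exists d. split; [apply cond_pos|]. intros u W. apply Hd, W.
Qed.

Lemma rcont_comp (h : C -> C) (g : R -> C) (t : R) :
  rcont g t -> ccont h (g t) -> rcont (fun u => h (g u)) t.
Proof.
  intros Hg Hh e He. destruct (Hh e He) as [d [Hd H]].
  destruct (Hg d Hd) as [d' [Hd' H']]. exists d'. auto.
Qed.

Lemma rcont_pair (x y : R -> R) (t : R) :
  continuous x t -> continuous y t -> rcont (fun u => (x u, y u)) t.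
Proof.
  intros Hx Hy. apply continuous_rcont. intros P [e HP].
  specialize (Hx _ (locally_ball (x t) e)). specialize (Hy _ (locally_ball (y t) e)).
  unfold filtermap in *. generalize (filter_and _ _ Hx Hy). apply filter_imp.
  intros u [H1 H2]. apply HP. split; assumption.
Qed.

Definition isI (g : R -> C) (a b : R) (l : C) : Prop := @is_RInt C_R_NormedModule g a b l.
Definition CInt (g : R -> C) (a b : R) : C := @RInt C_R_CompleteNormedModule g a b.

Definition rcont_on (g : R -> C) (a b : R) : Prop :=
  forall t, (a <= t <= b)%R -> rcont g t.

Lemma CInt_correct (g : R -> C) (a b : R) : (a <= b)%R ->
  rcont_on g a b -> isI g a b (CInt g a b).
Proof.
  intros Hab H. apply (@RInt_correct C_R_CompleteNormedModule).
  apply (@ex_RInt_continuous C_R_CompleteNormedModule).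
  rewrite Rmin_left, Rmax_right by exact Hab. intros t Ht. apply rcont_continuous, H, Ht.
Qed.

Lemma isI_unique (g : R -> C) (a b : R) (l : C) : isI g a b l -> CInt g a b = l.
Proof. intros H. apply (@is_RInt_unique C_R_CompleteNormedModule). exact H. Qed.

Lemma isI_components (g : R -> C) (a b : R) (l : C) :
  isI g a b l <-> is_RInt (fun t => Re (g t)) a b (Re l) /\ is_RInt (fun t => Im (g t)) a b (Im l).
Proof.
  split.
  - intros H. split.
    + exact (@is_RInt_fct_extend_fst R_NormedModule R_NormedModule g a b l H).
    + exact (@is_RInt_fct_extend_snd R_NormedModule R_NormedModule g a b l H).
  - intros [H1 H2]. destruct l as [x y].
    exact (@is_RInt_fct_extend_pair R_NormedModule R_NormedModule g a b x y H1 H2).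
Qed.

Lemma isI_plus (f g : R -> C) (a b : R) (l m : C) :
  isI f a b l -> isI g a b m -> isI (fun t => f t + g t) a b (l + m).
Proof. exact (@is_RInt_plus C_R_NormedModule f g a b l m). Qed.

Lemma isI_const (c : C) (a b : R) : isI (fun _ => c) a b ((b - a)%R * c).
Proof.
  rewrite <- scal_R_Cmult. exact (@is_RInt_const C_R_NormedModule a b c).
Qed.

Lemma isI_scal (c : C) (g : R -> C) (a b : R) (l : C) :
  isI g a b l -> isI (fun t => c * g t) a b (c * l).
Proof.
  rewrite !isI_components. intros [H1 H2]. split.
  - exact (is_RInt_minus _ _ a b _ _ (is_RInt_scal _ a b (Re c) _ H1) (is_RInt_scal _ a b (Im c) _ H2)).
  - exact (is_RInt_plus _ _ a b _ _ (is_RInt_scal _ a b (Re c) _ H2) (is_RInt_scal _ a b (Im c) _ H1)).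
Qed.

Lemma isI_Chasles (g : R -> C) (a b c : R) (l m : C) :
  isI g a b l -> isI g b c m -> isI g a c (l + m).
Proof. exact (@is_RInt_Chasles C_R_NormedModule g a b c l m). Qed.

Lemma isI_bound (g : R -> C) (a b : R) (l : C) (M : R) : (a <= b)%R ->
  (forall t, (a <= t <= b)%R -> (Cmod (g t) <= M)%R) -> isI g a b l ->
  (Cmod l <= (b - a) * M)%R.
Proof.
  intros Hab H Hl.
  assert (E : forall x : C, Cmod x = @norm R_AbsRing C_R_NormedModule x).
  { intros x. unfold norm. simpl. unfold prod_norm, Cmod. f_equal.
    unfold norm. simpl. unfold abs. simpl. rewrite !Rmult_1_r.
    rewrite <- !Rabs_mult, !Rabs_pos_eq by apply Rle_0_sqr. reflexivity. }
  rewrite E. apply (@norm_RInt_le_const C_R_NormedModule g a b l M Hab); [|exact Hl].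
  intros t Ht. rewrite <- E. now apply H.
Qed.

Lemma isI_Re_ge_0 (g : R -> C) (a b : R) (l : C) : (a <= b)%R ->
  (forall t, (a <= t <= b)%R -> (0 <= Re (g t))%R) -> isI g a b l -> (0 <= Re l)%R.
Proof.
  intros Hab H Hl. apply isI_components in Hl. destruct Hl as [Hl _].
  eapply is_RInt_ge_0; [exact Hab | exact Hl | ]. intros t Ht. apply H. lra.
Qed.

(** * Goursat's theorem on rectangles *)

Definition quarter_gluing (P : R -> R -> R -> R -> Prop) : Prop :=
  forall a b c d, (a <= b)%R -> (c <= d)%R ->
  let m := ((a + b) / 2)%R in let n := ((c + d) / 2)%R in
  P a m c n -> P m b c n -> P a m n d -> P m b n d -> P a b c d.

(** Locating the bad quarter by its lower left corner, rather than by cases, keeps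
    the iteration in [bisection] a sequence of points. *)
Lemma bisection_step (P : R -> R -> R -> R -> Prop) (a b c d : R) :
  quarter_gluing P -> (a <= b)%R -> (c <= d)%R -> ~ P a b c d ->
  exists a' c' : R, ~ P a' (a' + (b - a) / 2)%R c' (c' + (d - c) / 2)%R /\
   (a <= a' <= a + (b - a) / 2)%R /\ (c <= c' <= c + (d - c) / 2)%R.
Proof.
  intros P_glue Hab Hcd HP. apply NNPP. intros Hn. apply HP.
  set (m := ((a + b) / 2)%R). set (n := ((c + d) / 2)%R).
  assert (X : forall a' c', (a <= a' <= a + (b - a) / 2)%R -> (c <= c' <= c + (d - c) / 2)%R ->
    P a' (a' + (b - a) / 2)%R c' (c' + (d - c) / 2)%R).
  { intros a' c' H1 H2. apply NNPP. intros H3. apply Hn. exists a', c'. auto. }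
  apply P_glue; [exact Hab | exact Hcd | | | | ]; fold m n.
  - replace m with (a + (b - a) / 2)%R by (unfold m; field).
    replace n with (c + (d - c) / 2)%R by (unfold n; field). apply X; lra.
  - replace b with (m + (b - a) / 2)%R at 1 by (unfold m; field).
    replace n with (c + (d - c) / 2)%R by (unfold n; field). apply X; unfold m; lra.
  - replace m with (a + (b - a) / 2)%R by (unfold m; field).
    replace d with (n + (d - c) / 2)%R at 1 by (unfold n; field). apply X; unfold n; lra.
  - replace b with (m + (b - a) / 2)%R at 1 by (unfold m; field).
    replace d with (n + (d - c) / 2)%R at 1 by (unfold n; field). apply X; unfold n, m; lra.
Qed.

(** Otherwise nested bad rectangles shrink to a point, and the local hypothesis at
    that point fails.  The small rectangles of that hypothesis are required to
    contain the point: this is what makes the estimate in Goursat's theorem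
    quadratic in their size. *)
Lemma bisection (P : R -> R -> R -> R -> Prop) (a b c d : R) :
  quarter_gluing P -> (a <= b)%R -> (c <= d)%R ->
  (forall x y, (a <= x <= b)%R -> (c <= y <= d)%R -> exists r, (0 < r)%R /\
    forall a' b' c' d', (a <= a' <= x)%R -> (x <= b' <= b)%R -> (c <= c' <= y)%R -> (y <= d' <= d)%R ->
    (b' - a' < r)%R -> (d' - c' < r)%R -> P a' b' c' d') ->
  P a b c d.
Proof.
  intros P_glue Hab Hcd Hloc. apply NNPP. intros HP.
  set (w := fun n : nat => ((b - a) / 2 ^ n)%R). set (v := fun n : nat => ((d - c) / 2 ^ n)%R).
  assert (Hpow : forall n : nat, (0 < 2 ^ n)%R) by (intros n; apply pow_lt; lra).
  assert (Hw : forall n, (0 <= w n)%R) by (intros n; apply Rdiv_le_0_compat; [lra | apply Hpow]).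
  assert (Hv : forall n, (0 <= v n)%R) by (intros n; apply Rdiv_le_0_compat; [lra | apply Hpow]).
  assert (HwS : forall n, w (S n) = (w n / 2)%R).
  { intros n. unfold w. simpl. field. specialize (Hpow n). lra. }
  assert (HvS : forall n, v (S n) = (v n / 2)%R).
  { intros n. unfold v. simpl. field. specialize (Hpow n). lra. }
  set (bad := fun n (p : R * R) => ~ P (fst p) (fst p + w n)%R (snd p) (snd p + v n)%R).
  assert (Hstep : forall n p, exists q, bad n p -> bad (S n) q /\
    (fst p <= fst q <= fst p + w n / 2)%R /\ (snd p <= snd q <= snd p + v n / 2)%R).
  { intros n [x y]. destruct (classic (bad n (x, y))) as [H|H].
    - destruct (bisection_step P x (x + w n) y (y + v n)) as [a' [c' [H1 [H2 H3]]]].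
      + exact P_glue.
      + specialize (Hw n); lra.
      + specialize (Hv n); lra.
      + exact H.
      + exists (a', c'). intros _. unfold bad. simpl. rewrite HwS, HvS.
        replace (x + w n - x)%R with (w n) in * by ring.
        replace (y + v n - y)%R with (v n) in * by ring. auto.
    - exists (x, y). intros H'. contradiction. }
  set (next := fun n p => proj1_sig (constructive_indefinite_description _ (Hstep n p))).
  assert (Hnext : forall n p, bad n p -> bad (S n) (next n p) /\
    (fst p <= fst (next n p) <= fst p + w n / 2)%R /\
    (snd p <= snd (next n p) <= snd p + v n / 2)%R).
  { intros n p. exact (proj2_sig (constructive_indefinite_description _ (Hstep n p))). }
  set (s := fix s (n : nat) : R * R := match n with O => (a, c) | S k => next k (s k) end).
  assert (Hbad : forall n, bad n (s n)).
  { induction n as [|n IH].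
    - unfold bad, w, v. simpl. replace (a + (b - a) / 1)%R with b by field.
      replace (c + (d - c) / 1)%R with d by field. exact HP.
    - apply (Hnext n (s n) IH). }
  assert (Hs : forall n, (fst (s n) <= fst (s (S n)) <= fst (s n) + w n / 2)%R /\
    (snd (s n) <= snd (s (S n)) <= snd (s n) + v n / 2)%R).
  { intros n. exact (proj2 (Hnext n (s n) (Hbad n))). }
  assert (Hlim : forall (f u : nat -> R) (lo hi : R), f O = lo -> (lo + u O)%R = hi ->
    (forall n, (0 <= u n)%R) -> (forall n, u (S n) = (u n / 2)%R) ->
    (forall n, (f n <= f (S n) <= f n + u n / 2)%R) ->
    exists x, forall n, (lo <= f n <= x)%R /\ (x <= f n + u n <= hi)%R).
  { intros f u lo hi E0 E1 Hu HuS Hf.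
    assert (Up : forall n k, (f n <= f (k + n)%nat)%R /\ (f (k + n)%nat + u (k + n)%nat <= f n + u n)%R).
    { intros n. induction k as [|k IH]; simpl; [lra|].
      specialize (Hf (k + n)%nat). rewrite HuS. specialize (Hu (k + n)%nat). lra. }
    destruct (completeness (fun y => exists n, y = f n)) as [x [Hx1 Hx2]].
    - exists hi. intros y [n ->]. destruct (Up O n) as [_ U]. rewrite Nat.add_0_r in U.
      specialize (Hu n). lra.
    - exists (f O). now exists O.
    - exists x. intros n. split; split.
      + destruct (Up O n) as [U _]. rewrite Nat.add_0_r in U. lra.
      + apply Hx1. now exists n.
      + apply Hx2. intros y [k ->]. destruct (Nat.le_ge_cases k n) as [Hk|Hk].
        * destruct (Up k (n - k)%nat) as [U _]. replace (n - k + k)%nat with n in U by lia.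
          specialize (Hu n). lra.
        * destruct (Up n (k - n)%nat) as [_ U]. replace (k - n + n)%nat with k in U by lia.
          specialize (Hu k). lra.
      + destruct (Up O n) as [_ U]. rewrite Nat.add_0_r in U. lra. }
  destruct (Hlim (fun n => fst (s n)) w a b eq_refl ltac:(unfold w; simpl; field) Hw HwS
    (fun n => proj1 (Hs n))) as [x Hx].
  destruct (Hlim (fun n => snd (s n)) v c d eq_refl ltac:(unfold v; simpl; field) Hv HvS
    (fun n => proj2 (Hs n))) as [y Hy].
  destruct (Hloc x y) as [r [Hr Hin]].
  { specialize (Hx O). lra. } { specialize (Hy O). lra. }
  destruct (pow_lt_1_zero (/ 2) ltac:(rewrite Rabs_pos_eq; lra)
    (r / (b - a + (d - c) + 1))%R ltac:(apply Rdiv_lt_0_compat; lra)) as [N HN].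
  specialize (HN N (le_n N)). rewrite Rabs_pos_eq in HN by (apply pow_le; lra).
  rewrite pow_inv in HN. apply Rlt_div_r in HN; [|lra].
  pose proof (Rinv_0_lt_compat _ (Hpow N)) as Hi.
  assert (Hww : (w N < r)%R). { unfold w, Rdiv. nra. }
  assert (Hvv : (v N < r)%R). { unfold v, Rdiv. nra. }
  apply (Hbad N). specialize (Hx N). specialize (Hy N). cbv beta in Hx, Hy.
  apply Hin; lra.
Qed.

(** The integral of [G] along the positively oriented boundary of the rectangle
    with sides [a <= Re z <= b] and [c <= Im z <= d]. *)
Definition bdry (G : C -> C) (a b c d : R) : C :=
  CInt (fun s => G (s, c)) a b + Ci * CInt (fun t => G (b, t)) c d
  - CInt (fun s => G (s, d)) a b - Ci * CInt (fun t => G (a, t)) c d.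

Definition ccont_rect (G : C -> C) (a b c d : R) : Prop :=
  forall s t, (a <= s <= b)%R -> (c <= t <= d)%R -> ccont G (s, t).

Lemma rcont_horizontal (G : C -> C) (s t : R) :
  ccont G (s, t) -> rcont (fun u => G (u, t)) s.
Proof.
  intros H. apply (rcont_comp G (fun u => (u, t))); [|exact H].
  apply rcont_pair; [apply continuous_id | apply continuous_const].
Qed.

Lemma rcont_vertical (G : C -> C) (s t : R) :
  ccont G (s, t) -> rcont (fun u => G (s, u)) t.
Proof.
  intros H. apply (rcont_comp G (fun u => (s, u))); [|exact H].
  apply rcont_pair; [apply continuous_const | apply continuous_id].
Qed.

Lemma isI_horizontal (G : C -> C) (a b c d t : R) : (a <= b)%R -> (c <= t <= d)%R ->
  ccont_rect G a b c d -> isI (fun s => G (s, t)) a b (CInt (fun s => G (s, t)) a b).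
Proof.
  intros Hab Ht H. apply CInt_correct; [exact Hab|]. intros s Hs.
  apply rcont_horizontal, H; assumption.
Qed.

Lemma isI_vertical (G : C -> C) (a b c d s : R) : (c <= d)%R -> (a <= s <= b)%R ->
  ccont_rect G a b c d -> isI (fun t => G (s, t)) c d (CInt (fun t => G (s, t)) c d).
Proof.
  intros Hcd Hs H. apply CInt_correct; [exact Hcd|]. intros t Ht.
  apply rcont_vertical, H; assumption.
Qed.

Lemma ccont_rect_sub (G : C -> C) (a b c d a' b' c' d' : R) :
  ccont_rect G a b c d -> (a <= a')%R -> (b' <= b)%R -> (c <= c')%R -> (d' <= d)%R ->
  ccont_rect G a' b' c' d'.
Proof. intros H ? ? ? ? s t Hs Ht. apply H; lra. Qed.

Lemma bdry_split_h (G : C -> C) (a m b c d : R) : (a <= m <= b)%R -> (c <= d)%R ->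
  ccont_rect G a b c d -> bdry G a b c d = bdry G a m c d + bdry G m b c d.
Proof.
  intros Hm Hcd H. unfold bdry.
  assert (E : forall t, (c <= t <= d)%R -> CInt (fun s => G (s, t)) a b
     = CInt (fun s => G (s, t)) a m + CInt (fun s => G (s, t)) m b).
  { intros t Ht. apply isI_unique. apply isI_Chasles with m; eapply isI_horizontal; try lra;
      (eapply ccont_rect_sub; [exact H | | | | ]; try apply Ht; lra) || exact Ht. }
  rewrite !E by lra. ring.
Qed.

Lemma bdry_split_v (G : C -> C) (a b c n d : R) : (a <= b)%R -> (c <= n <= d)%R ->
  ccont_rect G a b c d -> bdry G a b c d = bdry G a b c n + bdry G a b n d.
Proof.
  intros Hab Hn H. unfold bdry.
  assert (E : forall s, (a <= s <= b)%R -> CInt (fun t => G (s, t)) c d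
     = CInt (fun t => G (s, t)) c n + CInt (fun t => G (s, t)) n d).
  { intros s Hs. apply isI_unique. apply isI_Chasles with n; eapply isI_vertical; try lra;
      (eapply ccont_rect_sub; [exact H | | | | ]; try apply Hs; lra) || exact Hs. }
  rewrite !E by lra. ring.
Qed.

Lemma bdry_plus (G H : C -> C) (a b c d : R) : (a <= b)%R -> (c <= d)%R ->
  ccont_rect G a b c d -> ccont_rect H a b c d ->
  bdry (fun z => G z + H z) a b c d = bdry G a b c d + bdry H a b c d.
Proof.
  intros Hab Hcd HG HH. unfold bdry.
  assert (E1 : forall t, (c <= t <= d)%R -> CInt (fun s => G (s, t) + H (s, t)) a b
     = CInt (fun s => G (s, t)) a b + CInt (fun s => H (s, t)) a b).
  { intros t Ht. apply isI_unique. apply isI_plus; eapply isI_horizontal; eassumption. }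
  assert (E2 : forall s, (a <= s <= b)%R -> CInt (fun t => G (s, t) + H (s, t)) c d
     = CInt (fun t => G (s, t)) c d + CInt (fun t => H (s, t)) c d).
  { intros t Ht. apply isI_unique. apply isI_plus; eapply isI_vertical; eassumption. }
  rewrite !E1, !E2 by lra. ring.
Qed.

Lemma bdry_ext (G H : C -> C) (a b c d : R) : (forall z, G z = H z) ->
  bdry G a b c d = bdry H a b c d.
Proof.
  intros E. unfold bdry, CInt.
  repeat (f_equal; try (apply (@RInt_ext C_R_CompleteNormedModule); intros; apply E)).
Qed.

Lemma bdry_bound (G : C -> C) (a b c d M : R) : (a <= b)%R -> (c <= d)%R ->
  ccont_rect G a b c d ->
  (forall s t, (a <= s <= b)%R -> (c <= t <= d)%R -> (Cmod (G (s, t)) <= M)%R) ->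
  (Cmod (bdry G a b c d) <= 2 * ((b - a) + (d - c)) * M)%R.
Proof.
  intros Hab Hcd HG HM. unfold bdry.
  assert (E1 : forall t, (c <= t <= d)%R -> (Cmod (CInt (fun s => G (s, t)) a b) <= (b - a) * M)%R).
  { intros t Ht. apply isI_bound with (fun s => G (s, t)); auto. eapply isI_horizontal; eassumption. }
  assert (E2 : forall s, (a <= s <= b)%R -> (Cmod (Ci * CInt (fun t => G (s, t)) c d) <= (d - c) * M)%R).
  { intros s Hs. rewrite Cmod_mult, Cmod_Ci, Rmult_1_l. apply isI_bound with (fun t => G (s, t)); auto.
    eapply isI_vertical; eassumption. }
  pose proof (E1 c ltac:(lra)). pose proof (E1 d ltac:(lra)).
  pose proof (E2 a ltac:(lra)). pose proof (E2 b ltac:(lra)).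
  eapply Rle_trans; [apply Cmod_triangle_minus|].
  eapply Rle_trans; [apply Rplus_le_compat_r, Cmod_triangle_minus|].
  eapply Rle_trans; [apply Rplus_le_compat_r, Rplus_le_compat_r, Cmod_triangle|]. lra.
Qed.

Lemma isI_fst_id (a b : R) (y : R) : isI (fun s => (s, y)) a b ((b^2 - a^2)/2, (b - a)*y)%R.
Proof.
  apply isI_components. simpl. split.
  - evar_last.
    + apply (is_RInt_derive (fun s => s^2/2)%R (fun s => s)).
      * intros s _. auto_derive; [trivial | field].
      * intros s _. apply continuous_id.
    + unfold minus, plus, opp. simpl. field.
  - exact (is_RInt_const a b y).
Qed.

Lemma isI_snd_id (c d : R) (x : R) : isI (fun t => (x, t)) c d ((d - c)*x, (d^2-c^2)/2)%R.
Proof.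
  apply isI_components. simpl. split.
  - exact (is_RInt_const c d x).
  - evar_last.
    + apply (is_RInt_derive (fun s => s^2/2)%R (fun s => s)).
      * intros s _. auto_derive; [trivial | field].
      * intros s _. apply continuous_id.
    + unfold minus, plus, opp. simpl. field.
Qed.

(** An affine function has a primitive; here its two pairs of side integrals are
    simply computed. *)
Lemma bdry_affine (u v : C) (a b c d : R) : bdry (fun z => u + v * z) a b c d = 0.
Proof.
  unfold bdry.
  rewrite !(isI_unique _ _ _ _ (isI_plus _ _ _ _ _ _ (isI_const u _ _)
     (isI_scal v _ _ _ _ (isI_fst_id a b _)))).
  rewrite !(isI_unique _ _ _ _ (isI_plus _ _ _ _ _ _ (isI_const u _ _)
     (isI_scal v _ _ _ _ (isI_snd_id c d _)))).
  destruct u as [u1 u2], v as [v1 v2]. unfold Cplus, Cminus, Copp, Cmult, Ci, RtoC. simpl.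
  apply injective_projections; simpl; field.
Qed.

Lemma Cmod_le_abs (x y : R) : (Cmod (x, y) <= Rabs x + Rabs y)%R.
Proof.
  replace ((x, y) : C) with (RtoC x + Ci * RtoC y).
  - eapply Rle_trans; [apply Cmod_triangle|]. rewrite Cmod_mult, Cmod_Ci, !Cmod_R. lra.
  - unfold Cplus, Cmult, Ci, RtoC. simpl. apply injective_projections; simpl; ring.
Qed.

(** The bisected property is [|bdry G| <= e * (half perimeter)^2].  It is additive over
    quarters since each has half the perimeter, and it holds for small
    rectangles around a point because there [G] differs from an affine function
    by at most [e / 2] times the distance to that point. *)
Lemma goursat (G : C -> C) (a b c d : R) : (a <= b)%R -> (c <= d)%R ->
  (forall s t, (a <= s <= b)%R -> (c <= t <= d)%R -> exists l, cderiv G (s, t) l) ->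
  bdry G a b c d = 0.
Proof.
  intros Hab Hcd HG.
  assert (HC : ccont_rect G a b c d).
  { intros s t Hs Ht. destruct (HG s t Hs Ht) as [l Hl]. eapply cderiv_ccont, Hl. }
  assert (Main : forall e, (0 < e)%R -> (Cmod (bdry G a b c d) <= e * ((b - a) + (d - c)) ^ 2)%R).
  { intros e He.
    pose (P := fun a' b' c' d' => ccont_rect G a' b' c' d' ->
       (Cmod (bdry G a' b' c' d') <= e * ((b' - a') + (d' - c')) ^ 2)%R).
    apply (bisection P) with (a := a) (b := b) (c := c) (d := d); try assumption.
    - intros a1 b1 c1 d1 H1 H2 m n P1 P2 P3 P4 HC1.
      assert (Hm : (a1 <= m <= b1)%R) by (unfold m; lra).
      assert (Hn : (c1 <= n <= d1)%R) by (unfold n; lra).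
      rewrite (bdry_split_v G a1 b1 c1 n d1), (bdry_split_h G a1 m b1 c1 n),
        (bdry_split_h G a1 m b1 n d1); try lra; try assumption;
        try (eapply ccont_rect_sub; [exact HC1 | lra ..]).
      specialize (P1 ltac:(eapply ccont_rect_sub; [exact HC1 | lra ..])).
      specialize (P2 ltac:(eapply ccont_rect_sub; [exact HC1 | lra ..])).
      specialize (P3 ltac:(eapply ccont_rect_sub; [exact HC1 | lra ..])).
      specialize (P4 ltac:(eapply ccont_rect_sub; [exact HC1 | lra ..])).
      eapply Rle_trans; [apply Cmod_triangle|].
      eapply Rle_trans; [apply Rplus_le_compat; apply Cmod_triangle|].
      replace (m - a1)%R with ((b1 - a1) / 2)%R in * by (unfold m; field).
      replace (b1 - m)%R with ((b1 - a1) / 2)%R in * by (unfold m; field).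
      replace (n - c1)%R with ((d1 - c1) / 2)%R in * by (unfold n; field).
      replace (d1 - n)%R with ((d1 - c1) / 2)%R in * by (unfold n; field).
      replace (e * (b1 - a1 + (d1 - c1)) ^ 2)%R
        with (4 * (e * ((b1 - a1) / 2 + (d1 - c1) / 2) ^ 2))%R by field. lra.
    - intros x y Hx Hy. destruct (HG x y Hx Hy) as [l Hl].
      destruct (proj1 (cderiv_eps _ _ _) Hl (e / 2)%R ltac:(lra)) as [r [Hr W]].
      exists (r / 2)%R. split; [lra|]. intros a' b' c' d' A B C' D' Sb Sd HC'.
      set (u := G (x, y) - l * (x, y)).
      set (E := fun z => G z - (u + l * z)).
      assert (CA : ccont_rect (fun z => u + l * z) a' b' c' d').
      { intros s t _ _. apply ccont_plus; [apply ccont_const|].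
        apply ccont_mult; [apply ccont_const | apply ccont_id]. }
      assert (CE : ccont_rect E a' b' c' d').
      { intros s t Hs Ht. apply ccont_plus; [now apply HC'|].
        apply (ccont_ext_loc (fun z => (-(1)) * (u + l * z)) _ _ 1 Rlt_0_1); [intros; ring|].
        apply ccont_mult; [apply ccont_const | now apply CA]. }
      replace (bdry G a' b' c' d') with (bdry E a' b' c' d').
      + replace (e * (b' - a' + (d' - c')) ^ 2)%R with
         (2 * ((b' - a') + (d' - c')) * (e / 2 * (b' - a' + (d' - c'))))%R by field.
        apply bdry_bound; try lra; [exact CE|]. intros s t Hs Ht.
        assert (Hd : (Cmod ((s, t) - (x, y)) <= (b' - a') + (d' - c'))%R).
        { change ((s, t) - (x, y)) with (((s - x)%R, (t - y)%R) : C).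
          eapply Rle_trans; [apply Cmod_le_abs|]. apply Rplus_le_compat; apply Rabs_le; lra. }
        unfold E, u.
        replace (G (s, t) - (G (x, y) - l * (x, y) + l * (s, t)))
          with (G (s, t) - G (x, y) - l * ((s, t) - (x, y))) by ring.
        eapply Rle_trans; [apply W; lra|]. apply Rmult_le_compat_l; lra.
      + transitivity (bdry (fun z => (u + l * z) + E z) a' b' c' d').
        * rewrite bdry_plus, bdry_affine; try lra; try assumption. ring.
        * apply bdry_ext. intros z. unfold E. ring. }
  apply Cmod_eq_0. apply Rle_antisym; [|apply Cmod_ge_0].
  apply le_epsilon. intros e He. rewrite Rplus_0_l.
  set (L := ((b - a) + (d - c))%R) in *.
  assert (HL : (0 <= L ^ 2)%R) by apply pow2_ge_0.
  eapply Rle_trans; [apply (Main (e / (L ^ 2 + 1))%R)|].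
  - apply Rdiv_lt_0_compat; lra.
  - replace (e / (L ^ 2 + 1) * L ^ 2)%R with (e * (L^2 / (L ^ 2 + 1)))%R by (field; lra).
    rewrite <- (Rmult_1_r e) at 2. apply Rmult_le_compat_l; [lra|].
    apply Rle_div_l; lra.
Qed.

(** * The complex exponential *)

Definition cexp (z : C) : C := (exp (Re z) * cos (Im z), exp (Re z) * sin (Im z))%R.

Lemma cexp_0 : cexp 0 = 1.
Proof. unfold cexp. simpl. rewrite exp_0, cos_0, sin_0. apply injective_projections; simpl; ring. Qed.

Lemma cexp_plus (z w : C) : cexp (z + w) = cexp z * cexp w.
Proof.
  destruct z as [x y], w as [x' y']. unfold cexp. simpl. rewrite exp_plus, cos_plus, sin_plus.
  apply injective_projections; simpl; ring.
Qed.

Lemma Cmod_cexp (z : C) : Cmod (cexp z) = exp (Re z).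
Proof.
  destruct z as [x y]. unfold cexp, Cmod, Re, Im, fst, snd. pose proof (exp_pos x) as Hp.
  rewrite <- (sqrt_pow2 (exp x)) at 3 by lra. f_equal.
  pose proof (sin2_cos2 y) as H. unfold Rsqr in H.
  transitivity (exp x ^ 2 * (sin y * sin y + cos y * cos y))%R; [ring|].
  rewrite H. ring.
Qed.

Lemma derivable_pt_lim_0_bound (f : R -> R) (l e : R) : derivable_pt_lim f 0 l -> (0 < e)%R ->
  exists d, (0 < d)%R /\ forall x, (Rabs x < d)%R -> (Rabs (f x - f 0 - l * x) <= e * Rabs x)%R.
Proof.
  intros H He. destruct (H e He) as [d Hd]. exists d. split; [apply cond_pos|].
  intros x Hx. destruct (Req_dec x 0) as [->|Hn].
  - replace (f 0 - f 0 - l * 0)%R with 0%R by ring. rewrite Rabs_R0. lra.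
  - specialize (Hd x Hn Hx). rewrite Rplus_0_l in Hd.
    replace (f x - f 0 - l * x)%R with (((f x - f 0) / x - l) * x)%R by (field; exact Hn).
    rewrite Rabs_mult. apply Rmult_le_compat_r; [apply Rabs_pos | lra].
Qed.

Lemma Rabs_Re_le (z : C) : (Rabs (Re z) <= Cmod z)%R.
Proof. apply re_le_Cmod. Qed.

Lemma Rabs_Im_le (z : C) : (Rabs (Im z) <= Cmod z)%R.
Proof. eapply Rle_trans; [apply Rmax_r|]. apply (Rmax_Cmod z). Qed.

(** Write [exp (x + i y) = E U] with [E = exp x], [U = cos y + i sin y].  Then
    [E U - 1 - (x + i y) = (E - 1 - x) + (U - 1 - i y) + (E - 1) (U - 1)]; the first two
    terms are small by the real derivatives at [0], the last one is a product
    of two terms of first order. *)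
Lemma cderiv_cexp_0 : cderiv cexp 0 1.
Proof.
  apply cderiv_eps. intros e He. rewrite cexp_0.
  (* With [k] as accuracy of the real expansions the three terms contribute at
     most [e / 4], [e / 2] and [e / 4] times [Cmod w]. *)
  set (k := Rmin 1 (e / 4)). assert (Hk : (0 < k)%R) by (apply Rmin_glb_lt; lra).
  assert (Hk1 : (k <= 1)%R) by apply Rmin_l. assert (Hk2 : (k <= e / 4)%R) by apply Rmin_r.
  assert (DE : derivable_pt_lim exp 0 1).
  { rewrite <- exp_0. apply derivable_pt_lim_exp. }
  assert (DS : derivable_pt_lim sin 0 1).
  { rewrite <- cos_0. apply derivable_pt_lim_sin. }
  assert (DC : derivable_pt_lim cos 0 0).
  { replace 0%R with (- sin 0)%R at 2 by (rewrite sin_0; ring). apply derivable_pt_lim_cos. }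
  destruct (derivable_pt_lim_0_bound _ _ k DE Hk) as [d1 [Hd1 H1]].
  destruct (derivable_pt_lim_0_bound _ _ k DS Hk) as [d2 [Hd2 H2]].
  destruct (derivable_pt_lim_0_bound _ _ k DC Hk) as [d3 [Hd3 H3]].
  rewrite exp_0 in H1. rewrite sin_0 in H2. rewrite cos_0 in H3.
  exists (Rmin (Rmin d1 d2) (Rmin d3 (e / 24))). split; [repeat apply Rmin_glb_lt; lra|].
  intros w. replace (w - 0) with w by ring. intros Hw.
  assert (W1 : (Cmod w < d1)%R) by (eapply Rlt_le_trans; [exact Hw|]; eapply Rle_trans; apply Rmin_l).
  assert (W2 : (Cmod w < d2)%R) by (eapply Rlt_le_trans; [exact Hw|]; eapply Rle_trans; [apply Rmin_l|apply Rmin_r]).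
  assert (W3 : (Cmod w < d3)%R) by (eapply Rlt_le_trans; [exact Hw|]; eapply Rle_trans; [apply Rmin_r|apply Rmin_l]).
  assert (W4 : (Cmod w < e / 24)%R) by (eapply Rlt_le_trans; [exact Hw|]; eapply Rle_trans; apply Rmin_r).
  pose proof (Rabs_Re_le w) as X. pose proof (Rabs_Im_le w) as Y.
  destruct w as [x y]. simpl in X, Y. set (m := Cmod (x, y)) in *.
  specialize (H1 x ltac:(lra)). specialize (H2 y ltac:(lra)). specialize (H3 y ltac:(lra)).
  pose proof (Rabs_pos x) as Px. pose proof (Rabs_pos y) as Py.
  set (E1 := RtoC (exp x - 1 - x)%R). set (U1 := ((cos y - 1)%R, (sin y - y)%R) : C).
  set (U := ((cos y - 1)%R, sin y) : C).
  replace (cexp (x, y) - 1 - 1 * (x, y)) with (E1 + U1 + RtoC (exp x - 1)%R * U).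
  2:{ unfold E1, U1, U, cexp. apply injective_projections; simpl; ring. }
  assert (B1 : (Cmod E1 <= k * m)%R).
  { unfold E1. rewrite Cmod_R. replace (exp x - 1 - x)%R with (exp x - 1 - 1 * x)%R by ring.
    eapply Rle_trans; [exact H1|]. apply Rmult_le_compat_l; lra. }
  assert (C1 : (Rabs (cos y - 1) <= k * m)%R).
  { replace (cos y - 1)%R with (cos y - 1 - 0 * y)%R by ring.
    eapply Rle_trans; [exact H3|]. apply Rmult_le_compat_l; lra. }
  assert (S1 : (Rabs (sin y - y) <= k * m)%R).
  { replace (sin y - y)%R with (sin y - 0 - 1 * y)%R by ring.
    eapply Rle_trans; [exact H2|]. apply Rmult_le_compat_l; lra. }
  assert (B2 : (Cmod U1 <= 2 * (k * m))%R).
  { unfold U1. eapply Rle_trans; [apply Cmod_le_abs|]. lra. }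
  assert (KM : (k * m <= m)%R) by nra.
  assert (B3 : (Cmod (RtoC (exp x - 1)) <= 2 * m)%R).
  { rewrite Cmod_R. replace (exp x - 1)%R with ((exp x - 1 - 1 * x) + x)%R by ring.
    eapply Rle_trans; [apply Rabs_triang|]. nra. }
  assert (B4 : (Cmod U <= 3 * m)%R).
  { unfold U. eapply Rle_trans; [apply Cmod_le_abs|].
    replace (sin y) with ((sin y - y) + y)%R by ring.
    pose proof (Rabs_triang (sin y - y) y). lra. }
  assert (B5 : (Cmod (RtoC (exp x - 1)%R * U) <= e / 4 * m)%R).
  { rewrite Cmod_mult. eapply Rle_trans.
    - apply Rmult_le_compat; [apply Cmod_ge_0 | apply Cmod_ge_0 | exact B3 | exact B4].
    - nra. }
  assert (KM2 : (k * m <= e / 4 * m)%R) by nra.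
  eapply Rle_trans; [apply Cmod_triangle|].
  eapply Rle_trans; [apply Rplus_le_compat_r, Cmod_triangle|]. lra.
Qed.

Lemma cderiv_cexp (z : C) : cderiv cexp z (cexp z).
Proof.
  apply (cderiv_ext_loc (fun w => cexp z * cexp (w - z)) _ z _ 1 Rlt_0_1).
  - intros w _. rewrite <- cexp_plus. f_equal. ring.
  - eapply cderiv_eq.
    + apply cderiv_mult; [apply cderiv_const|].
      apply (cderiv_comp (fun w => w - z) cexp z 1 1).
      * eapply cderiv_eq; [apply cderiv_minus; [apply cderiv_id | apply cderiv_const] | ring].
      * replace (z - z) with (RtoC 0) by ring. apply cderiv_cexp_0.
    + cbv beta. ring.
Qed.

(** * Means over circles *)

Definition circ (r t : R) : C := (r * cos t, r * sin t)%R.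

Lemma Cmod_circ (r t : R) : (0 <= r)%R -> Cmod (circ r t) = r.
Proof.
  intros Hr. unfold circ, Cmod, fst, snd. rewrite <- (sqrt_pow2 r) at 3 by exact Hr. f_equal.
  pose proof (sin2_cos2 t) as H. unfold Rsqr in H.
  transitivity (r ^ 2 * (sin t * sin t + cos t * cos t))%R; [ring|]. rewrite H. ring.
Qed.

Lemma Cmod_circ_minus (r r' t : R) : Cmod (circ r t - circ r' t) = Rabs (r - r').
Proof.
  transitivity (Cmod (RtoC (r - r') * circ 1 t)).
  - f_equal. unfold circ. apply injective_projections; simpl; ring.
  - rewrite Cmod_mult, Cmod_R, Cmod_circ by lra. ring.
Qed.

Lemma circ_cexp (r t : R) : (0 < r)%R -> circ r t = cexp (ln r, t).
Proof. intros Hr. unfold circ, cexp. simpl. now rewrite exp_ln. Qed.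

Lemma rcont_circ (r t : R) : rcont (circ r) t.
Proof.
  apply rcont_pair;
  apply (ex_derive_continuous (K := R_AbsRing) (V := R_NormedModule)); auto_derive; trivial.
Qed.

Definition cont_circle (h : C -> C) (r : R) : Prop := forall u, Cmod u = r -> ccont h u.

Definition mean (h : C -> C) (r : R) : C :=
  CInt (fun t => h (circ r t)) 0 (2 * PI) * RtoC (/ (2 * PI)).

Lemma two_PI_pos : (0 < 2 * PI)%R.
Proof. pose proof PI_RGT_0. lra. Qed.

Lemma isI_circle (h : C -> C) (r : R) : (0 <= r)%R -> cont_circle h r ->
  isI (fun t => h (circ r t)) 0 (2 * PI) (mean h r * RtoC (2 * PI)).
Proof.
  intros Hr H. pose proof two_PI_pos as HP.
  replace (mean h r * RtoC (2 * PI)) with (CInt (fun t => h (circ r t)) 0 (2 * PI)).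
  - apply CInt_correct; [lra|]. intros t _. apply rcont_comp; [apply rcont_circ|].
    apply H, Cmod_circ, Hr.
  - unfold mean. rewrite RtoC_inv by lra. field. intros E. apply RtoC_inj in E. lra.
Qed.

Lemma mean_intro (h : C -> C) (r : R) (l : C) :
  isI (fun t => h (circ r t)) 0 (2 * PI) (l * RtoC (2 * PI)) -> mean h r = l.
Proof.
  intros H. unfold mean. rewrite (isI_unique _ _ _ _ H). pose proof two_PI_pos as HP.
  rewrite RtoC_inv by lra. field. intros E. apply RtoC_inj in E. lra.
Qed.

Lemma mean_ext (g h : C -> C) (r : R) : (0 <= r)%R ->
  (forall u, Cmod u = r -> g u = h u) -> mean g r = mean h r.
Proof.
  intros Hr H. unfold mean, CInt. f_equal. apply (@RInt_ext C_R_CompleteNormedModule).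
  intros t _. apply H, Cmod_circ, Hr.
Qed.

Lemma mean_plus (g h : C -> C) (r : R) : (0 <= r)%R -> cont_circle g r -> cont_circle h r ->
  mean (fun u => g u + h u) r = mean g r + mean h r.
Proof.
  intros Hr Hg Hh. apply mean_intro. rewrite Cmult_plus_distr_r.
  apply isI_plus; apply isI_circle; assumption.
Qed.

Lemma mean_scal (c : C) (h : C -> C) (r : R) : (0 <= r)%R -> cont_circle h r ->
  mean (fun u => c * h u) r = c * mean h r.
Proof.
  intros Hr Hh. apply mean_intro. rewrite <- Cmult_assoc. apply isI_scal, isI_circle; assumption.
Qed.

Lemma mean_cst (c : C) (r : R) : mean (fun _ => c) r = c.
Proof.
  apply mean_intro. rewrite Cmult_comm. rewrite <- (Rminus_0_r (2 * PI)) at 2. apply isI_const.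
Qed.

Lemma mean_0 (h : C -> C) : mean h 0 = h 0.
Proof.
  transitivity (mean (fun _ => h 0) 0); [|apply mean_cst].
  apply mean_ext; [lra|]. intros u Hu. apply Cmod_eq_0 in Hu. now subst.
Qed.

Lemma mean_bound (h : C -> C) (r M : R) : (0 <= r)%R -> cont_circle h r ->
  (forall u, Cmod u = r -> (Cmod (h u) <= M)%R) -> (Cmod (mean h r) <= M)%R.
Proof.
  intros Hr Hh HM. pose proof two_PI_pos as HP.
  pose proof (isI_bound _ 0 (2 * PI) _ M ltac:(lra) (fun t _ => HM _ (Cmod_circ r t Hr))
    (isI_circle h r Hr Hh)) as H.
  rewrite Cmod_mult, Cmod_R, Rabs_pos_eq in H by lra. nra.
Qed.

Lemma mean_Re_ge_0 (h : C -> C) (r : R) : (0 <= r)%R -> cont_circle h r ->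
  (forall u, Cmod u = r -> (0 <= Re (h u))%R) -> (0 <= Re (mean h r))%R.
Proof.
  intros Hr Hh H0. pose proof two_PI_pos as HP.
  pose proof (isI_Re_ge_0 _ 0 (2 * PI) _ ltac:(lra) (fun t _ => H0 _ (Cmod_circ r t Hr))
    (isI_circle h r Hr Hh)) as H.
  rewrite re_scal_r in H. nra.
Qed.

(** Compactness of an interval: a local uniformity becomes global.  This is the
    bisection principle on degenerate rectangles. *)
Lemma interval_uniform (Q : R -> R -> Prop) (a b : R) : (a <= b)%R ->
  (forall t, (a <= t <= b)%R -> exists d e, (0 < d)%R /\ (0 < e)%R /\
     forall s, (Rabs (s - t) < d)%R -> forall x, (0 < x < e)%R -> Q s x) ->
  exists e, (0 < e)%R /\ forall s, (a <= s <= b)%R -> forall x, (0 < x < e)%R -> Q s x.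
Proof.
  intros Hab H.
  apply (bisection (fun a b _ _ => exists e, (0 < e)%R /\
     forall s, (a <= s <= b)%R -> forall x, (0 < x < e)%R -> Q s x)) with (c := 0%R) (d := 0%R);
   [ | exact Hab | lra | ].
  - intros a1 b1 _ _ H1 _ m _ [e1 [He1 Q1]] [e2 [He2 Q2]] _ _.
    exists (Rmin e1 e2). split; [now apply Rmin_glb_lt|]. intros s Hs x Hx.
    assert (Hx1 : (x < e1)%R) by (eapply Rlt_le_trans; [apply Hx | apply Rmin_l]).
    assert (Hx2 : (x < e2)%R) by (eapply Rlt_le_trans; [apply Hx | apply Rmin_r]).
    destruct (Rle_dec s m); [apply Q1 | apply Q2]; lra.
  - intros t y Ht _. destruct (H t Ht) as [d [e [Hd [He Hq]]]]. exists d. split; [exact Hd|].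
    intros a' b' _ _ A B _ _ D _. exists e. split; [exact He|]. intros s Hs.
    apply Hq. apply Rabs_def1; lra.
Qed.

Lemma circle_bounded (h : C -> C) (r : R) : (0 <= r)%R -> cont_circle h r ->
  exists M, (0 <= M)%R /\ forall t, (0 <= t <= 2 * PI)%R -> (Cmod (h (circ r t)) <= M)%R.
Proof.
  intros Hr Hh. pose proof two_PI_pos as HP.
  destruct (interval_uniform (fun s x => (Cmod (h (circ r s)) <= / x)%R) 0 (2 * PI) ltac:(lra))
    as [e [He H]].
  - intros t _.
    destruct (rcont_comp h (circ r) t (rcont_circ r t) (Hh _ (Cmod_circ r t Hr)) 1%R Rlt_0_1)
      as [d [Hd Hu]].
    pose proof (Cmod_ge_0 (h (circ r t))) as P0.
    exists d, (/ (Cmod (h (circ r t)) + 1))%R. split; [exact Hd|].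
    split; [apply Rinv_0_lt_compat; lra|].
    intros s Hs x Hx. specialize (Hu s Hs).
    pose proof (Cmod_minus_ge (h (circ r s)) (h (circ r t))).
    apply Rle_trans with (Cmod (h (circ r t)) + 1)%R; [lra|].
    rewrite <- (Rinv_inv (Cmod (h (circ r t)) + 1)). apply Rinv_le_contravar; lra.
  - exists (/ (e / 2))%R. split; [apply Rlt_le, Rinv_0_lt_compat; lra|].
    intros t Ht. apply H; [exact Ht | lra].
Qed.

(** A multiplicative form of the bound by the maximum on the circle: a single
    constant serves for all functions dominated by multiples of [h]. *)
Lemma mean_bound_ex (h : C -> C) (r : R) : (0 <= r)%R -> cont_circle h r ->
  exists M, (0 <= M)%R /\ forall (g : C -> C) (q : R), (0 <= q)%R -> cont_circle g r ->
    (forall u, Cmod u = r -> (Cmod (g u) <= q * Cmod (h u))%R) -> (Cmod (mean g r) <= q * M)%R.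
Proof.
  intros Hr Hh. destruct (circle_bounded h r Hr Hh) as [M [HM H]]. exists M.
  split; [exact HM|]. intros g q Hq Hg Hgq. pose proof two_PI_pos as HP.
  assert (B : forall t, (0 <= t <= 2 * PI)%R -> (Cmod (g (circ r t)) <= q * M)%R).
  { intros t Ht. eapply Rle_trans; [apply Hgq, Cmod_circ, Hr|].
    apply Rmult_le_compat_l; auto. }
  pose proof (isI_bound _ 0 (2 * PI) _ _ ltac:(lra) B (isI_circle g r Hr Hg)) as H'.
  rewrite Cmod_mult, Cmod_R, Rabs_pos_eq in H' by lra. nra.
Qed.

Lemma mean_continuous (h : C -> C) (Rad r0 : R) : (0 <= r0 < Rad)%R ->
  (forall u, (Cmod u < Rad)%R -> ccont h u) ->
  forall e, (0 < e)%R -> exists d, (0 < d)%R /\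
    forall r, (0 <= r < Rad)%R -> (Rabs (r - r0) < d)%R -> (Cmod (mean h r - mean h r0) <= e)%R.
Proof.
  intros Hr0 Hh e He. pose proof two_PI_pos as HP.
  assert (Hc : forall r, (0 <= r < Rad)%R -> cont_circle h r).
  { intros r Hr u Hu. apply Hh. lra. }
  destruct (interval_uniform (fun t x => forall r, (Rabs (r - r0) < x)%R ->
     (Cmod (h (circ r t) - h (circ r0 t)) <= e)%R) 0 (2 * PI) ltac:(lra)) as [d [Hd H]].
  - intros t _.
    destruct (Hh (circ r0 t) ltac:(rewrite Cmod_circ; lra) (e / 2)%R ltac:(lra)) as [d1 [Hd1 H1]].
    destruct (rcont_circ r0 t (d1 / 2)%R ltac:(lra)) as [d2 [Hd2 H2]].
    exists d2, (d1 / 2)%R. split; [exact Hd2|]. split; [lra|].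
    intros s Hs x Hx r Hr. specialize (H2 s Hs).
    assert (A1 : (Cmod (h (circ r0 s) - h (circ r0 t)) < e / 2)%R) by (apply H1; lra).
    assert (A2 : (Cmod (h (circ r s) - h (circ r0 t)) < e / 2)%R).
    { apply H1. replace (circ r s - circ r0 t) with
        ((circ r s - circ r0 s) + (circ r0 s - circ r0 t)) by ring.
      eapply Rle_lt_trans; [apply Cmod_triangle|]. rewrite Cmod_circ_minus. lra. }
    replace (h (circ r s) - h (circ r0 s)) with
      ((h (circ r s) - h (circ r0 t)) - (h (circ r0 s) - h (circ r0 t))) by ring.
    eapply Rle_trans; [apply Cmod_triangle_minus|]. lra.
  - exists (d / 2)%R. split; [lra|]. intros r Hr Hrr.
    pose proof (isI_circle h r ltac:(lra) (Hc r Hr)) as I1.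
    pose proof (isI_circle h r0 ltac:(lra) (Hc r0 Hr0)) as I0.
    pose proof (isI_plus _ _ _ _ _ _ I1 (isI_scal (-(1)) _ _ _ _ I0)) as I2.
    apply (isI_bound _ 0 (2 * PI) _ e) in I2; [|lra|].
    + replace (mean h r * RtoC (2 * PI) + - (1) * (mean h r0 * RtoC (2 * PI)))
        with ((mean h r - mean h r0) * RtoC (2 * PI)) in I2 by ring.
      rewrite Cmod_mult, Cmod_R, Rabs_pos_eq in I2 by lra. nra.
    + intros t Ht. replace (h (circ r t) + - (1) * h (circ r0 t))
        with (h (circ r t) - h (circ r0 t)) by ring.
      apply (H t Ht (d / 2)%R); lra.
Qed.

(** The exponential pulls the annulus back to a rectangle of height [2 PI]; by
    periodicity the horizontal sides cancel in Goursat's theorem, and the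
    vertical sides are the two means. *)
Lemma mean_annulus (h : C -> C) (r1 r2 : R) : (0 < r1 <= r2)%R ->
  (forall u, (r1 <= Cmod u <= r2)%R -> exists l, cderiv h u l) -> mean h r1 = mean h r2.
Proof.
  intros Hr Hh. pose proof two_PI_pos as HP.
  assert (Hln : (ln r1 <= ln r2)%R).
  { destruct (Req_dec r1 r2) as [->|]; [lra|]. apply Rlt_le, ln_increasing; lra. }
  pose (G := fun z => h (cexp z)).
  assert (B : bdry G (ln r1) (ln r2) 0 (2 * PI) = 0).
  { apply goursat; [exact Hln | lra |]. intros s t Hs _.
    destruct (Hh (cexp (s, t))) as [l Hl].
    - rewrite Cmod_cexp. simpl. split.
      + rewrite <- (exp_ln r1) by lra. destruct (Req_dec (ln r1) s) as [->|]; [lra|].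
        apply Rlt_le, exp_increasing. lra.
      + rewrite <- (exp_ln r2) by lra. destruct (Req_dec (ln r2) s) as [->|]; [lra|].
        apply Rlt_le, exp_increasing. lra.
    - exists (l * cexp (s, t)). apply (cderiv_comp cexp h); [apply cderiv_cexp | exact Hl]. }
  unfold bdry in B.
  assert (E0 : CInt (fun s => G (s, (2 * PI)%R)) (ln r1) (ln r2) = CInt (fun s => G (s, 0%R)) (ln r1) (ln r2)).
  { apply (@RInt_ext C_R_CompleteNormedModule). intros s _. unfold G, cexp. simpl.
    rewrite cos_2PI, sin_2PI, cos_0, sin_0. reflexivity. }
  assert (E1 : forall r, (0 < r)%R -> CInt (fun t => G (ln r, t)) 0 (2 * PI) = CInt (fun t => h (circ r t)) 0 (2 * PI)).
  { intros r Hr'. apply (@RInt_ext C_R_CompleteNormedModule). intros t _. unfold G.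
    now rewrite circ_cexp. }
  rewrite E0, !E1 in B by lra. unfold mean. f_equal.
  set (X := CInt (fun t => h (circ r1 t)) 0 (2 * PI)) in *.
  set (Y := CInt (fun t => h (circ r2 t)) 0 (2 * PI)) in *.
  apply Ceq_minus.
  match type of B with ?a + _ - _ - _ = _ => replace (X - Y) with (Ci * (a + Ci * Y - a - Ci * X)) end.
  - rewrite B. ring.
  - transitivity (Ci * Ci * (Y - X)); [ring|].
    replace (Ci * Ci) with (- (1)) by (apply injective_projections; simpl; ring).
    ring.
Qed.

Lemma mean_limit (h : C -> C) (Rad r0 : R) (v : C) : (0 <= r0 < Rad)%R ->
  (forall u, (Cmod u < Rad)%R -> ccont h u) ->
  (forall d, (0 < d)%R -> exists r, (0 <= r < Rad)%R /\ (Rabs (r - r0) < d)%R /\ mean h r = v) ->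
  mean h r0 = v.
Proof.
  intros Hr0 Hc H. symmetry. apply Ceq_minus, Cmod_eq_0. apply Rle_antisym; [|apply Cmod_ge_0].
  apply le_epsilon. intros e He. rewrite Rplus_0_l.
  destruct (mean_continuous h Rad r0 Hr0 Hc e He) as [d [Hd Hm]].
  destruct (H d Hd) as [r [Hr [Hd' <-]]]. now apply Hm.
Qed.

(** The means are constant on both sides of [rho] and depend continuously on the
    radius, so that mere continuity on the circle [Cmod u = rho] is harmless. *)
Lemma mean_value (h : C -> C) (Rad rho r : R) : (0 <= r < Rad)%R -> (0 <= rho < Rad)%R ->
  (forall u, (Cmod u < Rad)%R -> ccont h u) ->
  (forall u, (0 < Cmod u < Rad)%R -> Cmod u <> rho -> exists l, cderiv h u l) ->
  mean h r = h 0.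
Proof.
  intros Hr Hrho Hc Hd.
  (* Constancy between two radii between which [rho] does not lie. *)
  assert (K : forall alpha s, (0 <= alpha < s)%R -> (s < Rad)%R -> (s < rho \/ rho <= alpha)%R ->
     mean h alpha = mean h s).
  { intros al s Hal Hs Hor. apply (mean_limit h Rad al); [lra | exact Hc |].
    intros d Hd0. exists (Rmin (al + d / 2) s).
    assert (M1 := Rmin_l (al + d / 2) s). assert (M2 := Rmin_r (al + d / 2) s).
    assert (M3 : (al < Rmin (al + d / 2) s)%R) by (apply Rmin_glb_lt; lra).
    split; [lra|]. split; [apply Rabs_def1; lra|].
    apply mean_annulus; [lra|]. intros u Hu. apply Hd; [lra|]. lra. }
  assert (K0 : forall s, (0 <= s < rho)%R -> mean h s = h 0).
  { intros s Hs. destruct (Req_dec s 0) as [->|Hn]; [apply mean_0|].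
    rewrite <- mean_0. symmetry. apply K; lra. }
  assert (Krho : mean h rho = h 0).
  { destruct (Req_dec rho 0) as [->|Hn]; [apply mean_0|].
    apply (mean_limit h Rad rho); [lra | exact Hc|]. intros d Hd0.
    exists (Rmax 0 (rho - d / 2)).
    assert (M1 := Rmax_l 0 (rho - d / 2)). assert (M2 := Rmax_r 0 (rho - d / 2)).
    assert (M3 : (Rmax 0 (rho - d / 2) < rho)%R) by (apply Rmax_lub_lt; lra).
    split; [lra|]. split; [apply Rabs_def1; lra|]. apply K0. lra. }
  destruct (Rtotal_order r rho) as [H|[->|H]]; [apply K0; lra | exact Krho |].
  rewrite <- Krho. symmetry. apply K; lra.
Qed.

(** * Complex series *)

(** Summing the [n] first terms makes the empty sum available; [sum_n] starts with one
    term. *)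
Fixpoint csum (a : nat -> C) (n : nat) : C :=
  match n with O => 0 | S k => csum a k + a k end.

Definition cser (a : nat -> C) (l : C) : Prop :=
  forall e : R, (0 < e)%R -> exists N : nat, forall n, (N <= n)%nat -> (Cmod (csum a n - l) < e)%R.

Lemma sum_n_csum (a : nat -> C) (n : nat) :
  @sum_n C_AbelianMonoid a n = csum a (S n).
Proof.
  induction n as [|n IH].
  - rewrite sum_O. simpl. ring.
  - rewrite sum_Sn, IH. reflexivity.
Qed.

Lemma is_series_cser (a : nat -> C) (l : C) :
  @is_series C_AbsRing C_NormedModule a l <-> cser a l.
Proof.
  split.
  - intros H e He.
    destruct (H (fun w => (Cmod (w - l) < e)%R)) as [N HN].
    + apply (proj2 (locally_Cmod l _)). exists e. auto.
    + exists (S N). intros [|n] Hn; [lia|].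
      specialize (HN n ltac:(lia)). rewrite <- sum_n_csum. exact HN.
  - intros H P HP. apply (proj1 (locally_Cmod l P)) in HP. destruct HP as [e [He HP]].
    destruct (H e He) as [N HN]. exists N. intros n Hn. apply HP.
    change (Cmod (@sum_n C_AbelianMonoid a n - l) < e)%R.
    rewrite sum_n_csum. apply HN. lia.
Qed.

Lemma cser_unique (a : nat -> C) (l m : C) : cser a l -> cser a m -> l = m.
Proof.
  intros Hl Hm. apply Ceq_minus, Cmod_eq_0. apply Rle_antisym; [|apply Cmod_ge_0].
  apply le_epsilon. intros e He. rewrite Rplus_0_l.
  destruct (Hl (e / 2)%R ltac:(lra)) as [N1 H1]. destruct (Hm (e / 2)%R ltac:(lra)) as [N2 H2].
  specialize (H1 (N1 + N2)%nat ltac:(lia)). specialize (H2 (N1 + N2)%nat ltac:(lia)).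
  replace (l - m) with ((csum a (N1 + N2) - m) - (csum a (N1 + N2) - l)) by ring.
  eapply Rle_trans; [apply Cmod_triangle_minus|]. lra.
Qed.

Lemma csum_ext (a b : nat -> C) (n : nat) : (forall k, (k < n)%nat -> a k = b k) -> csum a n = csum b n.
Proof.
  induction n as [|n IH]; intros H; [reflexivity|]. simpl.
  rewrite IH by (intros; apply H; lia). now rewrite H by lia.
Qed.

Lemma csum_lin (c : C) (a b : nat -> C) (n : nat) :
  csum (fun k => a k + c * b k) n = csum a n + c * csum b n.
Proof. induction n as [|n IH]; simpl; [ring | rewrite IH; ring]. Qed.

Lemma csum_shift (a : nat -> C) (n : nat) : csum a (S n) = a O + csum (fun k => a (S k)) n.
Proof. induction n as [|n IH]; [simpl; ring|]. change (csum a (S (S n))) with (csum a (S n) + a (S n)). rewrite IH. simpl. ring. Qed.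

Lemma cser_ext (a b : nat -> C) (l : C) : (forall k, a k = b k) -> cser a l -> cser b l.
Proof.
  intros H Ha e He. destruct (Ha e He) as [N HN]. exists N. intros n Hn.
  rewrite <- (csum_ext a) by auto. auto.
Qed.

Lemma cser_lin (c : C) (a b : nat -> C) (l m : C) :
  cser a l -> cser b m -> cser (fun k => a k + c * b k) (l + c * m).
Proof.
  intros Ha Hb e He. pose proof (Cmod_ge_0 c) as Pc.
  destruct (Ha (e / 2)%R ltac:(lra)) as [N1 H1].
  destruct (Hb (e / (2 * (Cmod c + 1)))%R ltac:(apply Rdiv_lt_0_compat; lra)) as [N2 H2].
  exists (N1 + N2)%nat. intros n Hn. specialize (H1 n ltac:(lia)). specialize (H2 n ltac:(lia)).
  rewrite csum_lin.
  replace (csum a n + c * csum b n - (l + c * m)) with ((csum a n - l) + c * (csum b n - m)) by ring.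
  eapply Rle_lt_trans; [apply Cmod_triangle|]. rewrite Cmod_mult.
  assert (X : (Cmod c * Cmod (csum b n - m) <= e / 2)%R).
  { apply Rle_trans with ((Cmod c + 1) * (e / (2 * (Cmod c + 1))))%R.
    - apply Rmult_le_compat; try apply Cmod_ge_0; lra.
    - apply Req_le. field. lra. }
  lra.
Qed.

Lemma cser_zero : cser (fun _ => 0) 0.
Proof.
  intros e He. exists O. intros n _. replace (csum (fun _ => 0) n) with (RtoC 0).
  - replace (0 - 0) with (RtoC 0) by ring. now rewrite Cmod_0.
  - induction n as [|n IH]; simpl; [reflexivity | rewrite <- IH; ring].
Qed.

Lemma cser_scal (c : C) (a : nat -> C) (l : C) : cser a l -> cser (fun k => c * a k) (c * l).
Proof.
  intros H. replace (c * l) with (0 + c * l) by ring.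
  apply (cser_ext (fun k => 0 + c * a k)); [intros; ring|]. apply cser_lin; [apply cser_zero | exact H].
Qed.

Lemma cser_plus (a b : nat -> C) (l m : C) : cser a l -> cser b m -> cser (fun k => a k + b k) (l + m).
Proof.
  intros Ha Hb. replace (l + m) with (l + 1 * m) by ring.
  apply (cser_ext (fun k => a k + 1 * b k)); [intros; ring|]. now apply cser_lin.
Qed.

Lemma cser_shift (a : nat -> C) (l : C) : cser (fun k => a (S k)) l <-> cser a (a O + l).
Proof.
  split; intros H e He; destruct (H e He) as [N HN]; exists (S N); intros n Hn.
  - destruct n as [|n]; [lia|]. rewrite csum_shift. specialize (HN n ltac:(lia)).
    replace (a O + csum (fun k => a (S k)) n - (a O + l)) with (csum (fun k => a (S k)) n - l) by ring.
    exact HN.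
  - specialize (HN (S n) ltac:(lia)). rewrite csum_shift in HN.
    replace (csum (fun k => a (S k)) n - l) with
      (a O + csum (fun k => a (S k)) n - (a O + l)) by ring. exact HN.
Qed.

Lemma cser_bound (a : nat -> C) (l : C) : cser a l -> exists M, (0 < M)%R /\ forall n, (Cmod (a n) <= M)%R.
Proof.
  intros H. destruct (H 1%R Rlt_0_1) as [N HN].
  assert (F : forall m, exists M, (0 < M)%R /\ forall n, (n < m)%nat -> (Cmod (a n) <= M)%R).
  { induction m as [|m [M [HM IH]]].
    - exists 1%R. split; [lra|]. intros; lia.
    - exists (M + Cmod (a m))%R. pose proof (Cmod_ge_0 (a m)). split; [lra|]. intros n Hn.
      destruct (Nat.eq_dec n m) as [->|]; [lra|]. specialize (IH n ltac:(lia)). lra. }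
  destruct (F N) as [M [HM HF]]. exists (M + 2)%R. split; [lra|]. intros n.
  destruct (Nat.lt_ge_cases n N) as [Hn|Hn]; [specialize (HF n Hn); lra|].
  pose proof (HN n Hn) as H1. pose proof (HN (S n) ltac:(lia)) as H2. simpl in H2.
  replace (a n) with ((csum a n + a n - l) - (csum a n - l)) by ring.
  eapply Rle_trans; [apply Cmod_triangle_minus|]. lra.
Qed.

Lemma cser_le (a : nat -> C) (l : C) (M : R) : cser a l ->
  (forall n, (Cmod (csum a n) <= M)%R) -> (Cmod l <= M)%R.
Proof.
  intros H HM. apply le_epsilon. intros e He. destruct (H e He) as [N HN].
  specialize (HN N (le_n N)). specialize (HM N).
  replace l with (csum a N - (csum a N - l)) by ring.
  eapply Rle_trans; [apply Cmod_triangle_minus|]. lra.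
Qed.

Lemma csum_Cmod_le (a : nat -> C) (b : nat -> R) (S0 : R) :
  (forall n, (Cmod (a n) <= b n)%R) -> is_series b S0 -> forall n, (Cmod (csum a n) <= S0)%R.
Proof.
  intros H HS n.
  assert (P : forall k, (0 <= b k)%R) by (intros k; eapply Rle_trans; [apply Cmod_ge_0 | apply H]).
  destruct n as [|n].
  - simpl. rewrite Cmod_0. apply (is_lim_seq_le (fun _ => 0%R) (sum_n b) 0 S0).
    + intros k. induction k as [|k IH]; [rewrite sum_O; apply P|].
      rewrite sum_Sn. unfold plus. simpl. specialize (P (S k)). lra.
    + apply is_lim_seq_const.
    + exact HS.
  - apply Rle_trans with (sum_n b n).
    + induction n as [|n IH].
      * rewrite sum_O. simpl. replace (0 + a O) with (a O) by ring. apply H.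
      * rewrite sum_Sn. change (csum a (S (S n))) with (csum a (S n) + a (S n)).
        eapply Rle_trans; [apply Cmod_triangle|]. apply Rplus_le_compat; [exact IH | apply H].
    + apply (is_lim_seq_incr_compare (sum_n b) S0 HS). intros k.
      rewrite sum_Sn. unfold plus. simpl. specialize (P (S k)). lra.
Qed.

Lemma cser_ex (a : nat -> C) (b : nat -> R) :
  (forall n, (Cmod (a n) <= b n)%R) -> ex_series b -> exists l, cser a l.
Proof.
  intros H Hb.
  destruct (@ex_series_le C_AbsRing C_CompleteNormedModule a b) as [l Hl]; [exact H | exact Hb|].
  exists l. apply is_series_cser. exact Hl.
Qed.

(** * Taylor series of a holomorphic function *)

Lemma cont_circle_cderiv (h : C -> C) (r : R) :
  (forall u, Cmod u = r -> exists l, cderiv h u l) -> cont_circle h r.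
Proof. intros H u Hu. destruct (H u Hu) as [l Hl]. eapply cderiv_ccont, Hl. Qed.

Lemma circle_neq_0 (r : R) (u : C) : (0 < r)%R -> Cmod u = r -> u <> 0.
Proof. intros Hr Hu. apply Cmod_gt_0. lra. Qed.

Lemma cderiv_inv_pow (k : nat) (u : C) : u <> 0 -> exists l, cderiv (fun w => (/ w) ^ k) u l.
Proof.
  intros Hu. induction k as [|k [l IH]].
  - exists 0. exact (cderiv_const 1 u).
  - eexists. apply (cderiv_mult (fun w => / w) (fun w => (/ w) ^ k)); [now apply cderiv_inv_id | exact IH].
Qed.

Lemma Cmod_inv_pow (k : nat) (u : C) : u <> 0 -> Cmod ((/ u) ^ k) = (/ Cmod u ^ k)%R.
Proof. intros Hu. rewrite Cmod_pow, Cmod_inv by exact Hu. apply pow_inv. Qed.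

(** The mean does not depend on the radius and tends to [0] as the radius grows. *)
Lemma mean_inv_pow (k : nat) (r : R) : (0 < r)%R -> mean (fun u => (/ u) ^ S k) r = 0.
Proof.
  intros Hr. apply Cmod_eq_0. apply Rle_antisym; [|apply Cmod_ge_0].
  apply le_epsilon. intros e He. rewrite Rplus_0_l.
  pose proof (Rinv_0_lt_compat e He) as Hie.
  (* At this radius the inverse powers are at most [e]. *)
  set (r' := (r + 1 + / e)%R).
  assert (Hr' : (1 < r')%R) by (unfold r'; lra).
  assert (Hd : forall u : C, u <> 0 -> exists l, cderiv (fun w => (/ w) ^ S k) u l)
    by (intros u Hu; now apply (cderiv_inv_pow (S k))).
  rewrite (mean_annulus _ r r').
  - apply mean_bound; [lra | |].
    + apply cont_circle_cderiv. intros u Hu. apply Hd. apply circle_neq_0 with r'; lra.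
    + intros u Hu. rewrite Cmod_inv_pow by (apply circle_neq_0 with r'; lra).
      rewrite Hu. rewrite <- (Rinv_inv e). apply Rinv_le_contravar; [lra|]. simpl.
      assert (1 <= r' ^ k)%R by (apply pow_R1_Rle; lra).
      assert (/ e <= r')%R by (unfold r'; lra). nra.
  - unfold r'. lra.
  - intros u Hu. apply Hd. apply Cmod_gt_0. lra.
Qed.

Definition holo (f : C -> C) (R0 : R) : Prop :=
  forall z, (Cmod z < R0)%R -> exists l, cderiv f z l.

Definition series_on (a : nat -> C) (f : C -> C) (R0 : R) : Prop :=
  forall z, (Cmod z < R0)%R -> cser (fun k => a k * z ^ k) (f z).

Lemma mean_csum (F : nat -> C -> C) (r : R) (n : nat) : (0 <= r)%R ->
  (forall k, cont_circle (F k) r) ->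
  cont_circle (fun u => csum (fun k => F k u) n) r /\
  mean (fun u => csum (fun k => F k u) n) r = csum (fun k => mean (F k) r) n.
Proof.
  intros Hr HF. induction n as [|n [IH1 IH2]]; simpl.
  - split; [intros u _; apply ccont_const | apply mean_cst].
  - split.
    + intros u Hu. apply ccont_plus; [now apply IH1 | now apply HF].
    + rewrite mean_plus, IH2; auto.
Qed.

(** The kernel [u / (u - z)] of Cauchy's formula enters here, through its geometric
    expansion. *)
Lemma geometric_slope (f : C -> C) (z l u : C) (n : nat) : u <> 0 ->
  csum (fun k => z ^ k * ((f u - f z) * (/ u) ^ k)) n
  = u * slope f z l u - (z * / u) ^ n * (u * slope f z l u).
Proof.
  intros Hu. pose proof (slope_spec f z l u) as E. set (s := slope f z l u) in *.
  induction n as [|n IH]; [simpl; ring|]. simpl csum. rewrite IH, E. rewrite !Cpow_mult_l. simpl. field. exact Hu.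
Qed.

(** By [mean_value] the mean of [h u = u * slope f z u] vanishes.  Expanding
    [u / (u - z)] geometrically, the partial sums of the series with
    coefficients [mean (f u / u^k)] differ from [f z] by the mean of
    [(z / u)^n h], which tends to [0] on a circle of radius larger than
    [Cmod z].  The integral form of the coefficients is kept for Bessel's
    inequality. *)
Lemma taylor (f : C -> C) (R0 : R) : (0 < R0)%R -> holo f R0 ->
  exists a : nat -> C, series_on a f R0 /\
    forall k r, (0 < r < R0)%R -> a k = mean (fun u => f u * (/ u) ^ k) r.
Proof.
  intros HR Hf.
  set (a := fun k => mean (fun u => f u * (/ u) ^ k) (R0 / 2)).
  assert (Hcd : forall k (u : C), u <> 0 -> (Cmod u < R0)%R ->
    exists l, cderiv (fun u => f u * (/ u) ^ k) u l).
  { intros k u Hu Hu'. destruct (Hf u Hu') as [l Hl]. destruct (cderiv_inv_pow k u Hu) as [m Hm].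
    eexists. apply (cderiv_mult f (fun u => (/ u) ^ k)); eassumption. }
  assert (Ha : forall k r, (0 < r < R0)%R -> a k = mean (fun u => f u * (/ u) ^ k) r).
  { intros k r Hr. unfold a. destruct (Rle_dec r (R0 / 2)).
    - symmetry. apply mean_annulus; [lra|]. intros u Hu. apply Hcd; [apply Cmod_gt_0; lra | lra].
    - apply mean_annulus; [lra|]. intros u Hu. apply Hcd; [apply Cmod_gt_0; lra | lra]. }
  exists a. split; [|exact Ha].
  intros z Hz. destruct (Hf z Hz) as [l Hl].
  pose proof (Cmod_ge_0 z) as Pz.
  set (r := ((Cmod z + R0) / 2)%R). assert (Hr : (Cmod z < r < R0)%R) by (unfold r; lra).
  set (h := fun u => u * slope f z l u).
  assert (Hhc : forall u, (Cmod u < R0)%R -> (u <> z -> exists m, cderiv h u m) /\ ccont h u).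
  { intros u Hu.
    assert (D : u <> z -> exists m, cderiv h u m).
    { intros Huz. destruct (Hf u Hu) as [m Hm]. apply Cminus_eq_contra in Huz as Huz'.
      apply Cmod_gt_0 in Huz' as Hp. eexists.
      apply (cderiv_ext_loc (fun w => w * ((f w - f z) / (w - z))) h u _ _ Hp).
      - intros w Hw. unfold h. rewrite slope_off; [reflexivity|]. intros ->.
        rewrite Cmod_minus_sym in Hw. lra.
      - apply (cderiv_mult (fun w => w) (fun w => (f w - f z) / (w - z))); [apply cderiv_id|].
        apply (cderiv_div (fun w => f w - f z) (fun w => w - z)); [exact Huz' | |].
        + apply cderiv_minus; [exact Hm | apply cderiv_const].
        + apply cderiv_minus; [apply cderiv_id | apply cderiv_const]. }
    split; [exact D|]. destruct (classic (u = z)) as [->|Huz].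
    - apply ccont_mult; [apply ccont_id | exact Hl].
    - destruct (D Huz) as [m Hm]. eapply cderiv_ccont, Hm. }
  assert (Hm0 : mean h r = 0).
  { rewrite (mean_value h R0 (Cmod z) r); [unfold h; ring | lra | lra | |].
    - intros u Hu. apply (Hhc u Hu).
    - intros u Hu Hn. apply (Hhc u); [lra|]. intros ->. now apply Hn. }
  assert (Hch : cont_circle h r) by (intros u Hu; apply Hhc; lra).
  destruct (mean_bound_ex h r ltac:(lra) Hch) as [M [HM HB]].
  assert (Hcz : forall n, cont_circle (fun u => (z * / u) ^ n) r).
  { intros n u Hu. assert (Hu0 : u <> 0) by (apply circle_neq_0 with r; lra).
    apply (ccont_ext_loc (fun u => z ^ n * (/ u) ^ n) _ u 1 Rlt_0_1).
    - intros w _. symmetry. apply Cpow_mult_l.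
    - apply ccont_mult; [apply ccont_const|]. destruct (cderiv_inv_pow n u Hu0) as [m Hm].
      eapply cderiv_ccont, Hm. }
  (* The remainder of the partial sum is a mean of [(z / u)^(n + 1) h]. *)
  assert (Hps : forall n, csum (fun k => a k * z ^ k) (S n) - f z
     = - mean (fun u => (z * / u) ^ S n * h u) r).
  { intros n.
    assert (HFc : forall k, cont_circle (fun u => z ^ k * ((f u - f z) * (/ u) ^ k)) r).
    { intros k. apply cont_circle_cderiv. intros u Hu.
      assert (Hu0 : u <> 0) by (apply circle_neq_0 with r; lra).
      destruct (Hf u ltac:(lra)) as [m Hm]. destruct (cderiv_inv_pow k u Hu0) as [m' Hm'].
      eexists. apply cderiv_mult; [apply cderiv_const|].
      apply cderiv_mult; [apply cderiv_minus; [exact Hm | apply cderiv_const] | exact Hm']. }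
    destruct (mean_csum (fun k u => z ^ k * ((f u - f z) * (/ u) ^ k)) r (S n) ltac:(lra) HFc) as [_ E].
    transitivity (csum (fun k => mean (fun u => z ^ k * ((f u - f z) * (/ u) ^ k)) r) (S n)).
    - rewrite !csum_shift.
      assert (Hk : forall k, mean (fun u => z ^ k * ((f u - f z) * (/ u) ^ k)) r
         = a k * z ^ k - f z * z ^ k * mean (fun u => (/ u) ^ k) r).
      { intros k. rewrite (Ha k r) by lra.
        assert (C1 : cont_circle (fun u => f u * (/ u) ^ k) r).
        { apply cont_circle_cderiv. intros u Hu. apply Hcd; [apply circle_neq_0 with r|]; lra. }
        assert (C2 : cont_circle (fun u => (/ u) ^ k) r).
        { apply cont_circle_cderiv. intros u Hu. apply cderiv_inv_pow. apply circle_neq_0 with r; lra. }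
        transitivity (mean (fun u => z ^ k * (f u * (/ u) ^ k) + (- (f z * z ^ k)) * (/ u) ^ k) r).
        { apply mean_ext; [lra|]. intros; ring. }
        rewrite mean_plus, !mean_scal; try lra; try assumption; [ring | |];
          intros u Hu; apply ccont_mult; try apply ccont_const; [now apply C1 | now apply C2]. }
      rewrite (Hk O). rewrite (csum_ext (fun k => mean _ _) (fun k => a (S k) * z ^ S k)).
      + simpl Cpow. rewrite mean_cst. ring.
      + intros k _. rewrite Hk, mean_inv_pow by lra. ring.
    - rewrite <- E. transitivity (mean (fun u => h u + (-(1)) * ((z * / u) ^ S n * h u)) r).
      + apply mean_ext; [lra|]. intros u Hu. rewrite (geometric_slope f z l) by (apply circle_neq_0 with r; lra).
        unfold h. ring.
      + assert (C3 : cont_circle (fun u => (z * / u) ^ S n * h u) r).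
        { intros u Hu. apply (ccont_mult (fun u => (z * / u) ^ S n) h); [now apply Hcz | now apply Hch]. }
        rewrite (mean_plus h (fun u => -(1) * ((z * / u) ^ S n * h u))), mean_scal, Hm0; try lra; try assumption; [ring|].
        intros u Hu. apply ccont_mult; [apply ccont_const | now apply C3]. }
  assert (Hq : (0 <= Cmod z / r < 1)%R).
  { split; [apply Rdiv_le_0_compat; lra | apply Rlt_div_l; lra]. }
  intros e He.
  destruct (pow_lt_1_zero (Cmod z / r) ltac:(rewrite Rabs_pos_eq; lra) (e / (M + 1))%R
    ltac:(apply Rdiv_lt_0_compat; lra)) as [N HN].
  exists (S N). intros n Hn. destruct n as [|n]; [lia|]. rewrite Hps, Cmod_opp.
  apply Rle_lt_trans with ((Cmod z / r) ^ S n * M)%R.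
  - apply HB.
    + apply pow_le; lra.
    + intros u Hu. apply (ccont_mult (fun u => (z * / u) ^ S n) h); [now apply Hcz | now apply Hch].
    + intros u Hu. rewrite Cmod_mult, Cmod_pow, Cmod_mult, Cmod_inv, Hu by (apply circle_neq_0 with r; lra).
      apply Rle_refl.
  - specialize (HN (S n) ltac:(lia)). rewrite Rabs_pos_eq in HN by (apply pow_le; lra).
    apply Rle_lt_trans with ((Cmod z / r) ^ S n * (M + 1))%R.
    + apply Rmult_le_compat_l; [apply pow_le; lra | lra].
    + apply Rlt_div_r in HN; lra.
Qed.

(** * Termwise differentiation *)

Lemma series_coef_bound (a : nat -> C) (f : C -> C) (R0 r : R) : series_on a f R0 -> (0 <= r < R0)%R ->
  exists M, (0 < M)%R /\ forall n, (Cmod (a n) * r ^ n <= M)%R.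
Proof.
  intros H Hr. destruct (cser_bound _ _ (H (RtoC r) ltac:(rewrite Cmod_R, Rabs_pos_eq; lra))) as [M [HM HB]].
  exists M. split; [exact HM|]. intros n. specialize (HB n).
  rewrite Cmod_mult, Cmod_pow, Cmod_R, Rabs_pos_eq in HB by lra. exact HB.
Qed.

(** The factor [n^2] accounts for the second order remainder in termwise
    differentiation. *)
Lemma ex_series_poly_geom (M q : R) : (0 <= q < 1)%R -> ex_series (fun n => M * (INR n ^ 2 * q ^ n))%R.
Proof.
  intros Hq. apply (ex_series_scal M (fun n => INR n ^ 2 * q ^ n)%R).
  destruct (Req_dec q 0) as [->|Hq0].
  - apply ex_series_ext with (fun _ => 0 * 0)%R.
    + intros [|n]; simpl; ring.
    + exists 0%R. assert (L : is_lim_seq (sum_n (fun _ => 0 * 0)%R) 0%R); [|exact L].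
      apply (is_lim_seq_ext (fun _ => 0%R)); [|apply is_lim_seq_const].
      intros n. rewrite sum_n_const. ring.
  - apply (ex_series_incr_1 (fun n => INR n ^ 2 * q ^ n)%R).
    apply ex_series_Rabs.
    assert (Hnz : forall n, (INR (S n) ^ 2 * q ^ S n)%R <> 0%R).
    { intros n. apply Rmult_integral_contrapositive_currified; apply pow_nonzero; [|exact Hq0].
      apply not_0_INR. lia. }
    apply ex_series_DAlembert with q; [lra | exact Hnz |].
    apply (is_lim_seq_ext (fun n => (1 + / INR (S n)) * (1 + / INR (S n)) * q)%R).
    + intros n. assert (INR (S n) <> 0%R) by (apply not_0_INR; lia).
      replace (INR (S (S n)) ^ 2 * q ^ S (S n) / (INR (S n) ^ 2 * q ^ S n))%R
        with ((1 + / INR (S n)) * (1 + / INR (S n)) * q)%R.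
      * symmetry. apply Rabs_pos_eq. assert (0 < / INR (S n))%R by (apply Rinv_0_lt_compat, lt_0_INR; lia).
        apply Rmult_le_pos; nra.
      * rewrite (S_INR (S n)). set (x := INR (S n)) in *.
        change (q ^ S (S n))%R with (q * (q * q ^ n))%R. change (q ^ S n)%R with (q * q ^ n)%R.
        assert (q ^ n <> 0)%R by now apply pow_nonzero. field. auto.
    + replace q with ((1 + 0) * (1 + 0) * q)%R at 1 by ring.
      assert (L : is_lim_seq (fun n => 1 + / INR (S n))%R (1 + 0)%R).
      { apply is_lim_seq_plus'; [apply is_lim_seq_const|].
        apply (is_lim_seq_incr_1 (fun n => / INR n)%R).
        apply (is_lim_seq_inv INR p_infty); [apply is_lim_seq_INR | discriminate]. }
      apply is_lim_seq_mult'; [apply is_lim_seq_mult'; exact L | apply is_lim_seq_const].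
Qed.

(** The second order Taylor remainder of a power, proved by induction; the factor
    [p ^ 2] on the left replaces the exponent [n - 1] on the right. *)
Lemma pow_increment_bound (z w : C) (p : R) (n : nat) : (0 <= p)%R -> (Cmod z <= p)%R -> (Cmod w <= p)%R ->
  (Cmod (w ^ S n - z ^ S n - INR (S n) * z ^ n * (w - z)) * p ^ 2
     <= INR (S n) ^ 2 * p ^ S n * Cmod (w - z) ^ 2)%R.
Proof.
  intros Hp Hz Hw. set (D := Cmod (w - z)).
  assert (PD : (0 <= D)%R) by apply Cmod_ge_0.
  induction n as [|n IH].
  - replace (w ^ 1 - z ^ 1 - INR 1 * z ^ 0 * (w - z)) with (RtoC 0) by (simpl; ring).
    rewrite Cmod_0. simpl. nra.
  - set (E := w ^ S n - z ^ S n - INR (S n) * z ^ n * (w - z)) in *.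
    replace (w ^ S (S n) - z ^ S (S n) - INR (S (S n)) * z ^ S n * (w - z))
      with (w * E + INR (S n) * z ^ n * ((w - z) * (w - z))).
    2:{ unfold E. rewrite (S_INR (S n)), RtoC_plus. simpl Cpow. ring. }
    pose proof (pos_INR (S n)) as PI0.
    assert (Hpn : (0 <= p ^ n)%R) by now apply pow_le.
    apply Rle_trans with ((p * Cmod E + INR (S n) * p ^ n * (D * D)) * p ^ 2)%R.
    + apply Rmult_le_compat_r; [apply pow2_ge_0|].
      eapply Rle_trans; [apply Cmod_triangle|]. rewrite !Cmod_mult, Cmod_R, Rabs_pos_eq by exact PI0.
      apply Rplus_le_compat.
      * apply Rmult_le_compat_r; [apply Cmod_ge_0 | exact Hw].
      * fold D. apply Rmult_le_compat_r; [nra|]. apply Rmult_le_compat_l; [exact PI0|].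
        rewrite Cmod_pow. apply pow_incr. split; [apply Cmod_ge_0 | exact Hz].
    + rewrite (S_INR (S n)).
      apply Rle_trans with (p * (INR (S n) ^ 2 * p ^ S n * D ^ 2) + INR (S n) * p ^ n * (D * D) * p ^ 2)%R.
      * assert (X := Rmult_le_compat_l p _ _ Hp IH). lra.
      * replace ((INR (S n) + 1) ^ 2 * p ^ S (S n) * D ^ 2)%R with
         (p * (INR (S n) ^ 2 * p ^ S n * D ^ 2) + INR (S n) * p ^ n * (D * D) * p ^ 2 +
          (INR (S n) + 1) * (p ^ n * p ^ 2 * D ^ 2))%R by (simpl; ring).
        assert (0 <= (INR (S n) + 1) * (p ^ n * p ^ 2 * D ^ 2))%R.
        { apply Rmult_le_pos; [lra|]. apply Rmult_le_pos; [apply Rmult_le_pos; [lra | apply pow2_ge_0] | apply pow2_ge_0]. }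
        lra.
Qed.

(** Choose [Cmod z < p < r < R0].  Since [a n * r ^ n] is bounded, the remainders of
    the powers at distance [Cmod (w - z)] sum to at most a constant times
    [Cmod (w - z) ^ 2] for [Cmod w <= p]. *)
Lemma series_deriv_ex (a : nat -> C) (f : C -> C) (R0 : R) : series_on a f R0 ->
  forall z, (Cmod z < R0)%R ->
  exists l, cser (fun k => INR (S k) * a (S k) * z ^ k) l /\ cderiv f z l.
Proof.
  intros H z Hz. pose proof (Cmod_ge_0 z) as Pz.
  set (p := ((2 * Cmod z + R0) / 3)%R). set (r := ((Cmod z + 2 * R0) / 3)%R).
  assert (Hp : (Cmod z < p)%R) by (unfold p; lra). assert (Hpr : (p < r < R0)%R) by (unfold p, r; lra).
  destruct (series_coef_bound a f R0 r H ltac:(lra)) as [M [HM HB]].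
  set (q := (p / r)%R).
  assert (Hq : (0 <= q < 1)%R).
  { unfold q. split; [apply Rdiv_le_0_compat; lra | apply Rlt_div_l; lra]. }
  assert (Hap : forall n, (Cmod (a n) * p ^ n <= M * q ^ n)%R).
  { intros n. unfold q. unfold Rdiv. rewrite Rpow_mult_distr, pow_inv.
    assert (Hrn : (0 < r ^ n)%R) by (apply pow_lt; lra).
    assert (Hpn : (0 <= p ^ n)%R) by (apply pow_le; lra).
    replace (Cmod (a n) * p ^ n)%R with (Cmod (a n) * r ^ n * (p ^ n * / r ^ n))%R by (field; lra).
    apply Rmult_le_compat_r; [|apply HB]. apply Rmult_le_pos; [exact Hpn|].
    apply Rlt_le, Rinv_0_lt_compat, Hrn. }
  assert (Hpow : forall n : nat, (0 <= p ^ n)%R) by (intros n; apply pow_le; lra).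
  pose proof (ex_series_poly_geom (M / p) q Hq) as E1. apply ex_series_incr_1 in E1.
  pose proof (ex_series_poly_geom (M / p ^ 2) q Hq) as E2. apply ex_series_incr_1 in E2.
  destruct (cser_ex (fun k => INR (S k) * a (S k) * z ^ k)
    (fun k => M / p * (INR (S k) ^ 2 * q ^ S k))%R) as [l Hl]; [ | exact E1 | ].
  { intros n. rewrite !Cmod_mult, Cmod_R, Rabs_pos_eq, Cmod_pow by apply pos_INR.
    apply Rle_trans with (INR (S n) ^ 2 * (Cmod (a (S n)) * p ^ n))%R.
    - rewrite Rmult_assoc. apply Rmult_le_compat.
      + apply pos_INR.
      + apply Rmult_le_pos; [apply Cmod_ge_0 | apply pow_le, Cmod_ge_0].
      + assert (1 <= INR (S n))%R by (rewrite S_INR; pose proof (pos_INR n); lra). nra.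
      + apply Rmult_le_compat_l; [apply Cmod_ge_0|]. apply pow_incr. lra.
    - replace (M / p * (INR (S n) ^ 2 * q ^ S n))%R with (INR (S n) ^ 2 * (M * q ^ S n / p))%R by (field; lra).
      apply Rmult_le_compat_l; [apply pow2_ge_0|]. apply (proj1 (Rle_div_r _ _ p ltac:(lra))).
      eapply Rle_trans; [|apply Hap]. apply Req_le. simpl. ring. }
  exists l. split; [exact Hl|]. destruct E2 as [K HK].
  assert (PK : (0 <= K)%R).
  { apply (is_lim_seq_le (fun _ => 0%R) _ 0 K) with (2 := is_lim_seq_const 0) (3 := HK).
    intros n. assert (T : forall k, (0 <= M / p ^ 2 * (INR (S k) ^ 2 * q ^ S k))%R).
    { intros k. apply Rmult_le_pos; [apply Rdiv_le_0_compat; [lra | apply pow_lt; lra]|].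
      apply Rmult_le_pos; [apply pow2_ge_0 | apply pow_le; lra]. }
    induction n as [|n IH]; [rewrite sum_O; apply T|].
    rewrite sum_Sn. unfold plus. simpl plus. specialize (T (S n)). simpl in *. lra. }
  assert (HK' : forall w, (Cmod w <= p)%R ->
     (Cmod (f w - f z - l * (w - z)) <= K * Cmod (w - z) ^ 2)%R).
  { intros w Hw.
    assert (S1 : cser (fun k => a (S k) * (w ^ S k - z ^ S k - INR (S k) * z ^ k * (w - z)))
       (f w - f z - l * (w - z))).
    { assert (Sw := H w ltac:(lra)). assert (Sz := H z Hz).
      replace (f w) with (a O * w ^ O + (f w - a O * w ^ O)) in Sw by ring. apply cser_shift in Sw.
      replace (f z) with (a O * z ^ O + (f z - a O * z ^ O)) in Sz by ring. apply cser_shift in Sz.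
      pose proof (cser_lin (- (w - z)) _ _ _ _ (cser_lin (- (1)) _ _ _ _ Sw Sz) Hl) as S2.
      replace (f w - f z - l * (w - z)) with
        (f w - a O * w ^ 0 + - (1) * (f z - a O * z ^ 0) + - (w - z) * l) by (simpl; ring).
      eapply cser_ext; [|exact S2]. intros k. cbv beta. ring. }
    apply (cser_le _ _ _ S1).
    destruct (Req_dec (Cmod (w - z)) 0) as [E0|E0].
    - apply Cmod_eq_0 in E0 as E0'. intros n.
      assert (w = z) as -> by (now apply Ceq_minus).
      rewrite E0. replace (csum _ n) with (RtoC 0); [rewrite Cmod_0; lra|].
      induction n as [|n IH]; cbn [csum]; [reflexivity|]. rewrite <- IH. simpl. ring.
    - apply (csum_Cmod_le _ (fun n => (M / p ^ 2 * (INR (S n) ^ 2 * q ^ S n)) * Cmod (w - z) ^ 2)%R).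
      + intros n. rewrite Cmod_mult.
        pose proof (pow_increment_bound z w p n ltac:(lra) ltac:(lra) Hw) as B.
        set (X := Cmod (w ^ S n - z ^ S n - INR (S n) * z ^ n * (w - z))) in *.
        assert (Hp2 : (0 < p ^ 2)%R) by (apply pow_lt; lra).
        apply Rmult_le_reg_r with (p ^ 2)%R; [exact Hp2|].
        apply Rle_trans with (Cmod (a (S n)) * (INR (S n) ^ 2 * p ^ S n * Cmod (w - z) ^ 2))%R.
        * rewrite Rmult_assoc. apply Rmult_le_compat_l; [apply Cmod_ge_0 | exact B].
        * replace (Cmod (a (S n)) * (INR (S n) ^ 2 * p ^ S n * Cmod (w - z) ^ 2))%R
            with ((Cmod (a (S n)) * p ^ S n) * (INR (S n) ^ 2 * Cmod (w - z) ^ 2))%R by ring.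
          replace (M / p ^ 2 * (INR (S n) ^ 2 * q ^ S n) * Cmod (w - z) ^ 2 * p ^ 2)%R
            with ((M * q ^ S n) * (INR (S n) ^ 2 * Cmod (w - z) ^ 2))%R by (field; lra).
          apply Rmult_le_compat_r; [|apply Hap]. apply Rmult_le_pos; apply pow2_ge_0.
      + apply is_series_scal_r. exact HK. }
  apply cderiv_eps. intros e He.
  exists (Rmin (p - Cmod z) (e / (K + 1))). split.
  - apply Rmin_glb_lt; [lra | apply Rdiv_lt_0_compat; lra].
  - intros w Hw. assert (W1 := Rlt_le_trans _ _ _ Hw (Rmin_l _ _)).
    assert (W2 := Rlt_le_trans _ _ _ Hw (Rmin_r _ _)).
    pose proof (Cmod_minus_ge w z). eapply Rle_trans; [apply HK'; lra|].
    pose proof (Cmod_ge_0 (w - z)) as PW. apply Rlt_div_r in W2; [|lra].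
    replace (K * Cmod (w - z) ^ 2)%R with (K * Cmod (w - z) * Cmod (w - z))%R by ring.
    apply Rmult_le_compat_r; [exact PW|]. nra.
Qed.

Lemma series_deriv (a : nat -> C) (f g : C -> C) (R0 : R) : series_on a f R0 ->
  (forall z, (Cmod z < R0)%R -> cderiv f z (g z)) ->
  series_on (fun k => INR (S k) * a (S k)) g R0.
Proof.
  intros H Hg z Hz. destruct (series_deriv_ex a f R0 H z Hz) as [l [H1 H2]].
  replace (g z) with l; [exact H1|].
  rewrite <- (C_derive_cderiv _ _ _ H2). apply C_derive_cderiv, Hg, Hz.
Qed.

Lemma series_holo (a : nat -> C) (f : C -> C) (R0 : R) : series_on a f R0 -> holo f R0.
Proof.
  intros H z Hz. destruct (series_deriv_ex a f R0 H z Hz) as [l [_ H2]]. now exists l.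
Qed.

(** * Jets of order three *)

(** The origin is excluded because quotients such as [F w / w] are compared with
    their Taylor polynomial, and they have a wrong value there. *)
Definition bigO (k : nat) (f : C -> C) : Prop :=
  exists M d : R, (0 <= M)%R /\ (0 < d)%R /\
    forall w : C, w <> 0 -> (Cmod w < d)%R -> (Cmod (f w) <= M * Cmod w ^ k)%R.

Lemma bigO_ext (k : nat) (f g : C -> C) (d : R) : (0 < d)%R ->
  (forall w : C, w <> 0 -> (Cmod w < d)%R -> f w = g w) -> bigO k f -> bigO k g.
Proof.
  intros Hd E [M [d' [HM [Hd' H]]]]. exists M, (Rmin d d'). split; [exact HM|].
  split; [now apply Rmin_glb_lt|]. intros w Hw Hwd. rewrite <- E.
  - apply H; [exact Hw|]. eapply Rlt_le_trans; [exact Hwd | apply Rmin_r].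
  - exact Hw.
  - eapply Rlt_le_trans; [exact Hwd | apply Rmin_l].
Qed.

Lemma bigO_plus (k : nat) (f g : C -> C) : bigO k f -> bigO k g -> bigO k (fun w => f w + g w).
Proof.
  intros [M [d [HM [Hd H]]]] [M' [d' [HM' [Hd' H']]]]. exists (M + M')%R, (Rmin d d').
  split; [lra|]. split; [now apply Rmin_glb_lt|]. intros w Hw Hwd.
  specialize (H w Hw (Rlt_le_trans _ _ _ Hwd (Rmin_l _ _))).
  specialize (H' w Hw (Rlt_le_trans _ _ _ Hwd (Rmin_r _ _))).
  eapply Rle_trans; [apply Cmod_triangle|]. lra.
Qed.

Lemma bigO_mult (k l : nat) (f g : C -> C) : bigO k f -> bigO l g -> bigO (k + l) (fun w => f w * g w).
Proof.
  intros [M [d [HM [Hd H]]]] [M' [d' [HM' [Hd' H']]]]. exists (M * M')%R, (Rmin d d').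
  split; [nra|]. split; [now apply Rmin_glb_lt|]. intros w Hw Hwd.
  specialize (H w Hw (Rlt_le_trans _ _ _ Hwd (Rmin_l _ _))).
  specialize (H' w Hw (Rlt_le_trans _ _ _ Hwd (Rmin_r _ _))).
  rewrite Cmod_mult, pow_add.
  replace (M * M' * (Cmod w ^ k * Cmod w ^ l))%R with ((M * Cmod w ^ k) * (M' * Cmod w ^ l))%R by ring.
  apply Rmult_le_compat; try apply Cmod_ge_0; assumption.
Qed.

Lemma bigO_weaken (k l : nat) (f : C -> C) : (l <= k)%nat -> bigO k f -> bigO l f.
Proof.
  intros Hkl [M [d [HM [Hd H]]]]. exists M, (Rmin d 1). split; [exact HM|].
  split; [apply Rmin_glb_lt; lra|]. intros w Hw Hwd.
  specialize (H w Hw (Rlt_le_trans _ _ _ Hwd (Rmin_l _ _))).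
  assert (W1 := Rlt_le_trans _ _ _ Hwd (Rmin_r _ _)). pose proof (Cmod_ge_0 w) as P0.
  eapply Rle_trans; [exact H|]. apply Rmult_le_compat_l; [exact HM|].
  replace k with (l + (k - l))%nat by lia. rewrite pow_add.
  rewrite <- (Rmult_1_r (Cmod w ^ l)) at 2. apply Rmult_le_compat_l; [now apply pow_le|].
  rewrite <- (pow1 (k - l)). apply pow_incr. lra.
Qed.

Lemma bigO_monomial (k : nat) (c : C) : bigO k (fun w => c * w ^ k).
Proof.
  exists (Cmod c), 1%R. split; [apply Cmod_ge_0|]. split; [lra|]. intros w _ _.
  rewrite Cmod_mult, Cmod_pow. apply Rle_refl.
Qed.

Lemma bigO_const (c : C) : bigO 0 (fun _ => c).
Proof. apply (bigO_ext 0 (fun w => c * w ^ 0) _ 1 Rlt_0_1); [intros; simpl; ring | apply bigO_monomial]. Qed.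

Lemma bigO_id : bigO 1 (fun w => w).
Proof. apply (bigO_ext 1 (fun w => 1 * w ^ 1) _ 1 Rlt_0_1); [intros; simpl; ring | apply bigO_monomial]. Qed.

Lemma bigO_1_const (c : C) : bigO 1 (fun _ => c) -> c = 0.
Proof.
  intros [M [d [HM [Hd H]]]]. apply Cmod_eq_0. apply Rle_antisym; [|apply Cmod_ge_0].
  apply le_epsilon. intros e He. rewrite Rplus_0_l.
  set (x := Rmin (d / 2) (e / (M + 1))).
  assert (Hx : (0 < x)%R) by (apply Rmin_glb_lt; [lra | apply Rdiv_lt_0_compat; lra]).
  assert (X1 : (x <= d / 2)%R) by apply Rmin_l. assert (X2 : (x <= e / (M + 1))%R) by apply Rmin_r.
  assert (E : Cmod x = x) by (rewrite Cmod_R; apply Rabs_pos_eq; lra).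
  specialize (H (RtoC x)). rewrite E in H.
  eapply Rle_trans; [apply H; [apply Cmod_gt_0|]; lra|]. simpl. rewrite Rmult_1_r.
  apply Rle_trans with (M * (e / (M + 1)))%R; [now apply Rmult_le_compat_l|].
  apply Rle_trans with ((M + 1) * (e / (M + 1)))%R.
  - apply Rmult_le_compat_r; [apply Rlt_le, Rdiv_lt_0_compat; lra | lra].
  - apply Req_le. field. lra.
Qed.

Lemma bigO_div (k : nat) (f : C -> C) : bigO (S k) (fun w => w * f w) -> bigO k f.
Proof.
  intros [M [d [HM [Hd H]]]]. exists M, d. split; [exact HM|]. split; [exact Hd|].
  intros w Hw Hwd. specialize (H w Hw Hwd). rewrite Cmod_mult in H.
  apply Cmod_gt_0 in Hw. apply Rmult_le_reg_l with (Cmod w); [exact Hw|].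
  simpl in H. lra.
Qed.

Definition poly3 (a0 a1 a2 a3 w : C) : C := a0 + a1 * w + a2 * w ^ 2 + a3 * w ^ 3.

(** Taylor polynomials of order three at the origin.  Jets allow products and
    compositions of power series to be compared coefficient by coefficient without
    multiplying series. *)
Definition jet (f : C -> C) (a0 a1 a2 a3 : C) : Prop :=
  bigO 4 (fun w => f w - poly3 a0 a1 a2 a3 w).

Lemma jet_ext (f g : C -> C) (a0 a1 a2 a3 : C) (d : R) : (0 < d)%R ->
  (forall w : C, w <> 0 -> (Cmod w < d)%R -> f w = g w) -> jet f a0 a1 a2 a3 -> jet g a0 a1 a2 a3.
Proof.
  intros Hd E H. eapply bigO_ext; [exact Hd | | exact H]. intros w Hw Hwd. cbv beta. now rewrite E.
Qed.

Lemma bigO_poly3_0 (a0 a1 a2 a3 : C) : bigO 0 (poly3 a0 a1 a2 a3).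
Proof.
  unfold poly3. repeat apply bigO_plus; [apply bigO_const | | | ].
  - apply (bigO_weaken 1); [lia|].
    apply (bigO_ext 1 (fun w => a1 * w ^ 1) _ 1 Rlt_0_1); [intros; simpl; ring | apply bigO_monomial].
  - apply (bigO_weaken 2); [lia | apply bigO_monomial].
  - apply (bigO_weaken 3); [lia | apply bigO_monomial].
Qed.

Lemma jet_bigO_0 (f : C -> C) (a0 a1 a2 a3 : C) : jet f a0 a1 a2 a3 -> bigO 0 f.
Proof.
  intros H. apply (bigO_ext 0 (fun w => (f w - poly3 a0 a1 a2 a3 w) + poly3 a0 a1 a2 a3 w) _ 1 Rlt_0_1).
  - intros; ring.
  - apply bigO_plus; [apply (bigO_weaken 4); [lia | exact H] | apply bigO_poly3_0].
Qed.

Lemma jet_bigO_1 (f : C -> C) (a1 a2 a3 : C) : jet f 0 a1 a2 a3 -> bigO 1 f.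
Proof.
  intros H.
  apply (bigO_ext 1 (fun w => (f w - poly3 0 a1 a2 a3 w) + w * poly3 a1 a2 a3 0 w) _ 1 Rlt_0_1).
  - intros. unfold poly3. ring.
  - apply bigO_plus; [apply (bigO_weaken 4); [lia | exact H]|].
    apply (bigO_mult 1 0); [apply bigO_id | apply bigO_poly3_0].
Qed.

Lemma jet_plus (f g : C -> C) (a0 a1 a2 a3 b0 b1 b2 b3 : C) :
  jet f a0 a1 a2 a3 -> jet g b0 b1 b2 b3 ->
  jet (fun w => f w + g w) (a0 + b0) (a1 + b1) (a2 + b2) (a3 + b3).
Proof.
  intros Hf Hg. apply (bigO_ext 4 (fun w => (f w - poly3 a0 a1 a2 a3 w) + (g w - poly3 b0 b1 b2 b3 w)) _ 1 Rlt_0_1).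
  - intros. unfold poly3. ring.
  - now apply bigO_plus.
Qed.

Lemma jet_mult (f g : C -> C) (a0 a1 a2 a3 b0 b1 b2 b3 : C) :
  jet f a0 a1 a2 a3 -> jet g b0 b1 b2 b3 ->
  jet (fun w => f w * g w) (a0 * b0) (a0 * b1 + a1 * b0) (a0 * b2 + a1 * b1 + a2 * b0)
    (a0 * b3 + a1 * b2 + a2 * b1 + a3 * b0).
Proof.
  intros Hf Hg.
  apply (bigO_ext 4 (fun w => ((f w - poly3 a0 a1 a2 a3 w) * g w
    + poly3 a0 a1 a2 a3 w * (g w - poly3 b0 b1 b2 b3 w))
    + 1 * w ^ 4 * poly3 (a1 * b3 + a2 * b2 + a3 * b1) (a2 * b3 + a3 * b2) (a3 * b3) 0 w) _ 1 Rlt_0_1).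
  - intros. unfold poly3. ring.
  - apply bigO_plus; [apply bigO_plus|].
    + apply (bigO_mult 4 0); [exact Hf | eapply jet_bigO_0, Hg].
    + apply (bigO_mult 0 4); [apply bigO_poly3_0 | exact Hg].
    + apply (bigO_mult 4 0 (fun w => 1 * w ^ 4)); [apply bigO_monomial | apply bigO_poly3_0].
Qed.

Lemma jet_poly3 (a0 a1 a2 a3 : C) : jet (poly3 a0 a1 a2 a3) a0 a1 a2 a3.
Proof.
  apply (bigO_ext 4 (fun w => 0 * w ^ 4) _ 1 Rlt_0_1); [intros; ring | apply bigO_monomial].
Qed.

Lemma jet_const (c : C) : jet (fun _ => c) c 0 0 0.
Proof.
  apply (jet_ext (poly3 c 0 0 0) _ _ _ _ _ 1 Rlt_0_1); [intros; unfold poly3; ring | apply jet_poly3].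
Qed.

Lemma jet_id : jet (fun w => w) 0 1 0 0.
Proof.
  apply (jet_ext (poly3 0 1 0 0) _ _ _ _ _ 1 Rlt_0_1); [intros; unfold poly3; ring | apply jet_poly3].
Qed.

Lemma jet_eq (f : C -> C) (a0 a1 a2 a3 b0 b1 b2 b3 : C) : jet f a0 a1 a2 a3 ->
  a0 = b0 -> a1 = b1 -> a2 = b2 -> a3 = b3 -> jet f b0 b1 b2 b3.
Proof. now intros H <- <- <- <-. Qed.

(** A polynomial of degree at most three which is [O(w^4)] vanishes: its constant term is
    [O(w)], hence zero, and one may divide by [w]. *)
Lemma jet_unique (f : C -> C) (a0 a1 a2 a3 b0 b1 b2 b3 : C) :
  jet f a0 a1 a2 a3 -> jet f b0 b1 b2 b3 -> a0 = b0 /\ a1 = b1 /\ a2 = b2 /\ a3 = b3.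
Proof.
  intros Ha Hb.
  assert (S1 : forall k (c0 c1 c2 c3 : C), bigO (S k) (poly3 c0 c1 c2 c3) ->
    c0 = 0 /\ bigO k (poly3 c1 c2 c3 0)).
  { intros k c0 c1 c2 c3 H.
    assert (c0 = 0) as ->.
    { apply bigO_1_const.
      apply (bigO_ext 1 (fun w => poly3 c0 c1 c2 c3 w + (-(1)) * w ^ 1 * poly3 c1 c2 c3 0 w) _ 1 Rlt_0_1).
      - intros. unfold poly3. ring.
      - apply bigO_plus; [apply (bigO_weaken (S k)); [lia | exact H]|].
        apply (bigO_mult 1 0 (fun w => -(1) * w ^ 1)); [apply bigO_monomial | apply bigO_poly3_0]. }
    split; [reflexivity|]. apply bigO_div.
    eapply (bigO_ext _ _ _ 1 Rlt_0_1); [|exact H]. intros. unfold poly3. ring. }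
  assert (H : bigO 4 (poly3 (a0 - b0) (a1 - b1) (a2 - b2) (a3 - b3))).
  { apply (bigO_ext 4 (fun w => (f w - poly3 b0 b1 b2 b3 w)
       + (-(1)) * w ^ 0 * (f w - poly3 a0 a1 a2 a3 w)) _ 1 Rlt_0_1).
    - intros. unfold poly3. simpl. ring.
    - apply bigO_plus; [exact Hb|].
      apply (bigO_mult 0 4 (fun w => -(1) * w ^ 0)); [apply bigO_monomial | exact Ha]. }
  apply S1 in H. destruct H as [E0 H]. apply S1 in H. destruct H as [E1 H].
  apply S1 in H. destruct H as [E2 H]. apply S1 in H. destruct H as [E3 _].
  repeat split; now apply Ceq_minus.
Qed.

(** The hypothesis on [phi 0] covers the points where [u] vanishes, about which a
    jet of [phi] says nothing. *)
Lemma jet_comp (phi u : C -> C) (p0 p1 p2 p3 u1 u2 u3 : C) :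
  jet phi p0 p1 p2 p3 -> phi 0 = p0 -> jet u 0 u1 u2 u3 ->
  jet (fun w => phi (u w)) p0 (p1 * u1) (p1 * u2 + p2 * u1 ^ 2)
    (p1 * u3 + 2 * p2 * u1 * u2 + p3 * u1 ^ 3).
Proof.
  intros Hphi H0 Hu.
  assert (R1 : bigO 4 (fun w => phi (u w) - poly3 p0 p1 p2 p3 (u w))).
  { destruct Hphi as [M [d [HM [Hd H]]]].
    destruct (jet_bigO_1 _ _ _ _ Hu) as [K [d' [HK [Hd' H']]]].
    exists (M * K ^ 4)%R, (Rmin d' (d / (K + 1))). split.
    { apply Rmult_le_pos; [exact HM | now apply pow_le]. }
    split; [apply Rmin_glb_lt; [exact Hd' | apply Rdiv_lt_0_compat; lra]|].
    intros w Hw Hwd.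
    assert (W1 := Rlt_le_trans _ _ _ Hwd (Rmin_l _ _)).
    assert (W2 := Rlt_le_trans _ _ _ Hwd (Rmin_r _ _)).
    specialize (H' w Hw W1). simpl in H'. rewrite Rmult_1_r in H'.
    pose proof (Cmod_ge_0 w) as P0. pose proof (Cmod_ge_0 (u w)) as Pu.
    apply Rlt_div_r in W2; [|lra].
    destruct (classic (u w = 0)) as [Z|Z].
    - rewrite Z, H0. replace (p0 - poly3 p0 p1 p2 p3 0) with (RtoC 0) by (unfold poly3; ring).
      rewrite Cmod_0. apply Rmult_le_pos; [|now apply pow_le].
      apply Rmult_le_pos; [exact HM | now apply pow_le].
    - eapply Rle_trans; [apply H; [exact Z | nra]|].
      rewrite Rmult_assoc, <- Rpow_mult_distr. apply Rmult_le_compat_l; [exact HM|].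
      apply pow_incr. lra. }
  assert (R2 : jet (fun w => poly3 p0 p1 p2 p3 (u w)) p0 (p1 * u1) (p1 * u2 + p2 * u1 ^ 2)
    (p1 * u3 + 2 * p2 * u1 * u2 + p3 * u1 ^ 3)).
  { pose proof (jet_mult _ _ _ _ _ _ _ _ _ _ Hu Hu) as Hu2.
    pose proof (jet_mult _ _ _ _ _ _ _ _ _ _ Hu2 Hu) as Hu3.
    pose proof (jet_plus _ _ _ _ _ _ _ _ _ _ (jet_const p0)
      (jet_mult _ _ _ _ _ _ _ _ _ _ (jet_const p1) Hu)) as A1.
    pose proof (jet_plus _ _ _ _ _ _ _ _ _ _ A1
      (jet_mult _ _ _ _ _ _ _ _ _ _ (jet_const p2) Hu2)) as A2.
    pose proof (jet_plus _ _ _ _ _ _ _ _ _ _ A2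
      (jet_mult _ _ _ _ _ _ _ _ _ _ (jet_const p3) Hu3)) as A3.
    eapply jet_eq.
    - eapply (jet_ext _ _ _ _ _ _ 1 Rlt_0_1); [|exact A3]. intros. unfold poly3. ring.
    - ring.
    - ring.
    - ring.
    - ring. }
  eapply (bigO_ext _ _ _ 1 Rlt_0_1); [|exact (bigO_plus _ _ _ R1 R2)]. intros. cbv beta. ring.
Qed.

(** * Uniqueness of coefficients *)

(** For [Cmod w <= r / 2] the tail from the fourth term on is dominated by a geometric
    series of ratio [1 / 2]. *)
Lemma series_jet (a : nat -> C) (f : C -> C) (R0 : R) : (0 < R0)%R ->
  (forall w : C, w <> 0 -> (Cmod w < R0)%R -> cser (fun k => a k * w ^ k) (f w)) ->
  jet f (a 0%nat) (a 1%nat) (a 2%nat) (a 3%nat).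
Proof.
  intros HR H. set (r := (R0 / 2)%R).
  assert (Er : Cmod r = r) by (rewrite Cmod_R; apply Rabs_pos_eq; unfold r; lra).
  assert (Hr : (0 < r)%R) by (unfold r; lra).
  destruct (cser_bound _ _ (H (RtoC r) ltac:(apply Cmod_gt_0; lra) ltac:(rewrite Er; unfold r; lra)))
    as [M [HM HB]].
  assert (HB' : forall n, (Cmod (a n) * r ^ n <= M)%R).
  { intros n. specialize (HB n). rewrite Cmod_mult, Cmod_pow, Er in HB. exact HB. }
  exists (2 * (M / r ^ 4))%R, (r / 2)%R.
  assert (Hr4 : (0 < r ^ 4)%R) by now apply pow_lt.
  split. { apply Rmult_le_pos; [lra | apply Rdiv_le_0_compat; lra]. }
  split; [lra|]. intros w Hw Hwd. pose proof (Cmod_ge_0 w) as P0.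
  pose proof (H w Hw ltac:(unfold r in *; lra)) as Hs.
  assert (T : cser (fun k => a (S (S (S (S k)))) * w ^ S (S (S (S k)))) (f w - poly3 (a 0%nat) (a 1%nat) (a 2%nat) (a 3%nat) w)).
  { do 4 (apply cser_shift with (a := fun k => a _ * w ^ _)).
    replace (_ + _) with (f w) by (unfold poly3; simpl; ring). exact Hs. }
  apply (cser_le _ _ _ T).
  apply (csum_Cmod_le _ (fun n => (/ 2) ^ n * (M / r ^ 4 * Cmod w ^ 4))%R).
  - intros n. rewrite Cmod_mult, Cmod_pow.
    change (S (S (S (S n)))) with (4 + n)%nat. rewrite pow_add.
    apply Rle_trans with (Cmod (a (4 + n)%nat) * (Cmod w ^ 4 * (r / 2) ^ n))%R.
    + apply Rmult_le_compat_l; [apply Cmod_ge_0|]. apply Rmult_le_compat_l; [now apply pow_le|].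
      apply pow_incr. lra.
    + specialize (HB' (4 + n)%nat). rewrite pow_add in HB'. unfold Rdiv. rewrite Rpow_mult_distr.
      replace (Cmod (a (4 + n)%nat) * (Cmod w ^ 4 * (r ^ n * (/ 2) ^ n)))%R
        with ((Cmod (a (4 + n)%nat) * (r ^ 4 * r ^ n)) * (/ r ^ 4 * (/ 2) ^ n * Cmod w ^ 4))%R
        by (field; lra).
      replace ((/ 2) ^ n * (M * / r ^ 4 * Cmod w ^ 4))%R
        with (M * (/ r ^ 4 * (/ 2) ^ n * Cmod w ^ 4))%R by ring.
      apply Rmult_le_compat_r; [|exact HB'].
      apply Rmult_le_pos; [apply Rmult_le_pos; [apply Rlt_le, Rinv_0_lt_compat, Hr4 | apply pow_le; lra] | now apply pow_le].
  - replace (2 * (M / r ^ 4) * Cmod w ^ 4)%R with (/ (1 - / 2) * (M / r ^ 4 * Cmod w ^ 4))%R by (field; lra).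
    apply (is_series_scal_r (M / r ^ 4 * Cmod w ^ 4) (fun n => (/ 2) ^ n)%R).
    apply is_series_geom. rewrite Rabs_pos_eq; lra.
Qed.

(** The constant term vanishes by uniqueness of jets; dividing the series by [w]
    shifts the coefficients. *)
Lemma series_zero (R0 : R) : (0 < R0)%R -> forall (n : nat) (a : nat -> C),
  (forall w : C, w <> 0 -> (Cmod w < R0)%R -> cser (fun k => a k * w ^ k) 0) -> a n = 0.
Proof.
  intros HR. induction n as [|n IH]; intros a H.
  - destruct (jet_unique _ _ _ _ _ _ _ _ _ (series_jet a (fun _ => 0) R0 HR H) (jet_const 0)) as [E _].
    exact E.
  - apply (IH (fun k => a (S k))). intros w Hw Hwd.
    assert (E0 : a O = 0).
    { destruct (jet_unique _ _ _ _ _ _ _ _ _ (series_jet a (fun _ => 0) R0 HR H) (jet_const 0)) as [E _].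
      exact E. }
    pose proof (H w Hw Hwd) as Hs.
    replace (RtoC 0) with (a O * w ^ 0 + 0) in Hs by (rewrite E0; ring).
    apply (cser_shift (fun k => a k * w ^ k)) in Hs. apply (cser_scal (/ w)) in Hs.
    replace (/ w * 0) with (RtoC 0) in Hs by ring.
    eapply cser_ext; [|exact Hs]. intros k. simpl. field. exact Hw.
Qed.

Lemma series_unique (a b : nat -> C) (f : C -> C) (R0 : R) : (0 < R0)%R ->
  series_on a f R0 -> series_on b f R0 -> forall n, a n = b n.
Proof.
  intros HR Ha Hb n. apply Ceq_minus. apply (series_zero R0 HR n (fun k => a k - b k)).
  intros w _ Hw. replace (RtoC 0) with (f w + (-(1)) * f w) by ring.
  eapply cser_ext; [|exact (cser_lin _ _ _ _ _ (Ha w Hw) (Hb w Hw))]. intros k. cbv beta. ring.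
Qed.

Lemma cser_at_0 (a : nat -> C) : cser (fun k => a k * 0 ^ k) (a O).
Proof.
  replace (a O) with (a O * 0 ^ 0 + 0) by (simpl; ring).
  apply (cser_shift (fun k => a k * 0 ^ k)).
  eapply cser_ext; [|exact cser_zero]. intros k. simpl. ring.
Qed.

Lemma series_at_0 (a : nat -> C) (f : C -> C) (R0 : R) : (0 < R0)%R -> series_on a f R0 -> f 0 = a O.
Proof.
  intros HR H. apply (cser_unique (fun k => a k * 0 ^ k)); [|apply cser_at_0].
  apply H. rewrite Cmod_0. exact HR.
Qed.

(** * The principal logarithm *)

Lemma cexp_Clog (z : C) : z <> 0 -> cexp (Clog z) = z.
Proof.
  intros Hz. apply Cmod_gt_0 in Hz as Hm. unfold cexp, Clog. simpl. rewrite exp_ln by exact Hm.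
  pose proof (re_le_Cmod z) as B.
  assert (Hx : (-1 <= Re z / Cmod z <= 1)%R).
  { apply Rabs_le_between. unfold Rdiv. rewrite Rabs_mult, (Rabs_pos_eq (/ Cmod z)) by (apply Rlt_le, Rinv_0_lt_compat, Hm).
    apply Rle_div_l; [exact Hm|]. lra. }
  assert (Hs : sin (acos (Re z / Cmod z)) = (Rabs (Im z) / Cmod z)%R).
  { rewrite sin_acos by exact Hx.
    replace (1 - (Re z / Cmod z)²)%R with ((Im z / Cmod z)²)%R.
    - rewrite sqrt_Rsqr_abs. unfold Rdiv. rewrite Rabs_mult, (Rabs_pos_eq (/ Cmod z)); [reflexivity|].
      apply Rlt_le, Rinv_0_lt_compat, Hm.
    - unfold Rsqr. pose proof (Cmod2_alt z) as E. field_simplify_eq; [|lra].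
      rewrite E. ring. }
  destruct z as [x y]. unfold Carg. simpl Re in *. simpl Im in *.
  set (m := Cmod (x, y)) in *. destruct Rle_dec as [Hy|Hy].
  - rewrite cos_acos, Hs, Rabs_pos_eq by assumption. apply injective_projections; simpl; field; lra.
  - rewrite cos_neg, sin_neg, cos_acos, Hs, Rabs_left by (assumption || lra).
    apply injective_projections; simpl; field; lra.
Qed.

(** The sign of [Im (cexp z)] is that of [sin (Im z)], hence that of [Im z] in this
    strip, so that both branches of the argument return [Im z]. *)
Lemma Clog_cexp (z : C) : (- PI < Im z < PI)%R -> Clog (cexp z) = z.
Proof.
  intros Hz. unfold Clog. rewrite Cmod_cexp, ln_exp. destruct z as [x y]. simpl in Hz. f_equal. simpl.
  unfold Carg. rewrite Cmod_cexp. simpl. pose proof (exp_pos x) as Hp.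
  replace (exp x * cos y / exp x)%R with (cos y) by (field; lra).
  destruct Rle_dec as [Hy|Hy].
  - destruct (Rle_dec 0 y) as [Y|Y]; [apply acos_cos; lra|]. exfalso.
    assert (0 < sin (- y))%R by (apply sin_gt_0; lra). rewrite sin_neg in *. nra.
  - destruct (Rle_dec 0 y) as [Y|Y].
    + exfalso. assert (0 <= sin y)%R by (apply sin_ge_0; lra). nra.
    + rewrite <- (cos_neg y), acos_cos by lra. ring.
Qed.

Lemma Carg_right (z : C) : (0 < Re z)%R -> Carg z = atan (Im z / Re z).
Proof.
  intros Hz. assert (Hz0 : z <> 0). { intros ->. simpl in Hz. lra. }
  apply Cmod_gt_0 in Hz0 as Hm.
  assert (Hb : (- (PI / 2) < Carg z < PI / 2)%R).
  { pose proof (atan_bound) as AB. unfold Carg.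
    assert (0 < Re z / Cmod z)%R by (apply Rdiv_lt_0_compat; assumption).
    pose proof (acos_bound (Re z / Cmod z)) as [A0 _].
    destruct Rle_dec; rewrite acos_atan in * by assumption;
     destruct (AB (sqrt (1 - (Re z / Cmod z)²) / (Re z / Cmod z))%R); pose proof PI_RGT_0; lra. }
  pose proof (cexp_Clog z Hz0) as E. unfold cexp, Clog in E. simpl in E.
  rewrite exp_ln in E by exact Hm. rewrite <- (atan_tan (Carg z)) at 1 by lra. f_equal.
  unfold tan. destruct z as [x y]. simpl in *. set (th := Carg (x, y)) in *. set (m := Cmod (x, y)) in *.
  injection E as E1 E2. rewrite <- E1, <- E2.
  assert (cos th <> 0)%R by (intros Z; rewrite Z in E1; lra). field. split; [assumption | lra].
Qed.

Lemma ccont_real (h : C -> R) (g : R -> R) (z : C) :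
  ccont (fun w => RtoC (h w)) z -> continuity_pt g (h z) -> ccont (fun w => RtoC (g (h w))) z.
Proof.
  intros Hh Hg e He. destruct (Hg e He) as [d [Hd H]]. destruct (Hh d Hd) as [d' [Hd' H']].
  exists d'. split; [exact Hd'|]. intros w Hw. specialize (H' w Hw).
  rewrite <- RtoC_minus, Cmod_R in *.
  destruct (Req_dec (h w) (h z)) as [E|E].
  - rewrite E, Rminus_diag, Rabs_R0. exact He.
  - apply (H (h w)). split; [split; [exact I | auto] | exact H'].
Qed.

Lemma ccont_Re (z : C) : ccont (fun w => RtoC (Re w)) z.
Proof.
  intros e He. exists e. split; [exact He|]. intros w Hw.
  rewrite <- RtoC_minus, Cmod_R. eapply Rle_lt_trans; [|exact Hw].
  exact (Rabs_Re_le (w - z)).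
Qed.

Lemma ccont_Im (z : C) : ccont (fun w => RtoC (Im w)) z.
Proof.
  intros e He. exists e. split; [exact He|]. intros w Hw.
  rewrite <- RtoC_minus, Cmod_R. eapply Rle_lt_trans; [|exact Hw].
  exact (Rabs_Im_le (w - z)).
Qed.

Lemma ccont_Cmod (z : C) : ccont (fun w => RtoC (Cmod w)) z.
Proof.
  intros e He. exists e. split; [exact He|]. intros w Hw.
  rewrite <- RtoC_minus, Cmod_R. eapply Rle_lt_trans; [|exact Hw].
  pose proof (Cmod_minus_ge w z). pose proof (Cmod_minus_ge z w) as H2. rewrite Cmod_minus_sym in H2.
  apply Rabs_le. lra.
Qed.

Lemma pair_decompose (x y : R) : ((x, y) : C) = RtoC x + Ci * RtoC y.
Proof. apply injective_projections; simpl; ring. Qed.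

Lemma ccont_Clog (z : C) : (0 < Re z)%R -> ccont Clog z.
Proof.
  intros Hz. assert (Hz0 : z <> 0). { intros ->. simpl in Hz. lra. }
  apply Cmod_gt_0 in Hz0 as Hm.
  apply (ccont_ext_loc (fun w => RtoC (ln (Cmod w)) + Ci * RtoC (atan (Im w / Re w))) _ z (Re z) Hz).
  - intros w Hw. pose proof (Rabs_Re_le (w - z)) as B.
    assert (0 < Re w)%R. { simpl in B. apply Rabs_le_between in B. unfold Re in *. lra. }
    unfold Clog. rewrite Carg_right by assumption. symmetry. apply pair_decompose.
  - apply ccont_plus.
    + apply (ccont_real Cmod ln); [apply ccont_Cmod|].
      apply derivable_continuous_pt. exists (/ Cmod z)%R. now apply derivable_pt_lim_ln.
    + apply ccont_mult; [apply ccont_const|]. apply (ccont_real (fun w => Im w / Re w)%R atan).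
      * apply (ccont_ext_loc (fun w => RtoC (Im w) * / RtoC (Re w)) _ z (Re z) Hz).
        -- intros w Hw. pose proof (Rabs_Re_le (w - z)) as B.
           assert (0 < Re w)%R. { simpl in B. apply Rabs_le_between in B. unfold Re in *. lra. }
           rewrite <- RtoC_inv, <- RtoC_mult by lra. reflexivity.
        -- apply ccont_mult; [apply ccont_Im|]. apply ccont_inv; [|apply ccont_Re].
           intros E. apply RtoC_inj in E. lra.
      * apply derivable_continuous_pt, derivable_pt_atan.
Qed.

(** The derivative of an inverse function: the slope of the logarithm is the inverse
    of the slope of the exponential, and the logarithm is continuous. *)
Lemma cderiv_Clog (z : C) : (0 < Re z)%R -> cderiv Clog z (/ z).
Proof.
  intros Hz. assert (Hz0 : z <> 0). { intros ->. simpl in Hz. lra. }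
  set (S := fun w => slope cexp (Clog z) z (Clog w)).
  assert (Sz : S z = z) by (unfold S; apply slope_at).
  assert (HS : ccont S z).
  { apply (ccont_comp Clog (slope cexp (Clog z) z)); [now apply ccont_Clog|].
    rewrite <- (cexp_Clog z Hz0) at 2. apply cderiv_cexp. }
  eapply cderiv_eq.
  - apply (cderiv_intro Clog (fun w => / S w) z (Re z) Hz).
    + intros w Hw. pose proof (Rabs_Re_le (w - z)) as B.
      assert (Hw0 : w <> 0).
      { intros ->. simpl in B. apply Rabs_le_between in B. unfold Re in *. simpl in B. lra. }
      pose proof (slope_spec cexp (Clog z) z (Clog w)) as E.
      rewrite !cexp_Clog in E by assumption. fold (S w) in E.
      destruct (classic (w = z)) as [->|Hn]; [ring|].
      assert (S w <> 0). { intros Z. apply Hn. rewrite Z in E. rewrite E. ring. }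
      assert (E2 : w - z = S w * (Clog w - Clog z)).
      { apply (f_equal (fun v => v - z)) in E. etransitivity; [exact E | cbv beta; ring]. }
      rewrite E2. field. assumption.
    + apply ccont_inv; [now rewrite Sz | exact HS].
  - cbv beta. now rewrite Sz.
Qed.

(** As the exponential is its own derivative, its Taylor coefficients satisfy
    [(n + 1) a (n + 1) = a n]. *)
Lemma jet_cexp : jet cexp 1 1 (1 / 2) (1 / 6).
Proof.
  destruct (taylor cexp 1 Rlt_0_1) as [a [Ha _]].
  { intros z _. exists (cexp z). apply cderiv_cexp. }
  pose proof (series_deriv a cexp cexp 1 Ha (fun z _ => cderiv_cexp z)) as Hd.
  pose proof (series_unique _ _ _ _ Rlt_0_1 Hd Ha) as E.
  assert (E0 : a O = 1) by (rewrite <- (series_at_0 a cexp 1 Rlt_0_1 Ha); apply cexp_0).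
  pose proof (E 0%nat) as E1. pose proof (E 1%nat) as E2. pose proof (E 2%nat) as E3.
  cbv beta in E1, E2, E3. rewrite E0 in E1. simpl INR in E1, E2, E3.
  rewrite Cmult_1_l in E1. rewrite E1 in E2.
  replace (1 + 1)%R with 2%R in * by ring. replace (2 + 1)%R with 3%R in * by ring.
  assert (A2 : a 2%nat = 1 / 2) by (rewrite <- E2; field).
  rewrite A2 in E3.
  eapply jet_eq; [exact (series_jet a cexp 1 Rlt_0_1 (fun w _ => Ha w)) | exact E0 | exact E1 | exact A2 |].
  replace (a 3%nat) with (3 * a 3%nat / 3) by field. rewrite E3. field.
Qed.

(** * Bessel's inequality and the coefficients of Schwarz functions *)

Lemma ccont_Cconj (f : C -> C) (z : C) : ccont f z -> ccont (fun w => Cconj (f w)) z.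
Proof.
  intros H e He. destruct (H e He) as [d [Hd Hw]]. exists d. split; [exact Hd|].
  intros w W. rewrite <- Cminus_conj, Cmod_conj. auto.
Qed.

Lemma mean_Cconj (h : C -> C) (r : R) : (0 <= r)%R -> cont_circle h r ->
  mean (fun u => Cconj (h u)) r = Cconj (mean h r).
Proof.
  intros Hr Hh. apply mean_intro. pose proof (isI_circle h r Hr Hh) as H.
  apply isI_components in H. destruct H as [H1 H2]. apply isI_components.
  rewrite re_scal_r, im_scal_r in *. rewrite re_conj, im_conj. split.
  - exact H1.
  - replace (- Im (mean h r) * (2 * PI))%R with (opp (Im (mean h r) * (2 * PI))%R)
      by (unfold opp; simpl; ring).
    exact (is_RInt_opp _ _ _ _ H2).
Qed.

(** On a circle, conjugation is a rational function; so are the conjugates of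
    trigonometric polynomials. *)
Lemma circle_inv (r : R) (u : C) : (0 < r)%R -> Cmod u = r -> Cconj u = RtoC (r ^ 2) * / u.
Proof.
  intros Hr Hu. assert (Hu0 : u <> 0) by (apply circle_neq_0 with r; assumption).
  rewrite <- Hu, Cmod2_conj. field. exact Hu0.
Qed.

Lemma mean_pow_inv_pow (k n : nat) (r : R) : (0 < r)%R -> (k < n)%nat ->
  mean (fun u => u ^ k * (/ u) ^ n) r = 0.
Proof.
  intros Hr Hkn. rewrite <- (mean_inv_pow (n - k - 1) r Hr). apply mean_ext; [lra|].
  intros u Hu. assert (Hu0 : u <> 0) by (apply circle_neq_0 with r; assumption).
  replace n with (k + S (n - k - 1))%nat at 1 by lia.
  rewrite Cpow_add_r, !Cpow_inv by exact Hu0. field. split; apply Cpow_nz, Hu0.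
Qed.

Lemma cont_circle_inv_pow (k : nat) (r : R) : (0 < r)%R -> cont_circle (fun u => (/ u) ^ k) r.
Proof.
  intros Hr. apply cont_circle_cderiv. intros u Hu. apply cderiv_inv_pow.
  now apply circle_neq_0 with r.
Qed.

Lemma cont_circle_mult (f g : C -> C) (r : R) :
  cont_circle f r -> cont_circle g r -> cont_circle (fun u => f u * g u) r.
Proof. intros Hf Hg u Hu. apply ccont_mult; auto. Qed.

Lemma cont_circle_plus (f g : C -> C) (r : R) :
  cont_circle f r -> cont_circle g r -> cont_circle (fun u => f u + g u) r.
Proof. intros Hf Hg u Hu. apply ccont_plus; auto. Qed.

Lemma cont_circle_const (c : C) (r : R) : cont_circle (fun _ => c) r.
Proof. intros u _. apply ccont_const. Qed.

Lemma cont_circle_Cconj (f : C -> C) (r : R) : cont_circle f r -> cont_circle (fun u => Cconj (f u)) r.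
Proof. intros Hf u Hu. apply ccont_Cconj; auto. Qed.

Lemma cont_circle_pow (n : nat) (r : R) : cont_circle (fun u => u ^ n) r.
Proof.
  intros u _. induction n as [|n IH]; [exact (ccont_const 1 u)|].
  apply (ccont_mult (fun u => u)); [apply ccont_id | exact IH].
Qed.

(** The [n] first Taylor terms form the orthogonal projection of [g] on the circle:
    adding the next term removes exactly its own square norm. *)
Lemma bessel_identity (g : C -> C) (a : nat -> C) (r : R) (n : nat) : (0 < r)%R -> cont_circle g r ->
  (forall k, a k = mean (fun u => g u * (/ u) ^ k) r) ->
  let e := fun u => g u + (-(1)) * csum (fun k => a k * u ^ k) n in
  cont_circle e r /\
  mean (fun u => e u * Cconj (e u)) r
  = mean (fun u => g u * Cconj (g u)) r
    - csum (fun k => a k * Cconj (a k) * RtoC ((r ^ 2) ^ k)) n.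
Proof.
  intros Hr Hg Ha. intros e; unfold e; clear e. induction n as [|n [IH1 IH2]]; cbn [csum].
  - split.
    + intros u Hu. apply ccont_plus; [now apply Hg|]. apply ccont_mult; apply ccont_const.
    + transitivity (mean (fun u => g u * Cconj (g u)) r); [|ring].
      apply mean_ext; [lra|]. intros u _. replace (g u + - (1) * 0) with (g u) by ring. reflexivity.
  - set (e := fun u => g u + - (1) * csum (fun k => a k * u ^ k) n) in *.
    assert (Ce : cont_circle (fun u => e u + (- a n) * u ^ n) r).
    { apply cont_circle_plus; [exact IH1|].
      apply cont_circle_mult; [apply cont_circle_const | apply cont_circle_pow]. }
    assert (Ee : forall u, g u + - (1) * (csum (fun k => a k * u ^ k) n + a n * u ^ n)
        = e u + (- a n) * u ^ n) by (intros u; unfold e; ring).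
    split.
    { intros u Hu. apply (ccont_ext_loc (fun u => e u + (- a n) * u ^ n) _ u 1 Rlt_0_1); [|now apply Ce].
      intros w _. symmetry. apply Ee. }
    (* Subtracting the first terms does not change the next coefficient. *)
    assert (Hcoef : mean (fun u => e u * (/ u) ^ n) r = a n).
    { destruct (mean_csum (fun k u => a k * (u ^ k * (/ u) ^ n)) r n ltac:(lra)) as [C1 M1].
      { intros k. apply cont_circle_mult; [apply cont_circle_const|].
        apply cont_circle_mult; [apply cont_circle_pow | now apply cont_circle_inv_pow]. }
      assert (C2 : cont_circle (fun u => g u * (/ u) ^ n) r)
        by (apply cont_circle_mult; [exact Hg | now apply cont_circle_inv_pow]).
      transitivity (mean (fun u => g u * (/ u) ^ n
         + (-(1)) * csum (fun k => a k * (u ^ k * (/ u) ^ n)) n) r).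
      { apply mean_ext; [lra|]. intros u _. unfold e.
        assert (X : csum (fun k => a k * (u ^ k * (/ u) ^ n)) n
          = csum (fun k => a k * u ^ k) n * (/ u) ^ n).
        { generalize (/ u ^ n). intros _. generalize ((/ u) ^ n). intros c.
          clear. induction n as [|n IH]; simpl; [ring | rewrite IH; ring]. }
        rewrite X. ring. }
      rewrite mean_plus, mean_scal, M1, <- Ha; try lra; try assumption.
      - replace (csum _ n) with (RtoC 0); [ring|].
        assert (Z : forall m, (m <= n)%nat ->
          RtoC 0 = csum (fun k => mean (fun u => a k * (u ^ k * (/ u) ^ n)) r) m).
        { induction m as [|m IHm]; intros Hm; simpl; [reflexivity|].
          rewrite <- IHm by lia. rewrite mean_scal, mean_pow_inv_pow; try lra; try lia; [ring|].
          apply cont_circle_mult; [apply cont_circle_pow | now apply cont_circle_inv_pow]. }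
        now apply Z.
      - apply cont_circle_mult; [apply cont_circle_const | exact C1]. }
    set (R2 := RtoC ((r ^ 2) ^ n)).
    assert (C3 : cont_circle (fun u => e u * (/ u) ^ n) r)
      by (apply cont_circle_mult; [exact IH1 | now apply cont_circle_inv_pow]).
    assert (C4 : cont_circle (fun u => e u * Cconj (e u)) r)
      by (apply cont_circle_mult; [exact IH1 | now apply cont_circle_Cconj]).
    transitivity (mean (fun u => e u * Cconj (e u)
       + ((- (Cconj (a n) * R2)) * (e u * (/ u) ^ n)
       + ((- (a n * R2)) * Cconj (e u * (/ u) ^ n) + a n * Cconj (a n) * R2))) r).
    { apply mean_ext; [lra|]. intros u Hu. rewrite Ee.
      assert (Hu0 : u <> 0) by (apply circle_neq_0 with r; assumption).
      assert (K1 : Cconj (u ^ n) = R2 * (/ u) ^ n).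
      { rewrite Cpow_conj, (circle_inv r u Hr Hu), Cpow_mult_l. unfold R2. now rewrite (RtoC_pow (r ^ 2) n). }
      assert (K2 : u ^ n = R2 * Cconj ((/ u) ^ n)).
      { transitivity (Cconj (Cconj (u ^ n))); [now rewrite Cconj_conj|].
        rewrite K1, Cmult_conj. f_equal. unfold R2. apply injective_projections; simpl; ring. }
      assert (K3 : u ^ n * (/ u) ^ n = 1) by (rewrite <- Cpow_mult_l, (Cinv_r u Hu0); apply Cpow_1_l).
      rewrite Cplus_conj, !Cmult_conj, Copp_conj.
      transitivity (e u * Cconj (e u) - Cconj (a n) * Cconj (u ^ n) * e u
        - a n * u ^ n * Cconj (e u) + a n * Cconj (a n) * (u ^ n * Cconj (u ^ n))); [ring|].
      rewrite K1. replace (u ^ n * (R2 * (/ u) ^ n)) with R2 by (transitivity (R2 * (u ^ n * (/ u) ^ n)); [rewrite K3|]; ring).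
      rewrite K2. ring. }
    assert (C5 : cont_circle (fun u => - (Cconj (a n) * R2) * (e u * (/ u) ^ n)) r)
      by (apply cont_circle_mult; [apply cont_circle_const | exact C3]).
    assert (C6 : cont_circle (fun u => - (a n * R2) * Cconj (e u * (/ u) ^ n)) r)
      by (apply cont_circle_mult; [apply cont_circle_const | now apply cont_circle_Cconj]).
    rewrite mean_plus; [|lra|exact C4|].
    2:{ apply cont_circle_plus; [exact C5|]. apply cont_circle_plus; [exact C6 | apply cont_circle_const]. }
    rewrite mean_plus; [|lra|exact C5|].
    2:{ apply cont_circle_plus; [exact C6 | apply cont_circle_const]. }
    rewrite mean_plus; [|lra|exact C6| apply cont_circle_const].
    rewrite (mean_scal _ (fun u => e u * (/ u) ^ n)); [|lra|exact C3].
    rewrite (mean_scal _ (fun u => Cconj (e u * (/ u) ^ n))); [|lra|now apply cont_circle_Cconj].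
    rewrite (mean_Cconj (fun u => e u * (/ u) ^ n)); [|lra|exact C3].
    change (mean (fun u => e u * Cconj (e u)) r = mean (fun u => g u * Cconj (g u)) r -
      csum (fun k => a k * Cconj (a k) * RtoC ((r ^ 2) ^ k)) n) in IH2.
    rewrite Hcoef, mean_cst, IH2. fold R2. ring.
Qed.

Lemma Re_minus (x y : C) : Re (x - y) = (Re x - Re y)%R.
Proof. reflexivity. Qed.

Lemma Re_mult_Cconj (z : C) : Re (z * Cconj z) = (Cmod z ^ 2)%R.
Proof. rewrite <- Cmod2_conj. apply re_RtoC. Qed.

Fixpoint rsum (b : nat -> R) (n : nat) : R :=
  match n with O => 0%R | S k => (rsum b k + b k)%R end.

Lemma bessel (g : C -> C) (a : nat -> C) (r : R) (n : nat) : (0 < r)%R -> cont_circle g r ->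
  (forall k, a k = mean (fun u => g u * (/ u) ^ k) r) ->
  (rsum (fun k => Cmod (a k) ^ 2 * (r ^ 2) ^ k) n <= Re (mean (fun u => g u * Cconj (g u))%C r))%R.
Proof.
  intros Hr Hg Ha. destruct (bessel_identity g a r n Hr Hg Ha) as [Ce E].
  set (e := fun u => g u + - (1) * csum (fun k => a k * u ^ k) n) in *.
  assert (P : (0 <= Re (mean (fun u => e u * Cconj (e u))%C r))%R).
  { apply mean_Re_ge_0; [lra | |].
    - apply cont_circle_mult; [exact Ce | now apply cont_circle_Cconj].
    - intros u _. rewrite Re_mult_Cconj. apply pow2_ge_0. }
  unfold e in P. rewrite E in P.
  assert (S0 : Re (csum (fun k => a k * Cconj (a k) * RtoC ((r ^ 2) ^ k)) n)
    = rsum (fun k => Cmod (a k) ^ 2 * (r ^ 2) ^ k)%R n).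
  { clear. induction n as [|n IH]; [reflexivity|]. cbn [csum rsum]. rewrite <- IH.
    rewrite <- (Re_mult_Cconj (a n)), <- re_scal_r. reflexivity. }
  rewrite Re_minus, S0 in P. lra.
Qed.

(** On the circle of radius [r < 1] the function [w (1 + xi u)] is bounded by
    [1 + xi u], whose mean square is [1 + |xi|^2 r^2].  Bessel's inequality with
    the Taylor terms up to order three and [r] tending to [1] give the claim. *)
Lemma schwarz_bessel (w : C -> C) (b1 b2 b3 xi : C) : holo w 1 ->
  (forall z, (Cmod z < 1)%R -> (Cmod (w z) <= 1)%R) -> jet w 0 b1 b2 b3 ->
  (Cmod b1 ^ 2 + Cmod (b2 + xi * b1) ^ 2 + Cmod (b3 + xi * b2) ^ 2 <= 1 + Cmod xi ^ 2)%R.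
Proof.
  intros Hw Hb Hj.
  set (g := fun u => w u * (1 + xi * u)).
  assert (Hlin : forall u, exists l, cderiv (fun u => 1 + xi * u) u l).
  { intros u. eexists. apply cderiv_plus; [apply cderiv_const|].
    apply cderiv_mult; [apply cderiv_const | apply cderiv_id]. }
  assert (Hg : holo g 1).
  { intros u Hu. destruct (Hw u Hu) as [l Hl]. destruct (Hlin u) as [m Hm].
    eexists. apply (cderiv_mult w (fun u => 1 + xi * u)); eassumption. }
  destruct (taylor g 1 Rlt_0_1 Hg) as [a [Ha Hm]].
  assert (Jg : jet g 0 b1 (b2 + xi * b1) (b3 + xi * b2)).
  { eapply jet_eq.
    - apply jet_mult; [exact Hj|].
      apply jet_plus; [apply jet_const|]. apply jet_mult; [apply jet_const | apply jet_id].
    - ring.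
    - ring.
    - ring.
    - ring. }
  destruct (jet_unique _ _ _ _ _ _ _ _ _ (series_jet a g 1 Rlt_0_1 (fun u _ => Ha u)) Jg)
    as [E0 [E1 [E2 E3]]].
  set (X := (Cmod b1 ^ 2)%R). set (Y := (Cmod (b2 + xi * b1) ^ 2)%R). set (Z := (Cmod (b3 + xi * b2) ^ 2)%R).
  set (K := (Cmod xi ^ 2)%R).
  assert (PX : (0 <= X)%R) by apply pow2_ge_0. assert (PY : (0 <= Y)%R) by apply pow2_ge_0.
  assert (PZ : (0 <= Z)%R) by apply pow2_ge_0. assert (PK : (0 <= K)%R) by apply pow2_ge_0.
  assert (Hrr : forall r, (0 < r < 1)%R -> ((X + Y + Z) * r ^ 6 <= 1 + K)%R).
  { intros r Hr.
    assert (Cw : cont_circle g r).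
    { apply cont_circle_cderiv. intros u Hu. apply Hg. lra. }
    assert (Cq : cont_circle (fun u => 1 + xi * u) r).
    { apply cont_circle_cderiv. intros u _. apply Hlin. }
    pose proof (bessel g a r 4 ltac:(lra) Cw (fun k => Hm k r Hr)) as B.
    cbn [rsum] in B. rewrite E0, E1, E2, E3, Cmod_0 in B. fold X Y Z in B.
    set (q := fun u => (1 + xi * u) * Cconj (1 + xi * u)).
    assert (Mq : mean q r = RtoC (1 + K * r ^ 2)).
    { assert (Cl : cont_circle (fun u => xi * u) r).
      { apply cont_circle_mult; [apply cont_circle_const | intros u _; apply ccont_id]. }
      assert (Ml : mean (fun u => xi * u) r = 0).
      { rewrite mean_scal; [|lra|intros u _; apply ccont_id].
        rewrite (mean_value (fun u => u) 1 0 r); [ring | lra | lra | intros u _; apply ccont_id |].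
        intros u _ _. exists 1. apply cderiv_id. }
      transitivity (mean (fun u => RtoC (1 + K * r ^ 2) + (xi * u + Cconj (xi * u))) r).
      - apply mean_ext; [lra|]. intros u Hu. unfold q.
        assert (E : (xi * u) * Cconj (xi * u) = RtoC (K * r ^ 2)).
        { rewrite <- Cmod2_conj. f_equal. rewrite Cmod_mult, Hu. unfold K. ring. }
        rewrite RtoC_plus, <- E, Cplus_conj.
        replace (Cconj 1) with (RtoC 1) by (apply injective_projections; simpl; ring). ring.
      - rewrite mean_plus; [|lra|apply cont_circle_const|].
        2:{ apply cont_circle_plus; [exact Cl | now apply cont_circle_Cconj]. }
        rewrite (mean_plus (fun u => xi * u) (fun u => Cconj (xi * u)));
          [|lra|exact Cl | now apply cont_circle_Cconj].
        rewrite (mean_Cconj (fun u => xi * u)); [|lra|exact Cl]. rewrite Ml, mean_cst.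
        replace (Cconj 0) with (RtoC 0) by (apply injective_projections; simpl; ring).
        now rewrite !Cplus_0_r. }
    assert (Cqq : cont_circle q r)
      by (apply cont_circle_mult; [exact Cq | now apply cont_circle_Cconj]).
    assert (Cgg : cont_circle (fun u => g u * Cconj (g u)) r)
      by (apply cont_circle_mult; [exact Cw | now apply cont_circle_Cconj]).
    assert (D : (0 <= Re (mean (fun u => q u + (-(1)) * (g u * Cconj (g u)))%C r))%R).
    { apply mean_Re_ge_0; [lra | |].
      - apply cont_circle_plus; [exact Cqq|]. apply cont_circle_mult; [apply cont_circle_const | exact Cgg].
      - intros u Hu. unfold q. rewrite <- !Cmod2_conj.
        replace (RtoC (Cmod (1 + xi * u) ^ 2) + - (1) * RtoC (Cmod (g u) ^ 2))
          with (RtoC (Cmod (1 + xi * u) ^ 2 - Cmod (g u) ^ 2)) by (rewrite RtoC_minus; ring).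
        rewrite re_RtoC. unfold g. rewrite Cmod_mult.
        specialize (Hb u ltac:(lra)). pose proof (Cmod_ge_0 (w u)) as P0.
        pose proof (pow2_ge_0 (Cmod (1 + xi * u))) as P1. rewrite Rpow_mult_distr.
        assert (Cmod (w u) ^ 2 <= 1)%R by (rewrite <- (pow1 2); apply pow_incr; lra). nra. }
    rewrite mean_plus, mean_scal, Mq in D; try lra; [|exact Cgg|exact Cqq|].
    2:{ apply cont_circle_mult; [apply cont_circle_const | exact Cgg]. }
    replace (RtoC (1 + K * r ^ 2) + - (1) * mean (fun u => g u * Cconj (g u)) r)
      with (RtoC (1 + K * r ^ 2) - mean (fun u => g u * Cconj (g u)) r) in D by ring.
    set (m := mean (fun u => g u * Cconj (g u)) r) in *.
    rewrite Re_minus, re_RtoC in D.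
    assert (r2 : (0 <= r * r <= 1)%R) by nra.
    assert (r4 : (r * r * (r * r) <= r * r)%R) by nra.
    assert (r6 : (r * r * (r * r) * (r * r) <= r * r * (r * r))%R).
    { rewrite <- (Rmult_1_r (r * r * (r * r))) at 2. apply Rmult_le_compat_l; nra. }
    assert (KK : (K * (r * r) <= K)%R) by nra.
    assert (XX : (X * (r * r * (r * r) * (r * r)) <= X * (r * r))%R) by (apply Rmult_le_compat_l; lra).
    assert (YY : (Y * (r * r * (r * r) * (r * r)) <= Y * (r * r * (r * r)))%R) by (apply Rmult_le_compat_l; lra).
    replace ((X + Y + Z) * r ^ 6)%R with (X * (r * r * (r * r) * (r * r)) + Y * (r * r * (r * r) * (r * r))
       + Z * (r * r * (r * r) * (r * r)))%R by ring.
    ring_simplify in B. ring_simplify in D. nra. }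
  apply le_epsilon. intros e He. set (T := (X + Y + Z)%R) in *.
  set (dl := Rmin (/ 2) (e / (6 * (T + 1)))).
  assert (HT : (0 <= T)%R) by (unfold T; lra).
  assert (Hdl : (0 < dl)%R) by (apply Rmin_glb_lt; [lra | apply Rdiv_lt_0_compat; lra]).
  assert (D1 : (dl <= / 2)%R) by apply Rmin_l.
  assert (D2 : (dl <= e / (6 * (T + 1)))%R) by apply Rmin_r.
  specialize (Hrr (1 - dl)%R ltac:(lra)).
  (* Bernoulli's inequality for the sixth power of [r = 1 - dl]. *)
  assert (B6 : (1 - 6 * dl <= (1 - dl) ^ 6)%R).
  { assert (Q1 : (1 - 2 * dl <= (1 - dl) ^ 2)%R) by nra.
    assert (Q2 : (1 - 3 * dl <= (1 - dl) ^ 3)%R) by nra.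
    replace ((1 - dl) ^ 6)%R with ((1 - dl) ^ 3 * (1 - dl) ^ 3)%R by ring.
    assert (0 <= (1 - dl) ^ 3)%R by (apply pow_le; lra).
    destruct (Rle_dec 0 (1 - 3 * dl)); nra. }
  assert (D3 : (6 * dl * T <= e)%R).
  { apply (Rmult_le_compat_r (6 * (T + 1))) in D2; [|lra].
    replace (e / (6 * (T + 1)) * (6 * (T + 1)))%R with e in D2 by (field; lra). nra. }
  nra.
Qed.

(** The second estimate comes from [xi = conj b1 * b2 / d] with [d = 1 - |b1|^2], which
    maximizes the gap; it turns the inequality into [|b2|^2 / d <= d]. *)
Lemma schwarz_coef (w : C -> C) (b1 b2 b3 : C) : holo w 1 ->
  (forall z, (Cmod z < 1)%R -> (Cmod (w z) <= 1)%R) -> jet w 0 b1 b2 b3 ->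
  (Cmod b1 ^ 2 + Cmod b2 ^ 2 + Cmod b3 ^ 2 <= 1)%R /\ (Cmod b2 <= 1 - Cmod b1 ^ 2)%R.
Proof.
  intros Hw Hb Hj.
  assert (A : (Cmod b1 ^ 2 + Cmod b2 ^ 2 + Cmod b3 ^ 2 <= 1)%R).
  { pose proof (schwarz_bessel w b1 b2 b3 0 Hw Hb Hj) as H.
    rewrite !Cmult_0_l, !Cplus_0_r, Cmod_0 in H. lra. }
  split; [exact A|].
  set (x := Cmod b1) in *. set (y := Cmod b2) in *.
  pose proof (Cmod_ge_0 b1) as Px. pose proof (Cmod_ge_0 b2) as Py. fold x in Px. fold y in Py.
  pose proof (pow2_ge_0 (Cmod b3)) as P3. pose proof (pow2_ge_0 y) as Py2.
  set (d := (1 - x ^ 2)%R).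
  destruct (Req_dec d 0) as [Hd|Hd].
  { assert (y ^ 2 <= 0)%R by (unfold d in Hd; lra). nra. }
  assert (Hd0 : (0 < d)%R) by (unfold d in *; lra).
  pose proof (schwarz_bessel w b1 b2 b3 (Cconj b1 * b2 / RtoC d) Hw Hb Hj) as H.
  assert (Hdc : RtoC d <> 0) by (intros E; apply RtoC_inj in E; lra).
  assert (F : b2 + Cconj b1 * b2 / RtoC d * b1 = b2 / RtoC d).
  { assert (E : b1 * Cconj b1 = 1 - RtoC d).
    { rewrite <- Cmod2_conj. fold x. rewrite <- RtoC_minus. f_equal. unfold d. ring. }
    transitivity (b2 * (RtoC d + b1 * Cconj b1) / RtoC d); [field; exact Hdc|].
    rewrite E. field. exact Hdc. }
  rewrite F, !Cmod_div, Cmod_mult, Cmod_conj, Cmod_R, Rabs_pos_eq in H by (assumption || lra).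
  fold x y in H.
  pose proof (pow2_ge_0 (Cmod (b3 + Cconj b1 * b2 / RtoC d * b2))) as P4.
  assert (H1 : (x ^ 2 + (y / d) ^ 2 <= 1 + (x * y / d) ^ 2)%R) by lra.
  assert (H2 : (y ^ 2 <= d ^ 2)%R).
  { assert (G : ((y / d) ^ 2 * d <= d)%R).
    { assert (Ex : (x ^ 2 = 1 - d)%R) by (unfold d; ring).
      replace ((x * y / d) ^ 2)%R with (x ^ 2 * (y / d) ^ 2)%R in H1 by (field; lra).
      rewrite Ex in H1. lra. }
    apply (Rmult_le_compat_r d) in G; [|lra].
    replace ((y / d) ^ 2 * d * d)%R with (y ^ 2)%R in G by (field; lra). lra. }
  destruct (Rle_dec y d); [assumption | nra].
Qed.

(** * The Hankel determinant in Taylor coefficients *)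

Lemma slope_series (a : nat -> C) (f : C -> C) (R0 : R) (l : C) : (0 < R0)%R ->
  series_on a f R0 -> f 0 = 0 -> a 1%nat = l -> series_on (fun k => a (S k)) (slope f 0 l) R0.
Proof.
  intros HR Ha Hf0 <- u Hud.
  destruct (classic (u = 0)) as [->|Hu].
  - rewrite slope_at. apply (cser_at_0 (fun k => a (S k))).
  - pose proof (Ha u Hud) as Hs. assert (Ea0 : a O = 0) by (rewrite <- (series_at_0 a f R0 HR Ha); exact Hf0).
    replace (f u) with (a O * u ^ 0 + f u) in Hs by (rewrite Ea0; ring).
    apply (cser_shift (fun k => a k * u ^ k)) in Hs. apply (cser_scal (/ u)) in Hs.
    rewrite slope_off, Hf0 by exact Hu.
    replace ((f u - 0) / (u - 0)) with (/ u * f u)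
      by (replace (u - 0) with u by ring; field; exact Hu).
    eapply cser_ext; [|exact Hs]. intros k. simpl. field. exact Hu.
Qed.

(** With [E = F w / w = exp (2 sum G_n w^n)] and [phi u = f u / u], the equation
    [f (F w) = w] reads [phi (F w) * E w = 1].  Its coefficients of order one, two
    and three determine successively [G 1], [G 2] and [G 3]. *)
Lemma hankel_formula (f F : C -> C) (G : nat -> C) (a : nat -> C) (R0 : R) : (0 < R0)%R ->
  series_on a f R0 -> f 0 = 0 -> a 1%nat = 1 ->
  local_inverse f F -> log_coefficients F G ->
  4 * hankel21 G = a 2%nat * a 4%nat - a 2%nat ^ 2 * a 3%nat + 13 / 12 * a 2%nat ^ 4 - a 3%nat ^ 2.
Proof.
  intros HR Ha Hf0 Ha1 [HF0 [HFl _]] HG.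
  apply (proj1 (locally_Cmod 0 _)) in HFl. destruct HFl as [d1 [Hd1 HFl]].
  apply (proj1 (locally_Cmod 0 _)) in HG. destruct HG as [d2 [Hd2 HG]].
  set (L := fun w => Clog (F w / w)).
  assert (Ea0 : a O = 0) by (rewrite <- (series_at_0 a f R0 HR Ha); exact Hf0).
  set (b := fun n => match n with O => RtoC 0 | S k => 2 * G (S k) end).
  assert (JL : jet L 0 (2 * G 1%nat) (2 * G 2%nat) (2 * G 3%nat)).
  { apply (series_jet b L d2 Hd2). intros w Hw Hwd.
    assert (HGw : cser (fun n => 2 * G (S n) * w ^ S n) (L w)).
    { apply is_series_cser. apply HG; [|exact Hw]. replace (w - 0) with w by ring. exact Hwd. }
    replace (L w) with (b O * w ^ 0 + L w) by (simpl; ring).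
    apply (cser_shift (fun k => b k * w ^ k)). exact HGw. }
  set (d := Rmin d1 d2). assert (Hd : (0 < d)%R) by now apply Rmin_glb_lt.
  assert (HF : forall w : C, w <> 0 -> (Cmod w < d)%R -> f (F w) = w /\ F w <> 0).
  { intros w Hw Hwd. assert (W1 := Rlt_le_trans _ _ _ Hwd (Rmin_l _ _)).
    destruct (HFl w) as [_ E]; [now replace (w - 0) with w by ring|].
    split; [exact E|]. intros Z. rewrite Z, Hf0 in E. now apply Hw. }
  pose proof (jet_comp cexp L _ _ _ _ _ _ _ jet_cexp cexp_0 JL) as JE.
  pose proof (jet_mult _ _ _ _ _ _ _ _ _ _ jet_id JE) as JwE.
  set (e1 := 1 * (2 * G 1%nat)) in *.
  set (e2 := 1 * (2 * G 2%nat) + 1 / 2 * (2 * G 1%nat) ^ 2) in *.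
  set (e3 := 1 * (2 * G 3%nat) + 2 * (1 / 2) * (2 * G 1%nat) * (2 * G 2%nat) + 1 / 6 * (2 * G 1%nat) ^ 3) in *.
  assert (JF : jet F 0 1 e1 e2).
  { eapply jet_eq; [eapply (jet_ext _ F _ _ _ _ d Hd); [|exact JwE] | ring | ring | ring | ring].
    intros w Hw Hwd. destruct (HF w Hw Hwd) as [_ Z]. unfold L. rewrite cexp_Clog.
    - field. exact Hw.
    - intros E. apply Z. replace (F w) with (F w / w * w) by (field; exact Hw). rewrite E. ring. }
  set (phi := slope f 0 1).
  assert (Jphi : jet phi 1 (a 2%nat) (a 3%nat) (a 4%nat)).
  { rewrite <- Ha1. apply (series_jet (fun k => a (S k)) phi R0 HR). intros u _.
    now apply slope_series. }
  assert (Hphi0 : phi 0 = 1) by apply slope_at.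
  pose proof (jet_comp phi F _ _ _ _ _ _ _ Jphi Hphi0 JF) as JphiF.
  pose proof (jet_mult _ _ _ _ _ _ _ _ _ _ JphiF JE) as JP.
  assert (J1 : jet (fun w => phi (F w) * cexp (L w)) 1 0 0 0).
  { apply (jet_ext (fun _ => 1) _ _ _ _ _ d Hd); [|apply jet_const]. intros w Hw Hwd.
    destruct (HF w Hw Hwd) as [E Z]. unfold phi. rewrite slope_off, Hf0, E by exact Z.
    unfold L. rewrite cexp_Clog.
    - replace (F w - 0) with (F w) by ring. field. auto.
    - intros E'. apply Z. replace (F w) with (F w / w * w) by (field; exact Hw). rewrite E'. ring. }
  destruct (jet_unique _ _ _ _ _ _ _ _ _ JP J1) as [_ [Q1 [Q2 Q3]]].
  unfold e1, e2, e3 in Q1, Q2, Q3.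
  set (g1 := G 1%nat) in *. set (g2 := G 2%nat) in *. set (g3 := G 3%nat) in *.
  set (p := a 2%nat) in *. set (q := a 3%nat) in *. set (s := a 4%nat) in *.
  assert (X1 : g1 = - p / 2).
  { transitivity ((1 * (1 * (2 * g1)) + p * 1 * 1) / 2 - p / 2); [field|]. rewrite Q1. field. }
  rewrite X1 in Q2, Q3.
  assert (X2 : g2 = - (q - 3 / 2 * p ^ 2) / 2).
  { match type of Q2 with ?l = _ => transitivity (l / 2 - (q - 3 / 2 * p ^ 2) / 2) end; [field|].
    rewrite Q2. field. }
  rewrite X2 in Q3.
  assert (X3 : g3 = - (s - 4 * p * q + 10 / 3 * p ^ 3) / 2).
  { match type of Q3 with ?l = _ => transitivity (l / 2 - (s - 4 * p * q + 10 / 3 * p ^ 3) / 2) end; [field|].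
    rewrite Q3. field. }
  unfold hankel21. fold g1 g2 g3. rewrite X1, X2, X3. field.
Qed.

(** * The bound on the class *)

(** Here [x], [y], [s] are the moduli of the first three coefficients of a Schwarz
    function. *)
Lemma hankel_real_bound (x y s : R) : (0 <= x)%R -> (0 <= y)%R -> (0 <= s)%R ->
  (x ^ 2 + y ^ 2 + s ^ 2 <= 1)%R -> (y <= 1 - x ^ 2)%R ->
  (x * s / 16 + 17 / 144 * (x ^ 2 * y) + x ^ 4 / 576 + y ^ 2 / 9 <= 1 / 9)%R.
Proof.
  intros Hx Hy Hs H1 H2.
  assert (A : (x * s <= (1 - y ^ 2) / 2)%R) by (pose proof (pow2_ge_0 (x - s)); nra).
  set (t := (x ^ 2)%R) in *. assert (Ht : (0 <= t)%R) by (unfold t; nra).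
  replace (x ^ 4)%R with (t * t)%R by (unfold t; ring).
  assert (B : (t * y <= t * (1 - t))%R) by nra.
  assert (D : (y ^ 2 <= (1 - t) ^ 2)%R) by nra.
  nra.
Qed.

Lemma Cmod_sub_add_le (p : C) : (0 < Re p)%R -> (Cmod (p - 1) <= Cmod (p + 1))%R.
Proof.
  intros Hp. apply Rsqr_incr_0; try apply Cmod_ge_0. rewrite !Rsqr_pow2, !Cmod2_alt.
  destruct p as [x y]. simpl in *. nra.
Qed.

(** The coefficient comparison in [w (A + B) = A - B] gives [a2 = b1 / 2],
    [a3 = (b2 + b1^2) / 3] and
    [a4 = b3 / 8 + b1 b2 / 8 + (b1 b2 + b1^3) / 4]. *)
Lemma KS_hankel_bound (f F : C -> C) (G : nat -> C) :
  class_KS f -> local_inverse f F -> log_coefficients F G ->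
  (Cmod (hankel21 G) <= 1 / 36)%R.
Proof.
  intros [[Hd [Hf0 Hf1]] Hks] HF HG.
  assert (Hf : holo f 1).
  { intros z Hz. apply C_differentiable_at_cderiv, Hd, Hz. }
  destruct (taylor f 1 Rlt_0_1 Hf) as [a [Ha _]].
  assert (D1 : forall z, (Cmod z < 1)%R -> cderiv f z (C_derive f z)).
  { intros z Hz. destruct (Hf z Hz) as [l Hl]. now rewrite (C_derive_cderiv _ _ _ Hl). }
  set (f1 := C_derive f) in *.
  pose proof (series_deriv a f f1 1 Ha D1) as Ha1.
  pose proof (series_holo _ _ _ Ha1) as Hf1h.
  assert (D2 : forall z, (Cmod z < 1)%R -> cderiv f1 z (C_derive f1 z)).
  { intros z Hz. destruct (Hf1h z Hz) as [l Hl]. now rewrite (C_derive_cderiv _ _ _ Hl). }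
  set (f2 := C_derive f1) in *.
  pose proof (series_deriv _ f1 f2 1 Ha1 D2) as Ha2.
  pose proof (series_holo _ _ _ Ha2) as Hf2h.
  assert (Ea1 : a 1%nat = 1).
  { pose proof (series_at_0 _ _ _ Rlt_0_1 Ha1) as E. cbv beta in E. rewrite Hf1 in E.
    rewrite E. simpl. ring. }
  set (p := a 2%nat) in *. set (q := a 3%nat) in *. set (s := a 4%nat) in *.
  assert (J1 : jet f1 1 (2 * p) (3 * q) (4 * s)).
  { eapply jet_eq; [exact (series_jet _ f1 1 Rlt_0_1 (fun w _ => Ha1 w)) | | | | ]; cbv beta; fold p q s.
    - rewrite Ea1. simpl. ring.
    - now rewrite INR_IZR_INZ.
    - now rewrite INR_IZR_INZ.
    - now rewrite INR_IZR_INZ. }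
  assert (J2 : exists c, jet f2 (2 * p) (6 * q) (12 * s) c).
  { eexists. eapply jet_eq; [exact (series_jet _ f2 1 Rlt_0_1 (fun w _ => Ha2 w)) | | | | reflexivity];
      cbv beta; fold p q s; rewrite Cmult_assoc, <- RtoC_mult, !INR_IZR_INZ, <- mult_IZR; reflexivity. }
  destruct J2 as [c J2].
  set (A := fun z => 2 * (f1 z + z * f2 z)). set (B := fun z => f1 z + f1 (- z)).
  assert (EA : forall z, (Cmod z < 1)%R -> C_derive (fun u => u * f1 u) z = f1 z + z * f2 z).
  { intros z Hz. apply C_derive_cderiv. eapply cderiv_eq.
    - apply (cderiv_mult (fun u => u) f1); [apply cderiv_id | now apply D2].
    - cbv beta. ring. }
  assert (EB : forall z, (Cmod z < 1)%R -> C_derive (fun u => f u - f (- u)) z = B z).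
  { intros z Hz. apply C_derive_cderiv. eapply cderiv_eq.
    - apply (cderiv_minus f (fun u => f (- u))); [now apply D1|].
      apply (cderiv_comp (fun u => - u) f).
      + apply (cderiv_ext_loc (fun u => 0 - u) _ z _ 1 Rlt_0_1); [intros; ring|].
        apply cderiv_minus; [apply cderiv_const | apply cderiv_id].
      + apply D1. now rewrite Cmod_opp.
    - unfold B. ring. }
  assert (Hp : forall z, (Cmod z < 1)%R -> B z <> 0 /\ (0 < Re (A z / B z))%R).
  { intros z Hz. specialize (Hks z Hz). rewrite EA, EB in Hks by exact Hz.
    (* If [B z] were zero the quotient would be zero, against strict positivity. *)
    split.
    - intros Z. rewrite Z in Hks. revert Hks. unfold Cdiv.
      replace (/ 0) with (RtoC 0).
      + rewrite Cmult_0_r. simpl. lra.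
      + apply injective_projections; simpl; unfold Rdiv; ring.
    - replace (A z / B z) with (RtoC 2 * ((f1 z + z * f2 z) / B z)) by (unfold A, Cdiv; ring).
      rewrite re_scal_l. lra. }
  set (w := fun z => (A z - B z) / (A z + B z)).
  assert (Hw : forall z, (Cmod z < 1)%R -> A z + B z <> 0 /\ (Cmod (w z) <= 1)%R).
  { intros z Hz. destruct (Hp z Hz) as [HB HRe].
    assert (N : A z / B z + 1 <> 0).
    { intros Z. assert (E : Re (A z / B z + 1) = 0%R) by (rewrite Z; reflexivity).
      change (Re (A z / B z) + 1 = 0)%R in E. lra. }
    assert (E1 : A z + B z = (A z / B z + 1) * B z) by (field; exact HB).
    assert (N2 : A z + B z <> 0) by (rewrite E1; now apply Cmult_neq_0).
    split; [exact N2|]. unfold w. rewrite Cmod_div by exact N2.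
    apply Rle_div_l; [now apply Cmod_gt_0|]. rewrite Rmult_1_l, E1.
    replace (A z - B z) with ((A z / B z - 1) * B z) by (field; exact HB).
    rewrite !Cmod_mult. apply Rmult_le_compat_r; [apply Cmod_ge_0 | now apply Cmod_sub_add_le]. }
  assert (HA : holo A 1).
  { intros z Hz. destruct (Hf2h z Hz) as [l Hl]. eexists.
    apply cderiv_mult; [apply cderiv_const|]. apply cderiv_plus; [now apply D2|].
    apply cderiv_mult; [apply cderiv_id | exact Hl]. }
  assert (HB : holo B 1).
  { intros z Hz. eexists. apply cderiv_plus; [now apply D2|].
    apply (cderiv_comp (fun u => - u) f1).
    - apply (cderiv_ext_loc (fun u => 0 - u) _ z _ 1 Rlt_0_1); [intros; ring|].
      apply cderiv_minus; [apply cderiv_const | apply cderiv_id].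
    - apply D2. now rewrite Cmod_opp. }
  assert (Hwh : holo w 1).
  { intros z Hz. destruct (HA z Hz) as [l Hl]. destruct (HB z Hz) as [m Hm]. eexists.
    apply (cderiv_div (fun z => A z - B z) (fun z => A z + B z)); [now apply Hw | |].
    - apply cderiv_minus; eassumption.
    - apply cderiv_plus; eassumption. }
  destruct (taylor w 1 Rlt_0_1 Hwh) as [b [Hb _]].
  pose proof (series_jet b w 1 Rlt_0_1 (fun u _ => Hb u)) as Jw.
  assert (JA : jet A 2 (8 * p) (18 * q) (32 * s)).
  { eapply jet_eq; [apply jet_mult; [apply jet_const|]; apply jet_plus; [exact J1|];
      apply jet_mult; [apply jet_id | exact J2] | ring | ring | ring | ring]. }
  assert (Jn : jet (fun u => - u) 0 (-(1)) 0 0).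
  { apply (jet_ext (poly3 0 (-(1)) 0 0) _ _ _ _ _ 1 Rlt_0_1); [intros; unfold poly3; ring | apply jet_poly3]. }
  assert (JB : jet B 2 0 (6 * q) 0).
  { eapply jet_eq; [apply jet_plus; [exact J1|]; apply (jet_comp f1 (fun u => - u)); [exact J1 | exact Hf1 | exact Jn]
     | ring | ring | ring | ring]. }
  assert (JN : jet (fun z => A z - B z) 0 (8 * p) (12 * q) (32 * s)).
  { apply (jet_ext (fun z => A z + (-(1)) * B z) _ _ _ _ _ 1 Rlt_0_1); [intros; ring|].
    eapply jet_eq; [apply jet_plus; [exact JA|]; apply jet_mult; [apply jet_const | exact JB] | ring | ring | ring | ring]. }
  pose proof (jet_mult _ _ _ _ _ _ _ _ _ _ Jw (jet_plus _ _ _ _ _ _ _ _ _ _ JA JB)) as JN'.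
  apply (jet_ext _ (fun z => A z - B z) _ _ _ _ 1 Rlt_0_1) in JN'.
  2:{ intros z _ Hz. unfold w. field. now apply Hw. }
  destruct (jet_unique _ _ _ _ _ _ _ _ _ JN' JN) as [Q0 [Q1 [Q2 Q3]]].
  set (b0 := b 0%nat) in *. set (b1 := b 1%nat) in *. set (b2 := b 2%nat) in *. set (b3 := b 3%nat) in *.
  assert (X0 : b0 = 0).
  { transitivity (b0 * (2 + 2) / 4); [field|]. rewrite Q0. field. }
  rewrite X0 in *.
  assert (X1 : p = b1 / 2).
  { transitivity (8 * p / 8); [field|]. rewrite <- Q1. field. }
  rewrite X1 in Q2, Q3.
  assert (X2 : q = (b2 + b1 ^ 2) / 3).
  { transitivity (12 * q / 12); [field|]. rewrite <- Q2. field. }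
  rewrite X2 in Q3.
  assert (X3 : s = b3 / 8 + b1 * b2 / 8 + (b1 * b2 + b1 ^ 3) / 4).
  { transitivity (32 * s / 32); [field|]. rewrite <- Q3. field. }
  pose proof (hankel_formula f F G a 1 Rlt_0_1 Ha Hf0 Ea1 HF HG) as H4. fold p q s in H4.
  assert (H5 : 4 * hankel21 G = b1 * b3 / 16 - 17 / 144 * (b1 ^ 2 * b2) - b1 ^ 4 / 576 - b2 ^ 2 / 9).
  { rewrite H4, X1, X2, X3. field. }
  destruct (schwarz_coef w b1 b2 b3 Hwh (fun z Hz => proj2 (Hw z Hz)) Jw) as [S1 S2].
  pose proof (hankel_real_bound (Cmod b1) (Cmod b2) (Cmod b3) (Cmod_ge_0 _) (Cmod_ge_0 _) (Cmod_ge_0 _) S1 S2) as HB4.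
  assert (H6 : (Cmod (4 * hankel21 G) <= 1 / 9)%R).
  { rewrite H5. eapply Rle_trans; [|exact HB4].
    assert (T : forall (k : R) (u : C), (0 <= k)%R -> Cmod (RtoC k * u) = (k * Cmod u)%R).
    { intros k u Hk. now rewrite Cmod_mult, Cmod_R, Rabs_pos_eq. }
    replace (b1 * b3 / 16 - 17 / 144 * (b1 ^ 2 * b2) - b1 ^ 4 / 576 - b2 ^ 2 / 9)
      with (RtoC (/ 16) * (b1 * b3) - RtoC (17 / 144) * (b1 ^ 2 * b2) - RtoC (/ 576) * b1 ^ 4 - RtoC (/ 9) * b2 ^ 2).
    2:{ rewrite RtoC_div, !RtoC_inv by lra. field. }
    eapply Rle_trans; [apply Cmod_triangle_minus|].
    eapply Rle_trans; [apply Rplus_le_compat_r, Cmod_triangle_minus|].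
    eapply Rle_trans; [apply Rplus_le_compat_r, Rplus_le_compat_r, Cmod_triangle_minus|].
    rewrite !T, !Cmod_mult, !Cmod_pow by lra. lra. }
  rewrite Cmod_mult, Cmod_R, Rabs_pos_eq in H6 by lra. lra.
Qed.

(** * Existence of logarithmic coefficients *)

Lemma Clog_1 : Clog 1 = 0.
Proof.
  rewrite <- cexp_0. apply Clog_cexp. simpl. pose proof PI_RGT_0. lra.
Qed.

(** [F w / w], completed by [1] at the origin, is holomorphic and near [1] for small
    [w], so that its principal logarithm has a Taylor series. *)
Lemma log_coefficients_exist (F : C -> C) (R0 : R) : (0 < R0)%R -> holo F R0 -> F 0 = 0 ->
  cderiv F 0 1 -> exists G, log_coefficients F G.
Proof.
  intros HR HF HF0 HF1. destruct (taylor F R0 HR HF) as [A [HA _]].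
  assert (EA : A 1%nat = 1).
  { destruct (series_deriv_ex A F R0 HA 0) as [l [Hl Hd]]; [rewrite Cmod_0; exact HR|].
    assert (l = 1) as -> by (rewrite <- (C_derive_cderiv _ _ _ Hd); now apply C_derive_cderiv).
    pose proof (cser_unique _ _ _ Hl (cser_at_0 (fun k => INR (S k) * A (S k)))) as E.
    cbv beta in E. simpl INR in E. rewrite Cmult_1_l in E. now symmetry. }
  set (g := slope F 0 1).
  pose proof (series_holo _ _ _ (slope_series A F R0 1 HR HA HF0 EA)) as Hg. fold g in Hg.
  assert (g0 : g 0 = 1) by apply slope_at.
  destruct (Hg 0 ltac:(rewrite Cmod_0; exact HR)) as [l Hl]. apply cderiv_ccont in Hl.
  destruct (Hl 1%R Rlt_0_1) as [d [Hd Hnear]]. rewrite g0 in Hnear.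
  set (rho := Rmin R0 d). assert (Hrho : (0 < rho)%R) by now apply Rmin_glb_lt.
  set (L := fun w => Clog (g w)).
  assert (HL : holo L rho).
  { intros w Hw. assert (W1 := Rlt_le_trans _ _ _ Hw (Rmin_l _ _)).
    assert (W2 := Rlt_le_trans _ _ _ Hw (Rmin_r _ _)).
    destruct (Hg w W1) as [m Hm]. eexists. apply (cderiv_comp g Clog); [exact Hm|]. apply cderiv_Clog.
    specialize (Hnear w ltac:(now replace (w - 0) with w by ring)).
    pose proof (Rabs_Re_le (g w - 1)) as B. rewrite Re_minus, re_RtoC in B.
    apply Rabs_le_between in B. lra. }
  destruct (taylor L rho Hrho HL) as [c [Hc _]].
  assert (c0 : c O = 0).
  { rewrite <- (series_at_0 c L rho Hrho Hc). unfold L. rewrite g0. apply Clog_1. }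
  exists (fun n => c n / 2). apply locally_Cmod. exists rho. split; [exact Hrho|].
  intros w Hw Hw0. replace (w - 0) with w in Hw by ring. apply is_series_cser.
  pose proof (Hc w Hw) as Hs. unfold L, g in Hs. rewrite slope_off, HF0 in Hs by exact Hw0.
  replace ((F w - 0) / (w - 0)) with (F w / w) in Hs
    by (replace (w - 0) with w by ring; field; exact Hw0).
  replace (Clog (F w / w)) with (c O * w ^ 0 + Clog (F w / w)) in Hs by (rewrite c0; ring).
  apply (cser_shift (fun k => c k * w ^ k)) in Hs.
  eapply cser_ext; [|exact Hs]. intros k. cbv beta. field.
Qed.

(** * The extremal function *)

Lemma geometric_series (z : C) : (Cmod z < 1)%R -> cser (fun k => z ^ k) (/ (1 - z)).
Proof.
  intros Hz. assert (H1 : 1 - z <> 0).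
  { apply Cmod_gt_0. pose proof (Cmod_minus_ge 1 z). rewrite Cmod_1 in *. lra. }
  apply Cmod_gt_0 in H1 as Hm. pose proof (Cmod_ge_0 z) as P0.
  assert (E : forall n, csum (fun k => z ^ k) n - / (1 - z) = - (z ^ n * / (1 - z))).
  { induction n as [|n IH]; cbn [csum]; [simpl; ring|].
    replace (csum (fun k => z ^ k) n) with (csum (fun k => z ^ k) n - / (1 - z) + / (1 - z)) by ring.
    rewrite IH. simpl. field. exact H1. }
  intros e He.
  destruct (pow_lt_1_zero (Cmod z) ltac:(rewrite Rabs_pos_eq; lra) (e * Cmod (1 - z))%R
    ltac:(now apply Rmult_lt_0_compat)) as [N HN].
  exists N. intros n Hn. specialize (HN n Hn). rewrite Rabs_pos_eq in HN by now apply pow_le.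
  rewrite E, Cmod_opp, Cmod_mult, Cmod_pow, Cmod_inv by exact H1.
  now apply Rlt_div_l.
Qed.

Lemma disk_1_minus (z : C) : (Cmod z < 1)%R -> 1 - z <> 0.
Proof. intros Hz Z. pose proof (Cmod_minus_ge 1 z) as H. rewrite Z, Cmod_0, Cmod_1 in H. lra. Qed.

Lemma disk_1_plus (z : C) : (Cmod z < 1)%R -> 1 + z <> 0.
Proof.
  intros Hz. replace (1 + z) with (1 - (- z)) by ring. apply disk_1_minus. now rewrite Cmod_opp.
Qed.

Lemma disk_1_minus_sqr (z : C) : (Cmod z < 1)%R -> 1 - z * z <> 0.
Proof.
  intros Hz. replace (1 - z * z) with ((1 - z) * (1 + z)) by ring.
  apply Cmult_neq_0; [now apply disk_1_minus | now apply disk_1_plus].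
Qed.

Lemma Re_div (x y : C) : y <> 0 -> Re (x / y) = (Re (x * Cconj y) / Cmod y ^ 2)%R.
Proof.
  intros Hy. assert (N : RtoC (Cmod y ^ 2) <> 0).
  { intros E. apply RtoC_inj in E. apply Cmod_gt_0 in Hy. nra. }
  assert (Hc : Cconj y <> 0).
  { intros E. apply Hy. rewrite <- (Cconj_conj y), E. apply injective_projections; simpl; ring. }
  replace (x / y) with (x * Cconj y * RtoC (/ Cmod y ^ 2)).
  - apply re_scal_r.
  - rewrite RtoC_inv, Cmod2_conj.
    + field. split; assumption.
    + intros E. apply N. now rewrite E.
Qed.

Lemma Re_div_pos (x y : C) : y <> 0 -> (0 < Re (x * Cconj y))%R -> (0 < Re (x / y))%R.
Proof.
  intros Hy Hp. rewrite Re_div by exact Hy. apply Rdiv_lt_0_compat; [exact Hp|].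
  apply pow_lt. now apply Cmod_gt_0.
Qed.

Lemma disk_sqr (z : C) : (Cmod z < 1)%R -> (Re z ^ 2 + Im z ^ 2 < 1)%R.
Proof. intros Hz. rewrite <- Cmod2_alt. pose proof (Cmod_ge_0 z). nra. Qed.

Lemma cayley_right (z : C) : (Cmod z < 1)%R -> (0 < Re ((1 + z) / (1 - z)))%R.
Proof.
  intros Hz. apply Re_div_pos; [now apply disk_1_minus|].
  pose proof (disk_sqr z Hz) as H. destruct z as [x y]. simpl in *. nra.
Qed.

Lemma cderiv_h3 (z : C) : (Cmod z < 1)%R -> cderiv h3 z (/ (1 - z * z)).
Proof.
  intros Hz. pose proof (disk_1_minus z Hz) as H1. pose proof (disk_1_plus z Hz) as H2.
  pose proof (disk_1_minus_sqr z Hz) as H3.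
  eapply cderiv_eq.
  - apply (cderiv_mult (fun _ => 1 / 2) (fun z => Clog ((1 + z) / (1 - z)))); [apply cderiv_const|].
    apply (cderiv_comp (fun z => (1 + z) / (1 - z)) Clog).
    + apply (cderiv_div (fun z => 1 + z) (fun z => 1 - z)); [exact H1 | |].
      * apply cderiv_plus; [apply cderiv_const | apply cderiv_id].
      * apply cderiv_minus; [apply cderiv_const | apply cderiv_id].
    + apply cderiv_Clog. now apply cayley_right.
  - cbv beta. field. auto.
Qed.

Lemma h3_0 : h3 0 = 0.
Proof.
  unfold h3. replace ((1 + 0) / (1 - 0)) with (RtoC 1) by field. rewrite Clog_1. ring.
Qed.

(** The coefficients [0, 1, 0, 1/3, 0, 1/5, ...]: the sign term filters the odd
    exponents. *)
Definition h3_coef (n : nat) : C :=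
  match n with O => 0 | S k => (1 + (-(1)) ^ k) / (2 * INR (S k)) end.

(** The derivative [1 / (1 - z^2)] is half the sum of two geometric series; the
    coefficients of [h3] follow by uniqueness. *)
Lemma h3_series : series_on h3_coef h3 1.
Proof.
  destruct (taylor h3 1 Rlt_0_1) as [a [Ha _]].
  { intros z Hz. eexists. now apply cderiv_h3. }
  pose proof (series_deriv a h3 _ 1 Ha cderiv_h3) as Hd.
  assert (Hg : series_on (fun k => (1 + (-(1)) ^ k) / 2) (fun z => / (1 - z * z)) 1).
  { intros z Hz. pose proof (disk_1_minus z Hz). pose proof (disk_1_plus z Hz).
    pose proof (disk_1_minus_sqr z Hz).
    replace (/ (1 - z * z)) with (1 / 2 * (/ (1 - z) + / (1 - - z))).
    - pose proof (cser_scal (1 / 2) _ _ (cser_plus _ _ _ _ (geometric_series z Hz)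
        (geometric_series (- z) ltac:(now rewrite Cmod_opp)))) as S0.
      eapply cser_ext; [|exact S0]. intros k. cbv beta.
      replace (- z) with (-(1) * z) by ring. rewrite Cpow_mult_l. field.
    - replace (1 - - z) with (1 + z) by ring. field. auto. }
  assert (E : forall k, a k = h3_coef k).
  { intros [|k].
    - simpl. rewrite <- (series_at_0 a h3 1 Rlt_0_1 Ha). apply h3_0.
    - pose proof (series_unique _ _ _ 1 Rlt_0_1 Hd Hg k) as E. cbv beta in E.
      assert (N : RtoC (INR (S k)) <> 0).
      { intros Z. apply RtoC_inj in Z. apply (not_0_INR (S k)); [lia | exact Z]. }
      cbn [h3_coef]. replace (a (S k)) with (INR (S k) * a (S k) / INR (S k)) by (field; exact N).
      rewrite E. field. exact N. }
  intros z Hz. eapply cser_ext; [|exact (Ha z Hz)]. intros k. cbv beta. now rewrite E.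
Qed.

Lemma h3_odd_series (z : C) : in_disk z ->
  @is_series C_AbsRing C_NormedModule (fun n => z ^ (2 * n + 1) / INR (2 * n + 1)) (h3 z).
Proof.
  intros Hz. apply is_series_cser. intros e He. destruct (h3_series z Hz e He) as [N HN].
  assert (E : forall n, csum (fun n => z ^ (2 * n + 1) / INR (2 * n + 1)) n
     = csum (fun k => h3_coef k * z ^ k) (2 * n + 1)).
  { induction n as [|n IH].
    - simpl. ring.
    - replace (2 * S n + 1)%nat with (S (S (2 * n + 1))) by lia. cbn [csum]. rewrite IH.
      replace (2 * n + 1)%nat with (S (2 * n)) by lia. cbn [h3_coef].
      assert (N1 : RtoC (INR (S (2 * n))) <> 0).
      { intros Z. apply RtoC_inj in Z. apply (not_0_INR (S (2 * n))); [lia | exact Z]. }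
      assert (P : (-(1)) ^ (2 * n) = RtoC 1).
      { rewrite Cpow_mult_r. replace ((-(1)) ^ 2) with (RtoC 1) by (simpl; ring). apply Cpow_1_l. }
      replace ((-(1)) ^ S (2 * n)) with (- RtoC 1) by (simpl Cpow in *; rewrite P; ring).
      rewrite P.
      assert (N2 : RtoC (INR (S (S (2 * n)))) <> 0).
      { intros Z. apply RtoC_inj in Z. apply (not_0_INR (S (S (2 * n)))); [lia | exact Z]. }
      field. split; assumption. }
  (* [2 n + 1] terms of the full series contain exactly [n] odd powers. *)
  exists N. intros n Hn. rewrite E. apply HN. lia.
Qed.

(** The quotient to be tested is half of [(1 + z^2) / (1 - z^2)], the Cayley transform of
    [z^2]. *)
Lemma h3_KS : class_KS h3.
Proof.
  split; [split; [|split]|].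
  - intros z Hz. apply C_differentiable_at_cderiv. eexists. now apply cderiv_h3.
  - exact h3_0.
  - rewrite (C_derive_cderiv _ _ _ (cderiv_h3 0 ltac:(rewrite Cmod_0; lra))). field.
  - intros z Hz. unfold in_disk in Hz. pose proof (disk_1_minus_sqr z Hz) as H1.
    assert (E1 : C_derive (fun u => u * C_derive h3 u) z = (1 + z * z) / ((1 - z * z) * (1 - z * z))).
    { apply C_derive_cderiv.
      apply (cderiv_ext_loc (fun u => u / (1 - u * u)) _ z _ (1 - Cmod z)); [lra | |].
      - intros u Hu. pose proof (Cmod_minus_ge u z).
        rewrite (C_derive_cderiv _ _ _ (cderiv_h3 u ltac:(lra))). reflexivity.
      - eapply cderiv_eq.
        + apply (cderiv_div (fun u => u) (fun u => 1 - u * u)); [exact H1 | apply cderiv_id |].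
          apply cderiv_minus; [apply cderiv_const|]. apply cderiv_mult; apply cderiv_id.
        + cbv beta. field. exact H1. }
    assert (E2 : C_derive (fun u => h3 u - h3 (- u)) z = 2 / (1 - z * z)).
    { apply C_derive_cderiv. eapply cderiv_eq.
      - apply (cderiv_minus h3 (fun u => h3 (- u))); [now apply cderiv_h3|].
        apply (cderiv_comp (fun u => - u) h3).
        + apply (cderiv_ext_loc (fun u => 0 - u) _ z _ 1 Rlt_0_1); [intros; ring|].
          apply cderiv_minus; [apply cderiv_const | apply cderiv_id].
        + apply cderiv_h3. now rewrite Cmod_opp.
      - cbv beta. replace (1 - - z * - z) with (1 - z * z) by ring. field. exact H1. }
    rewrite E1, E2.
    replace ((1 + z * z) / ((1 - z * z) * (1 - z * z)) / (2 / (1 - z * z)))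
      with ((1 + z * z) / (1 - z * z) * RtoC (/ 2)) by (rewrite RtoC_inv by lra; field; exact H1).
    rewrite re_scal_r. apply Rmult_lt_0_compat; [|lra].
    apply (cayley_right (z * z)). rewrite Cmod_mult. pose proof (Cmod_ge_0 z). nra.
Qed.

Definition ctanh (w : C) : C := (cexp (2 * w) - 1) / (cexp (2 * w) + 1).

Lemma cexp_2_right (w : C) : (Cmod w < 1 / 2)%R -> (0 < Re (cexp (2 * w)))%R.
Proof.
  intros Hw. pose proof (Rabs_Im_le w) as H. apply Rabs_le_between in H.
  change (0 < exp (Re (2 * w)) * cos (Im (2 * w)))%R. rewrite im_scal_l.
  apply Rmult_lt_0_compat; [apply exp_pos|]. pose proof PI2_1. apply cos_gt_0; lra.
Qed.

Lemma ctanh_denom (w : C) : (Cmod w < 1 / 2)%R -> cexp (2 * w) + 1 <> 0.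
Proof.
  intros Hw Z. pose proof (cexp_2_right w Hw) as H.
  assert (E : Re (cexp (2 * w) + 1) = 0%R) by (rewrite Z; reflexivity).
  change (Re (cexp (2 * w)) + 1 = 0)%R in E. lra.
Qed.

Lemma cderiv_ctanh (w : C) : (Cmod w < 1 / 2)%R ->
  cderiv ctanh w (4 * cexp (2 * w) / ((cexp (2 * w) + 1) * (cexp (2 * w) + 1))).
Proof.
  intros Hw. pose proof (ctanh_denom w Hw) as H.
  assert (HE : cderiv (fun w => cexp (2 * w)) w (cexp (2 * w) * 2)).
  { apply (cderiv_comp (fun w => 2 * w) cexp); [|apply cderiv_cexp].
    eapply cderiv_eq; [apply cderiv_mult; [apply cderiv_const | apply cderiv_id] | cbv beta; ring]. }
  eapply cderiv_eq.
  - apply (cderiv_div (fun w => cexp (2 * w) - 1) (fun w => cexp (2 * w) + 1)); [exact H | |].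
    + apply cderiv_minus; [exact HE | apply cderiv_const].
    + apply cderiv_plus; [exact HE | apply cderiv_const].
  - cbv beta. field. exact H.
Qed.

Lemma ctanh_0 : ctanh 0 = 0.
Proof. unfold ctanh. rewrite Cmult_0_r, cexp_0. field. Qed.

Lemma h3_ctanh (w : C) : (Cmod w < 1 / 2)%R -> h3 (ctanh w) = w.
Proof.
  intros Hw. pose proof (ctanh_denom w Hw) as H. unfold h3.
  replace ((1 + ctanh w) / (1 - ctanh w)) with (cexp (2 * w)).
  - rewrite Clog_cexp; [field|]. rewrite im_scal_l. pose proof (Rabs_Im_le w) as B.
    apply Rabs_le_between in B. pose proof PI2_1. lra.
  - unfold ctanh. field. split; [exact H|].
    replace (cexp (2 * w) + 1 - (cexp (2 * w) - 1)) with (RtoC 2) by ring.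
    intros Z. apply RtoC_inj in Z. lra.
Qed.

Lemma ctanh_h3 (z : C) : (Cmod z < 1)%R -> ctanh (h3 z) = z.
Proof.
  intros Hz. pose proof (disk_1_minus z Hz) as H1. pose proof (disk_1_plus z Hz) as H2.
  unfold ctanh, h3. replace (2 * (1 / 2 * Clog ((1 + z) / (1 - z)))) with (Clog ((1 + z) / (1 - z))) by field.
  rewrite cexp_Clog.
  - field. split; [exact H1|]. replace (1 + z + (1 - z)) with (RtoC 2) by ring.
    intros Z. apply RtoC_inj in Z. lra.
  - intros Z. pose proof (cayley_right z Hz) as B. rewrite Z in B. simpl in B. lra.
Qed.

Lemma local_inverse_ctanh : local_inverse h3 ctanh.
Proof.
  split; [exact ctanh_0|]. split.
  - apply locally_Cmod. exists (1 / 2)%R. split; [lra|]. intros w Hw.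
    replace (w - 0) with w in Hw by ring. split; [|now apply h3_ctanh].
    apply C_differentiable_at_cderiv. eexists. now apply cderiv_ctanh.
  - apply locally_Cmod. exists 1%R. split; [lra|]. intros w Hw.
    replace (w - 0) with w in Hw by ring. now apply ctanh_h3.
Qed.

Theorem theorem2p2 :
  (forall f F : C -> C, forall G : nat -> C,
     class_KS f -> local_inverse f F -> log_coefficients F G ->
     (Cmod (hankel21 G) <= 1 / 36)%R) /\
  (forall z : C, in_disk z ->
     @is_series C_AbsRing C_NormedModule
       (fun n => z ^ (2 * n + 1) / INR (2 * n + 1)) (h3 z)) /\
  class_KS h3 /\
  (exists (F : C -> C) (G : nat -> C),
     local_inverse h3 F /\ log_coefficients F G /\
     Cmod (hankel21 G) = (1 / 36)%R).
Proof.
  split; [exact KS_hankel_bound|]. split; [exact h3_odd_series|]. split; [exact h3_KS|].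
  destruct (log_coefficients_exist ctanh (1 / 2) ltac:(lra)) as [G HG].
  - intros w Hw. eexists. now apply cderiv_ctanh.
  - exact ctanh_0.
  - eapply cderiv_eq; [apply cderiv_ctanh; rewrite Cmod_0; lra|].
    rewrite Cmult_0_r, cexp_0. field.
  - exists ctanh, G. split; [exact local_inverse_ctanh|]. split; [exact HG|].
    assert (E1 : h3_coef 1 = 1) by (simpl; field).
    pose proof (hankel_formula h3 ctanh G h3_coef 1 Rlt_0_1 h3_series h3_0 E1 local_inverse_ctanh HG) as H.
    assert (E2 : h3_coef 2 = 0) by (unfold h3_coef; rewrite INR_IZR_INZ; simpl; field).
    assert (E3 : h3_coef 3 = 1 / 3) by (unfold h3_coef; rewrite INR_IZR_INZ; simpl; field).
    rewrite E2, E3 in H.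
    assert (E : hankel21 G = RtoC (- (1 / 36))).
    { transitivity (4 * hankel21 G / 4); [field|]. rewrite H, RtoC_opp, RtoC_div by lra. field. }
    rewrite E, Cmod_R, Rabs_Ropp. apply Rabs_pos_eq. lra.
Qed.
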